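(* Let $(d_n)_{n\ge1}$ be a sequence of positive integers with $d_n\to\infty$ as $n\to\infty$. For each $n$, let $\boldsymbol{X}_{n,1},\ldots,\boldsymbol{X}_{n,n}$ be mutually independent random vectors, each uniformly distributed on $\mathbb{S}^{d_n}=\{\boldsymbol{x}\in\mathbb{R}^{d_n+1}:\boldsymbol{x}^\top\boldsymbol{x}=1\}$. For a real sequence of weights $(v_{k,d_n})_{k\ge1}$, let $\psi_n$ and $T_n$ be as defined in the context. Assume: (i) for every $n\ge1$, $$\sigma_n^2:=2\,\mathrm{E}\big[\psi_n^2(\boldsymbol{X}_{n,1}^\top\boldsymbol{X}_{n,2})\big]=2\sum_{k=1}^\infty v_{k,d_n}^4 d_{k,d_n}<\infty;$$ (ii) as $n\to\infty$, $$\sigma_n^{-4}\sum_{k=1}^\infty v_{k,d_n}^8 d_{k,d_n}=o(1)\quad\text{and}\quad \sigma_n^{-4}\,\mathrm{E}\big[\psi_n^4(\boldsymbol{X}_{n,1}^\top\boldsymbol{X}_{n,2})\big]=O(1).$$ Then $\sigma_n^{-1}T_n$ converges weakly to $\mathcal{N}(0,1)$ as $n\to\infty$.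
   Context: $C_k^{(\lambda)}$ denotes the Gegenbauer polynomial of degree $k$ and index $\lambda$ (orthogonal on $[-1,1]$ with respect to the weight $(1-x^2)^{\lambda-1/2}$). For $d\ge2$, $\psi_n:[-1,1]\to\mathbb{R}$ is defined (almost everywhere, as an $L^2$ series) by $\psi_n(x)=\sum_{k=1}^\infty\big(1+\frac{2k}{d_n-1}\big)v_{k,d_n}^2C_k^{(d_n-1)/2}(x)$ when $d_n\ge2$, and $\psi_n(x)=\sum_{k=1}^\infty 2v_{k,1}^2\cos(k\cos^{-1}(x))$ when $d_n=1$. The statistic is $T_n:=\frac{2}{n}\sum_{1\le i<j\le n}\psi_n(\boldsymbol{X}_{n,i}^\top\boldsymbol{X}_{n,j})$. For integers $k\ge1$, $d\ge1$, $d_{k,d}:=\binom{d+k-2}{d-1}+\binom{d+k-1}{d-1}$ (the dimension of the space of spherical harmonics of degree $k$ on $\mathbb{S}^d$); for $d\ge2$ it equals $\big(1+\frac{2k}{d-1}\big)\frac{\Gamma(d-1+k)}{\Gamma(d-1)k!}$. *)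

(* Defs.v *)
From HB Require Import structures.
From mathcomp Require Import all_boot all_order all_algebra.
From mathcomp Require Import all_classical all_reals all_analysis.
Set Implicit Arguments. Unset Strict Implicit. Unset Printing Implicit Defensive.
Import Order.TTheory GRing.Theory Num.Theory.
Import numFieldNormedType.Exports.
Local Open Scope classical_set_scope.
Local Open Scope ring_scope.

Section Defs.
Context {R : realType}.

(* Gegenbauer polynomials C_k^(lam)(x), standard normalisation (DLMF 18.9.1):
   C_0 = 1, C_1 = 2 lam x,
   n C_n = 2 x (n + lam - 1) C_(n-1) - (n + 2 lam - 2) C_(n-2).
   gegen_pair lam x k = (C_k(x), C_(k+1)(x)). *)
Fixpoint gegen_pair (lam x : R) (k : nat) : R * R :=
  match k with
  | 0 => (1, 2 * lam * x)
  | k'.+1 =>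
      let p := gegen_pair lam x k' in
      (p.2, (2 * x * (k'.+1%:R + lam) * p.2 - (k'%:R + 2 * lam) * p.1)
              / k'.+2%:R)
  end.

Definition gegenbauer (k : nat) (lam : R) (x : R) : R := (gegen_pair lam x k).1.

Definition dkd (k d : nat) : nat := 'C(d + k - 2, d - 1) + 'C(d + k - 1, d - 1).

Definition psi_term (v : nat -> nat -> R) (d k : nat) (x : R) : R :=
  if (2 <= d)%N then
    (1 + 2 * k%:R / (d%:R - 1)) * (v k d) ^+ 2
      * gegenbauer k ((d%:R - 1) / 2) x
  else 2 * (v k d) ^+ 2 * cos (k%:R * acos x).

Definition psi_partial (v : nat -> nat -> R) (d K : nat) (x : R) : R :=
  \sum_(1 <= k < K.+1) psi_term v d k x.

Definition inner (m : nat) (x y : m.-tuple R) : R :=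
  \sum_(j < m) tnth x j * tnth y j.

Definition unit_sphere (m : nat) : set (m.+1.-tuple R) :=
  [set x | inner x x = 1].

Definition mat_act (m : nat) (Q : 'M[R]_m) (x : m.-tuple R) : m.-tuple R :=
  [tuple \sum_(j < m) Q i j * tnth x j | i < m].

Definition orthogonal_mx (m : nat) (Q : 'M[R]_m) : Prop := Q^T *m Q = 1%:M.

Context {d0 : measure_display} {Omega : measurableType d0}.

(* X is uniformly distributed on S^m: a measurable random vector concentrated
   on S^m whose law is invariant under every orthogonal transformation
   (normalised rotation-invariant / Haar measure on the sphere). *)
Definition uniform_on_sphere (P : probability Omega R) (m : nat)
    (X : Omega -> m.+1.-tuple R) : Prop :=
  [/\ measurable_fun setT X,
      P (X @^-1` (@unit_sphere m)) = 1%E &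
      forall Q : 'M[R]_m.+1, orthogonal_mx Q ->
        forall A : set (m.+1.-tuple R), measurable A ->
          P (X @^-1` A) = P ((mat_act Q \o X) @^-1` A)].

Definition mutually_independent (P : probability Omega R) (m n : nat)
    (X : nat -> Omega -> m.-tuple R) : Prop :=
  forall A : 'I_n -> set (m.-tuple R), (forall i, measurable (A i)) ->
    P (\bigcap_(i in [set: 'I_n]) (X i @^-1` A i)) =
    (\prod_(i < n) P (X i @^-1` A i))%E.

Definition Tstat (n m : nat) (psi : R -> R) (X : nat -> Omega -> m.-tuple R)
    (w : Omega) : R :=
  2 / n%:R * \sum_(i < n) \sum_(j < n | (i < j)%N) psi (inner (X i w) (X j w)).

End Defs.

(* Main.v *)
(** The statistic is a degenerate U-statistic [W = \sum_(i < j) h x_i x_j]. With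
    [W_i = \sum_(j != i) h x_i x_j], the difference [W - W_i] does not involve
    the i-th variable, so [E (W_i g (W - W_i)) = 0]; expanding [g] around [W]
    gives [E (W g W) = E (U g' W) + o(1)] with [U = 1/2 \sum_i W_i ^ 2]. Hence
    [W] is asymptotically normal by Stein's method as soon as [E (U - 1) ^ 2]
    tends to 0. The Hoeffding decomposition of [U] involves only kernels that are
    centred in each variable, whose sums are controlled by the fourth moment of
    [h] and by [E (G ^ 2)], where [G x y = E (h x Z * h y Z)].

    On the sphere, planar rotations parametrised rationally yield two integration
    by parts formulas for zonal polynomials. Together with the Gegenbauer
    recurrences they give the orthogonality of the [C_k] and, by induction on [k],
    [E (C_k (x.Z) * C_k (y.Z)) = lam / (k + lam) * C_k (x.y)], so that
    [E (G ^ 2)] is bounded by the eighth-power sum of the weights. *)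
Require Import Defs.
From HB Require Import structures.
From mathcomp Require Import all_boot all_order all_algebra.
From mathcomp Require Import all_classical all_reals all_analysis.
From mathcomp Require Import measurable_realfun zify ring lra.
Set Implicit Arguments. Unset Strict Implicit. Unset Printing Implicit Defensive.
Import Order.TTheory GRing.Theory Num.Theory.
Import numFieldNormedType.Exports.
Local Open Scope classical_set_scope.
Local Open Scope ring_scope.

(** * Moments *)

Section Lebesgue_space_exponents.
Context {R : realType} {d : measure_display} {T : measurableType d}.
Variable mu : {measure set T -> \bar R}.
Implicit Types (f g : T -> R) (r : R) (k : nat).

Lemma Lfun_measurable p f : f \in Lfun mu p -> measurable_fun setT f.
Proof. by rewrite inE => /andP[/[!inE]]. Qed.

Lemma Lfun_powRP r f : 1 <= r -> f \in Lfun mu r%:E <->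
  measurable_fun setT f /\ mu.-integrable setT (fun x => (`|f x| `^ r)%:E).
Proof.
move=> r1; split=> [Lf|[mf /integrableP[_ fr]]].
  by split; [exact: Lfun_measurable Lf|exact: Lfun_integrable].
rewrite inE; apply/andP; split; rewrite inE//= /finite_norm unlock poweR_lty//.
by move: fr; under eq_integral do rewrite gee0_abs ?lee_fin ?powR_ge0//.
Qed.

Lemma Lfun_dom r f g : 1 <= r -> measurable_fun setT f -> g \in Lfun mu r%:E ->
  (forall x, `|f x| <= g x) -> f \in Lfun mu r%:E.
Proof.
move=> r1 mf /(Lfun_powRP _ r1)[mg ig] fg; apply/Lfun_powRP => //; split=> //.
apply: le_integrable ig => //.
  apply/measurable_EFinP/(measurableT_comp (measurable_powR _)).
  exact: measurableT_comp.
move=> x _; rewrite !gee0_abs ?lee_fin ?powR_ge0//.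
apply: ge0_ler_powR; rewrite ?nnegrE//.
  exact: le_trans ler01 r1.
exact: le_trans (fg x) (ler_norm _).
Qed.

Lemma Lfun_normXP k f : f \in Lfun mu k.+1%:R%:E <->
  measurable_fun setT f /\ (fun x => `|f x| ^+ k.+1) \in Lfun mu 1.
Proof.
rewrite Lfun1_integrable (Lfun_powRP _ (ler1n _ k.+1)).
by under eq_fun do rewrite powR_mulrn//.
Qed.

Lemma Lfun_evenXP k f : (0 < k)%N -> ~~ odd k -> f \in Lfun mu k%:R%:E <->
  measurable_fun setT f /\ (fun x => f x ^+ k) \in Lfun mu 1.
Proof.
case: k => // k _ ek; rewrite Lfun_normXP.
by under eq_fun do rewrite -normrX ger0_norm ?exprn_even_ge0//.
Qed.

Lemma Lfun_evenX k f : f \in Lfun mu k%:R%:E -> (0 < k)%N -> ~~ odd k ->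
  (fun x => f x ^+ k) \in Lfun mu 1.
Proof. by move=> Lf k0 ek; have /Lfun_evenXP[] := Lf. Qed.

Lemma Lfun_sum p I (s : seq I) (q : pred I) (F : I -> T -> R) : (1 <= p)%E ->
  (forall i, q i -> F i \in Lfun mu p) ->
  (fun x => \sum_(i <- s | q i) F i x) \in Lfun mu p.
Proof. by move=> p1 LF; rewrite -fct_sumE; apply: rpred_sum. Qed.

Lemma LfunM k f g : f \in Lfun mu k.+1.*2%:R%:E -> g \in Lfun mu k.+1.*2%:R%:E ->
  (fun x => f x * g x) \in Lfun mu k.+1%:R%:E.
Proof.
move=> /Lfun_evenXP[//||mf Lf]; first by rewrite odd_double.
move=> /Lfun_evenXP[//||mg Lg]; first by rewrite odd_double.
apply/Lfun_normXP; split; first exact: measurable_funM.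
apply: (@Lfun_dom 1 _ (fun x => f x ^+ k.+1.*2 + g x ^+ k.+1.*2)) => //.
- apply: measurable_funX; apply: measurableT_comp => //; exact: measurable_funM.
- exact: rpredD.
- move=> x; rewrite ger0_norm ?exprn_ge0// -muln2 !exprM -normrX exprMn.
  rewrite ler_norml; have := sqr_ge0 (f x ^+ k.+1 - g x ^+ k.+1).
  have := sqr_ge0 (f x ^+ k.+1 + g x ^+ k.+1).
  have := sqr_ge0 (f x ^+ k.+1); have := sqr_ge0 (g x ^+ k.+1); nra.
Qed.

Lemma ge0_Lfun1 f (B : R) : measurable_fun setT f -> (forall x, 0 <= f x) ->
  (\int[mu]_x (f x)%:E <= B%:E)%E -> f \in Lfun mu 1.
Proof.
move=> mf f0 fB; apply/Lfun1_integrable/integrableP.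
split; first exact/measurable_EFinP.
under eq_integral do rewrite /= ger0_norm//.
exact: le_lt_trans fB (ltry _).
Qed.

End Lebesgue_space_exponents.

#[local] Hint Extern 0 (is_true (Order.le _ (EFin _))) =>
  (rewrite lee_fin ler1n; exact: isT) : core.

Section expectation.
Context {R : realType} {d : measure_display} {T : measurableType d}.
Variable P : probability T R.
Implicit Types f g : T -> R.

Lemma Lfun_bounded (r : R) f (M : R) : measurable_fun setT f ->
  (forall x, `|f x| <= M) -> 1 <= r -> f \in Lfun P r%:E.
Proof. by move=> mf fM r1; apply: Lfun_dom (Lfun_cst P M r) fM. Qed.

Lemma Lfun1_bounded_mul f g (M : R) : measurable_fun setT f ->
  (forall x, `|f x| <= M) -> g \in Lfun P 1 -> (fun x => f x * g x) \in Lfun P 1.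
Proof.
move=> mf fM Lg; apply: (@Lfun_dom _ _ _ _ 1 _ (fun x => M * `|g x|)) => //.
- by apply: measurable_funM => //; exact: Lfun_measurable Lg.
- by apply: rpredZ => //; exact: Lfun_norm.
- by move=> x; rewrite normrM ler_wpM2r.
Qed.

Lemma Lfun21 f : f \in Lfun P 2%:E -> f \in Lfun P 1.
Proof. by apply: Lfun_subset12; exact: fin_num_measure. Qed.

Lemma Lfun42 f : f \in Lfun P 4%:E -> f \in Lfun P 2%:E.
Proof. by apply: Lfun_subset => //; [exact: fin_num_measure|rewrite lee_fin ler_nat]. Qed.

Lemma Lfun_sqr f : f \in Lfun P 4%:E -> (fun x => f x ^+ 2) \in Lfun P 2%:E.
Proof. by move=> Lf; exact: (LfunM (k := 1) Lf Lf). Qed.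

Lemma ExD f g : f \in Lfun P 1 -> g \in Lfun P 1 ->
  \int[P]_x (f x + g x) = \int[P]_x f x + \int[P]_x g x.
Proof. by move=> ? ?; rewrite RintegralD//; exact/Lfun1_integrable. Qed.

Lemma ExB f g : f \in Lfun P 1 -> g \in Lfun P 1 ->
  \int[P]_x (f x - g x) = \int[P]_x f x - \int[P]_x g x.
Proof. by move=> ? ?; rewrite RintegralB//; exact/Lfun1_integrable. Qed.

Lemma ExZ (a : R) f : f \in Lfun P 1 ->
  \int[P]_x (a * f x) = a * \int[P]_x f x.
Proof. by move=> ?; rewrite RintegralZl//; exact/Lfun1_integrable. Qed.

Lemma Ex_cst (a : R) : \int[P]_x a = a.
Proof. by rewrite Rintegral_cst// [X in fine X](probability_setT P) mulr1. Qed.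

Lemma Ex_sum I (s : seq I) (q : pred I) (F : I -> T -> R) :
  (forall i, q i -> F i \in Lfun P 1) ->
  \int[P]_x (\sum_(i <- s | q i) F i x) = \sum_(i <- s | q i) \int[P]_x F i x.
Proof.
move=> LF; elim: s => [|i s IHs].
  by under eq_Rintegral do rewrite big_nil; rewrite Ex_cst big_nil.
under eq_Rintegral do rewrite big_cons.
rewrite big_cons; case: ifP => // qi.
by rewrite ExD ?IHs//; [exact: LF|exact: Lfun_sum].
Qed.

Lemma le_Ex f g : f \in Lfun P 1 -> g \in Lfun P 1 -> (forall x, f x <= g x) ->
  \int[P]_x f x <= \int[P]_x g x.
Proof. by move=> *; apply: le_Rintegral => //; exact/Lfun1_integrable. Qed.

Lemma normr_Ex_le f g : f \in Lfun P 1 -> g \in Lfun P 1 ->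
  (forall x, `|f x| <= g x) -> `|\int[P]_x f x| <= \int[P]_x g x.
Proof.
move=> Lf Lg fg; apply: le_trans (le_normr_Rintegral measurableT _) _.
  exact/Lfun1_integrable.
by apply: le_Ex => //; exact: Lfun_norm.
Qed.

Lemma Ex_EFin f : f \in Lfun P 1 -> (\int[P]_x f x)%:E = (\int[P]_x (f x)%:E)%E.
Proof. by move=> /Lfun1_integrable Lf; rewrite fineK//; exact: integrable_fin_num. Qed.

Lemma ge0_Ex_le f (B : R) : measurable_fun setT f -> (forall x, 0 <= f x) ->
  (\int[P]_x (f x)%:E <= B%:E)%E -> \int[P]_x f x <= B.
Proof. by move=> mf f0 fB; rewrite -lee_fin Ex_EFin//; exact: ge0_Lfun1 fB. Qed.

Lemma Ex_sqr_sum3_le f g k : f \in Lfun P 2%:E -> g \in Lfun P 2%:E ->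
  k \in Lfun P 2%:E -> \int[P]_x (f x + g x + k x) ^+ 2 <=
  3 * (\int[P]_x f x ^+ 2 + \int[P]_x g x ^+ 2 + \int[P]_x k x ^+ 2).
Proof.
move=> Lf Lg Lk; have Lsum : (fun x => f x + g x + k x) \in Lfun P 2%:E.
  by apply: rpredD => //; exact: rpredD.
have [Lf2 Lg2 Lk2] : [/\ (fun x => f x ^+ 2) \in Lfun P 1,
    (fun x => g x ^+ 2) \in Lfun P 1 & (fun x => k x ^+ 2) \in Lfun P 1].
  by split; exact: Lfun_evenX.
rewrite -(ExD Lf2 Lg2) -ExD ?rpredD// -ExZ ?rpredD//.
apply: le_Ex; [exact: Lfun_evenX Lsum isT isT|by rewrite rpredZ ?rpredD|move=> x].
have := sqr_ge0 (f x - g x); have := sqr_ge0 (f x - k x).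
by have := sqr_ge0 (g x - k x); nra.
Qed.

Lemma normr_ExM_le f g : f \in Lfun P 2%:E -> g \in Lfun P 2%:E ->
  `|\int[P]_x (f x * g x)| <= Num.sqrt (\int[P]_x f x ^+ 2 * \int[P]_x g x ^+ 2).
Proof.
move=> Lf Lg; set a := \int[P]_x f x ^+ 2; set b := \int[P]_x (f x * g x).
set c := \int[P]_x g x ^+ 2; pose p := Poly [:: a; 2 * b; c].
have p_ge0 r : 0 <= p.[r].
  have Lf2 := Lfun_evenX Lf isT isT; have Lg2 := Lfun_evenX Lg isT isT.
  have Lfg : (fun x => f x * g x) \in Lfun P 1 := LfunM (k := 0) Lf Lg.
  have -> : p.[r] = \int[P]_x (f x + r * g x) ^+ 2.
    transitivity (\int[P]_x (f x ^+ 2 + r * (2 * (f x * g x) + r * g x ^+ 2))).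
      have Lr : (fun x => 2 * (f x * g x) + r * g x ^+ 2) \in Lfun P 1.
        by apply: rpredD => //; exact: rpredZ.
      rewrite ExD ?(ExZ r Lr) ?rpredZ// ExD ?(ExZ r Lg2) ?(ExZ 2 Lfg) ?rpredZ//.
      by rewrite /p horner_Poly/= /a /b /c; ring.
    by apply: eq_Rintegral => x _; ring.
  by apply: Rintegral_ge0 => x _; rewrite sqr_ge0.
have := deg_le2_poly_ge0 (size_Poly [:: a; 2 * b; c]) p_ge0.
rewrite !coefE/= => delta_le0; rewrite -sqrtr_sqr ler_wsqrtr//; lra.
Qed.

Lemma ExM_le f g (S : R) : f \in Lfun P 2%:E -> g \in Lfun P 2%:E ->
  \int[P]_x f x ^+ 2 <= S -> \int[P]_x g x ^+ 2 <= S ->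
  \int[P]_x (f x * g x) <= S.
Proof.
move=> Lf Lg fS gS.
have Ex_sqr_ge0 (u : T -> R) : 0 <= \int[P]_x u x ^+ 2.
  by apply: Rintegral_ge0 => x _; exact: sqr_ge0.
have S0 : 0 <= S by exact: le_trans fS.
apply: le_trans (ler_norm _) (le_trans (normr_ExM_le Lf Lg) _).
by rewrite -(ger0_norm S0) -sqrtr_sqr ler_wsqrtr// expr2 ler_pM.
Qed.

End expectation.

Section fatou_bound.
Context {R : realType} {d : measure_display} {T : measurableType d}.
Variable mu : {measure set T -> \bar R}.

Lemma integral_limit_le (f : nat -> T -> R) (g : T -> R) (b : \bar R) :
  (forall k, measurable_fun setT (f k)) -> (forall k x, 0 <= f k x) ->
  (forall x, f ^~ x @ \oo --> g x) ->
  (forall k, \int[mu]_x (f k x)%:E <= b)%E -> (\int[mu]_x (g x)%:E <= b)%E.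
Proof.
move=> mf f0 fg fb.
have mEf k : measurable_fun setT (fun x => (f k x)%:E) by exact/measurable_EFinP.
have Ef0 k x : setT x -> (0 <= (f k x)%:E)%E by rewrite lee_fin.
rewrite (_ : (\int[mu]_x _ = \int[mu]_x limn_einf (fun k => (f k x)%:E))%E).
  apply: le_trans (fatou mu measurableT mEf Ef0) _.
  rewrite limn_einf_lim; apply: lime_le; first exact: is_cvg_einfs.
  apply: nearW => k; apply: le_trans (fb k); apply: ereal_inf_lbound.
  by exists k => //=.
apply: eq_integral => x _; have fgx : (fun k => (f k x)%:E) @ \oo --> (g x)%:E.
  by apply/fine_cvgP; split; [exact: nearW|exact: fg].
by rewrite is_cvg_limn_einfE; [rewrite (cvg_lim _ fgx)|apply: cvgP fgx].
Qed.

End fatou_bound.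

(** * Resampling one coordinate *)

Section tuple_rectangles.
Context {d : measure_display} {T : measurableType d} {n : nat}.
Implicit Types B : 'I_n -> set T.

Definition rectangle B : set (n.-tuple T) := [set x | forall i, B i (tnth x i)].

Definition rectangles : set (set (n.-tuple T)) :=
  [set rectangle B | B in [set B | forall i, measurable (B i)]].

Lemma measurable_rectangle B :
  (forall i, measurable (B i)) -> measurable (rectangle B).
Proof.
move=> mB; rewrite (_ : rectangle B =
    \bigcap_(i in [set: 'I_n]) ((@tnth n T) ^~ i @^-1` B i)).
  apply: fin_bigcap_measurable => // i _.
  by rewrite -[X in measurable X]setTI; exact: measurable_tnth.
by apply/seteqP; split => x /= Bx i; [move=> _|]; exact: Bx.
Qed.

Lemma setI_closed_rectangles : setI_closed rectangles.
Proof.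
move=> _ _ [B mB <-] [C mC <-]; exists (fun i => B i `&` C i).
  by move=> i; exact: measurableI.
apply/seteqP; split=> x /=; last by move=> [Bx Cx] i; split.
by move=> BCx; split=> i; have [] := BCx i.
Qed.

Lemma measurable_rectanglesE :
  @measurable _ (n.-tuple T) = <<s rectangles >>.
Proof.
apply/seteqP; split; last first.
  apply: smallest_sub; first exact: sigma_algebra_measurable.
  by move=> _ [B mB <-]; exact: measurable_rectangle.
apply: smallest_sub; first exact: smallest_sigma_algebra.
rewrite -(@bigcup_seq _ _ (index_enum 'I_n)
  (fun i => preimage_set_system setT ((@tnth n T) ^~ i) measurable)).
move=> _ [i _ [C mC <-]]; apply: sub_sigma_algebra.
exists (fun j => if j == i then C else setT); first by move=> j; case: ifP.
rewrite setTI; apply/seteqP; split => x /=; last by move=> ? j; case: eqP => [->|].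
by move=> /(_ i); rewrite eqxx.
Qed.

Lemma eq_measure_rectangles (R : realType) (nu : probability (n.-tuple T) R)
    (nu' : {measure set (n.-tuple T) -> \bar R}) :
  (forall B, (forall i, measurable (B i)) -> nu (rectangle B) = nu' (rectangle B)) ->
  forall A, measurable A -> nu A = nu' A.
Proof.
move=> nuE A mA; apply: (measure_unique rectangles (fun=> setT)) => //.
- exact: measurable_rectanglesE.
- exact: setI_closed_rectangles.
- by move=> _; exists (fun=> setT) => //; apply/seteqP; split.
- by rewrite bigcup_const//; exact: set0P.
- by move=> _ [B mB <-]; exact: nuE.
- by move=> _; rewrite -ge0_fin_numE// fin_num_measure.
Qed.

End tuple_rectangles.

Section resampling.
Context {R : realType} {d : measure_display} {T : measurableType d} {n : nat}.
Implicit Types (i j : 'I_n) (x : n.-tuple T) (y : T).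

Definition resample i x y : n.-tuple T :=
  [tuple if j == i then y else tnth x j | j < n].

Lemma tnth_resample i x y j :
  tnth (resample i x y) j = if j == i then y else tnth x j.
Proof. by rewrite tnth_mktuple. Qed.

Lemma tnth_resample_eq i x y : tnth (resample i x y) i = y.
Proof. by rewrite tnth_resample eqxx. Qed.

Lemma tnth_resample_neq i x y j : j != i -> tnth (resample i x y) j = tnth x j.
Proof. by rewrite tnth_resample => /negbTE ->. Qed.

Lemma measurable_resample i :
  measurable_fun setT (fun p : n.-tuple T * T => resample i p.1 p.2).
Proof.
apply/measurable_fun_tnthP => j.
rewrite (_ : _ \o _ = fun p => if j == i then p.2 else tnth p.1 j); last first.
  by apply/funext => p /=; rewrite tnth_resample.
case: (j == i); first exact: measurable_snd.
by apply: (measurableT_comp (@measurable_tnth _ T n j)); exact: measurable_fst.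
Qed.

Lemma resample_rectangle i (B : 'I_n -> set T) :
  (fun p => resample i p.1 p.2) @^-1` rectangle B =
  rectangle (fun j => if j == i then setT else B j) `*` B i.
Proof.
apply/seteqP; split=> -[x y] /=; rewrite /rectangle /=.
  move=> Bxy; split; last by have := Bxy i; rewrite tnth_resample_eq.
  by move=> j; case: eqP => // /eqP ji; have := Bxy j; rewrite tnth_resample_neq.
by move=> [Bx By] j; rewrite tnth_resample; have := Bx j; case: eqP => // ->.
Qed.

Variables (nu : probability (n.-tuple T) R) (mu : 'I_n -> probability T R).

Definition resample_invariant := forall i A, measurable A ->
  nu A = (nu \x mu i)%E ((fun p => resample i p.1 p.2) @^-1` A).

Lemma product_resample_invariant :
  (forall B, (forall i, measurable (B i)) ->
    nu (rectangle B) = \prod_(i < n) mu i (B i))%E -> resample_invariant.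
Proof.
move=> nuE i A mA; have mi := measurable_resample i.
rewrite -[RHS]/(pushforward (nu \x mu i)%E (fun p => resample i p.1 p.2) A).
apply: (eq_measure_rectangles _ mA) => B mB.
rewrite -[RHS]/((nu \x mu i)%E ((fun p => resample i p.1 p.2) @^-1` rectangle B)).
rewrite resample_rectangle; set B' := fun j => _.
have mB' j : measurable (B' j) by rewrite /B'; case: ifP.
rewrite [RHS](product_measure1E nu (mu i) (measurable_rectangle mB') (mB i)).
rewrite nuE// [X in (X * _)%E](nuE B' mB') (bigD1 i)//= [in RHS](bigD1 i)//=.
rewrite {1}/B' eqxx [X in (X * _ * _)%E](probability_setT (mu i)) mul1e muleC.
congr (_ * _)%E.
by apply: eq_bigr => j /negbTE ji; rewrite /B' ji.
Qed.

Hypothesis nu_mu : resample_invariant.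

Lemma ge0_integral_resample i (F : n.-tuple T -> \bar R) :
  measurable_fun setT F -> (forall x, 0 <= F x)%E ->
  (\int[nu]_x F x = \int[nu]_x \int[mu i]_y F (resample i x y))%E.
Proof.
move=> mF F0; have mi := measurable_resample i.
pose ri := fun p : n.-tuple T * T => resample i p.1 p.2.
transitivity (\int[pushforward (nu \x mu i)%E ri]_x F x)%E.
  by apply: eq_measure_integral => A mA _; exact: (nu_mu i mA).
rewrite ge0_integral_pushforward// preimage_setT.
rewrite (fubini_tonelli1 (m1 := nu) (m2 := mu i) (F \o ri))//.
- exact: measurableT_comp.
- by move=> x; exact: F0.
Qed.

Lemma integral_resample_le i (F : n.-tuple T -> R) (B : R) :
  measurable_fun setT F -> (forall x, 0 <= F x) ->
  (forall x, (\int[mu i]_y (F (resample i x y))%:E <= B%:E)%E) ->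
  (\int[nu]_x (F x)%:E <= B%:E)%E.
Proof.
move=> mF F0 FB; have mEF : measurable_fun setT (EFin \o F) by exact/measurable_EFinP.
rewrite (ge0_integral_resample i mEF); last by move=> x; rewrite lee_fin.
apply: (@le_trans _ _ (\int[nu]_x cst B%:E x)%E); last first.
  by rewrite integral_cst// [X in (_ * X)%E](probability_setT nu) mule1.
apply: ge0_le_integral => //.
- by move=> x _; apply: integral_ge0 => y _; rewrite lee_fin.
- apply: (measurable_fun_fubini_tonelli_F (m2 := mu i)
    (fun p => (F (resample i p.1 p.2))%:E)).
    by apply/measurable_EFinP/(measurableT_comp mF); exact: measurable_resample.
  by move=> p; rewrite lee_fin.
- by move=> x _; exact: FB.
Qed.

Lemma Ex_resample_eq0 i (F : n.-tuple T -> R) : F \in Lfun nu 1 ->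
  (forall x, \int[mu i]_y F (resample i x y) = 0) -> \int[nu]_x F x = 0.
Proof.
move=> LF F0; have mF := Lfun_measurable LF; have mi := measurable_resample i.
pose ri := fun p : n.-tuple T * T => resample i p.1 p.2.
have mFi : measurable_fun setT (F \o ri) by exact: measurableT_comp.
have iFi : (nu \x mu i)%E.-integrable setT (EFin \o (F \o ri)).
  apply/integrable12ltyP; first exact/measurable_EFinP.
  rewrite -(@ge0_integral_resample i (fun x => `|(F x)%:E|)%E)//.
  - by case/Lfun1_integrable/integrableP : LF.
  - by apply: measurableT_comp => //; exact/measurable_EFinP.
rewrite /Rintegral (_ : (\int[nu]_x _)%E = 0%E)//.
transitivity (\int[pushforward (nu \x mu i)%E ri]_x (F x)%:E)%E.
  by apply: eq_measure_integral => A mA _; exact: (nu_mu i mA).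
rewrite integral_pushforward//; last exact/measurable_EFinP.
rewrite preimage_setT -(integral12_prod_meas1 iFi) /fubini_F.
rewrite -[RHS](integral0 nu setT).
apply: ae_eq_integral => //; first exact: measurable_fubini_F iFi.
have := ae_integrable1 iFi; apply: filterS => x /= /Lfun1_integrable Fx _.
by rewrite -Ex_EFin// F0.
Qed.

Lemma Ex_resample_cst i (F : n.-tuple T -> R) (a : R) : F \in Lfun nu 1 ->
  (forall x, (fun y => F (resample i x y)) \in Lfun (mu i) 1) ->
  (forall x, \int[mu i]_y F (resample i x y) = a) -> \int[nu]_x F x = a.
Proof.
move=> LF LFx Fa; apply/eqP; rewrite -subr_eq0 -[X in _ - X](Ex_cst nu).
rewrite -ExB//; last exact: Lfun_cst.
apply/eqP/(@Ex_resample_eq0 i) => [|x].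
  by apply: rpredB => //; exact: Lfun_cst.
by rewrite ExB ?Ex_cst ?Fa ?subrr//; exact: Lfun_cst.
Qed.

End resampling.

Definition mfun_of d1 d2 (T1 : measurableType d1) (T2 : measurableType d2)
  (f : T1 -> T2) (mf : measurable_fun setT f) : {mfun T1 >-> T2} :=
  mfun_Sub (mem_set mf).

Section sample_law.
Context {R : realType} {d0 : measure_display} {Omega : measurableType d0}.
Context {m n : nat}.
Variables (P : probability Omega R) (X : nat -> Omega -> m.-tuple R).
Hypothesis mX : forall i, (i < n)%N -> measurable_fun setT (X i).

Definition sample (w : Omega) : n.-tuple (m.-tuple R) := [tuple X i w | i < n].

Lemma measurable_sample : measurable_fun setT sample.
Proof.
apply/measurable_fun_tnthP => i.
rewrite (_ : _ \o _ = X i); first exact: mX.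
by apply/funext => w /=; rewrite tnth_mktuple.
Qed.

Definition sample_law : probability (n.-tuple (m.-tuple R)) R :=
  distribution P (mfun_of measurable_sample).

Definition marginal (i : 'I_n) : probability (m.-tuple R) R :=
  distribution P (mfun_of (mX (ltn_ord i))).

Lemma sample_law_resample_invariant :
  mutually_independent P n X -> resample_invariant sample_law marginal.
Proof.
move=> indX; apply: product_resample_invariant => B mB.
rewrite [RHS](_ : _ = \prod_(i < n) P (X i @^-1` B i))%E// -indX//.
congr (P _); apply/seteqP; split => w /=.
  by move=> Bw i _ /=; have := Bw i; rewrite tnth_mktuple.
by move=> Bw i; rewrite tnth_mktuple; exact: Bw.
Qed.

Lemma ge0_integral_sample (F : n.-tuple (m.-tuple R) -> \bar R) :
  measurable_fun setT F -> (forall x, 0 <= F x)%E ->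
  (\int[sample_law]_x F x = \int[P]_w F (sample w))%E.
Proof. exact: ge0_integral_distribution. Qed.

Lemma integral_sample (F : n.-tuple (m.-tuple R) -> \bar R) :
  measurable_fun setT F -> P.-integrable setT (F \o sample) ->
  (\int[sample_law]_x F x = \int[P]_w F (sample w))%E.
Proof.
by move=> mF iF; exact: (integral_distribution (X := mfun_of measurable_sample)).
Qed.

End sample_law.

Section orthogonal_sums.
Context {R : realType} {d : measure_display} {T : measurableType d} {n : nat}.
Variables (nu : probability (n.-tuple T) R) (mu : 'I_n -> probability T R).
Implicit Types (F : n.-tuple T -> R) (i : 'I_n).

Definition constant_in i F := forall x y, F (resample i x y) = F x.

Definition centred_in i F := forall x,
  (fun y => F (resample i x y)) \in Lfun (mu i) 1 /\
  \int[mu i]_y F (resample i x y) = 0.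

Lemma constant_inM i F F' : constant_in i F -> constant_in i F' ->
  constant_in i (fun x => F x * F' x).
Proof. by move=> cF cF' x y; rewrite cF cF'. Qed.

Lemma centred_inM i F F' : centred_in i F -> constant_in i F' ->
  centred_in i (fun x => F x * F' x).
Proof.
move=> zF cF' x; have [LF EF] := zF x.
rewrite (_ : (fun y => _) = fun y => F' x * F (resample i x y)); last first.
  by apply/funext => y; rewrite cF' mulrC.
by split; [apply: rpredZ|rewrite ExZ// EF mulr0].
Qed.

Lemma centred_in_sum i I (s : seq I) (q : pred I) (F : I -> n.-tuple T -> R) :
  (forall a, q a -> centred_in i (F a)) ->
  centred_in i (fun x => \sum_(a <- s | q a) F a x).
Proof.
move=> zF x; split; first by apply: Lfun_sum => // a qa; have [] := zF _ qa x.
rewrite Ex_sum; first by rewrite big1// => a qa; have [] := zF _ qa x.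
by move=> a qa; have [] := zF _ qa x.
Qed.

Lemma centred_inB i F F' : centred_in i F -> centred_in i F' ->
  centred_in i (fun x => F x - F' x).
Proof.
move=> zF zF' x; have [LF EF] := zF x; have [LF' EF'] := zF' x.
by split; [apply: rpredB|rewrite ExB// EF EF' subrr].
Qed.

Hypothesis nu_mu : resample_invariant nu mu.

Lemma Ex_centred i F : F \in Lfun nu 1 -> centred_in i F -> \int[nu]_x F x = 0.
Proof.
by move=> LF zF; apply: (Ex_resample_eq0 nu_mu (i := i)) => // x; case: (zF x).
Qed.

Lemma Ex_centredM i F F' : F \in Lfun nu 2%:E -> F' \in Lfun nu 2%:E ->
  centred_in i F -> constant_in i F' -> \int[nu]_x (F x * F' x) = 0.
Proof.
move=> LF LF' zF cF'; apply: (@Ex_centred i); last exact: centred_inM.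
exact: (LfunM (k := 0)).
Qed.

(* Terms centred in each variable of their support are orthogonal as soon as
   their supports differ. *)
Lemma Ex_sqr_orthogonal_sum_le (I : finType) (p : pred I) (q : I -> n.-tuple T -> R)
    (supp : I -> {set 'I_n}) (m : nat) (S : R) : 0 <= S ->
  (forall a, p a -> q a \in Lfun nu 2%:E) ->
  (forall a i, p a -> i \in supp a -> centred_in i (q a)) ->
  (forall a b i, p a -> p b -> i \in supp a -> i \notin supp b ->
    constant_in i (q b)) ->
  (forall a, p a -> \int[nu]_x q a x ^+ 2 <= S) ->
  (forall a, p a -> (#|[pred b | supp b == supp a]| <= m)%N) ->
  \int[nu]_x (\sum_(a | p a) q a x) ^+ 2 <= m%:R * #|I|%:R * S.
Proof.
move=> S0 Lq zq cq qS suppm.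
have orth a b : p a -> p b -> supp b != supp a ->
    \int[nu]_x (q a x * q b x) = 0.
  move=> pa pb; apply: contraNeq => ab; apply/eqP/setP => i.
  apply/idP/idP => [ib|ia]; apply: contraNT ab => ni.
    under eq_Rintegral do rewrite mulrC.
    by rewrite (@Ex_centredM i)//; [exact: Lq|exact: Lq|exact: zq|exact: (cq b)].
  by rewrite (@Ex_centredM i)//; [exact: Lq|exact: Lq|exact: zq|exact: (cq a)].
have Lqq a b : p a -> p b -> (fun x => q a x * q b x) \in Lfun nu 1.
  by move=> pa pb; apply: (LfunM (k := 0)); exact: Lq.
have sqrE x : (\sum_(a | p a) q a x) ^+ 2 =
    \sum_(a | p a) \sum_(b | p b) (q a x * q b x).
  by rewrite expr2 mulr_suml; apply: eq_bigr => a _; rewrite mulr_sumr.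
under eq_Rintegral do rewrite sqrE.
rewrite Ex_sum => [|a pa]; last by apply: Lfun_sum => // b pb; exact: Lqq.
apply: (@le_trans _ _ (\sum_(a | p a) m%:R * S)); last first.
  rewrite -mulrA [leRHS]mulrCA sumr_const -[leLHS]mulr_natl.
  by rewrite ler_wpM2r ?mulr_ge0// ler_nat max_card.
apply: ler_sum => a pa; rewrite Ex_sum => [|b pb]; last exact: Lqq.
apply: (@le_trans _ _ (\sum_(b | supp b == supp a) S)); last first.
  by rewrite sumr_const -[leLHS]mulr_natl ler_wpM2r// ler_nat suppm.
rewrite big_mkcond [leRHS]big_mkcond; apply: ler_sum => b _.
case: ifP => pb; last by case: ifP.
case: ifPn => ab; last by rewrite orth.
by apply: ExM_le; [exact: Lq|exact: Lq|exact: qS|exact: qS].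
Qed.

End orthogonal_sums.

(** * Degenerate U-statistics *)

Section pair_kernels.
Context {R : realType} {d : measure_display} {T : measurableType d} {n : nat}.
Variables (nu : probability (n.-tuple T) R) (mu : 'I_n -> probability T R).
Variable k : T -> T -> R.
Implicit Types (i j l : 'I_n) (x : n.-tuple T) (y z : T).
Hypothesis mk : measurable_fun setT (fun p : T * T => k p.1 p.2).

Definition at_pair i j x : R := k (tnth x i) (tnth x j).

Definition offdiag i j x : R := if i == j then 0 else at_pair i j x.

Lemma measurable_section y : measurable_fun setT (k y).
Proof.
by apply: (measurableT_comp mk (g := fun z => (y, z))); exact: measurable_fun_pair.
Qed.

Lemma measurable_at_pair i j : measurable_fun setT (at_pair i j).
Proof.
apply: (measurableT_comp mk (g := fun x => (tnth x i, tnth x j))).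
by apply: measurable_fun_pair; exact: measurable_tnth.
Qed.

Lemma at_pair_resample i j x y : i != j ->
  at_pair i j (resample j x y) = k (tnth x i) y.
Proof. by move=> ij; rewrite /at_pair tnth_resample_eq tnth_resample_neq. Qed.

Lemma constant_in_at_pair l i j : l != i -> l != j -> constant_in l (at_pair i j).
Proof.
by move=> li lj x y; rewrite /at_pair !tnth_resample_neq// eq_sym.
Qed.

Lemma centred_in_at_pair i j : i != j ->
  (forall y, k y \in Lfun (mu j) 1) -> (forall y, \int[mu j]_z k y z = 0) ->
  centred_in mu j (at_pair i j).
Proof.
move=> ij Lk Ek x; rewrite (_ : (fun y => _) = k (tnth x i)).
  by split; [exact: Lk|exact: Ek].
by apply/funext => y; rewrite at_pair_resample.
Qed.

Lemma offdiag_neq i j : i != j -> offdiag i j = at_pair i j.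
Proof. by rewrite /offdiag => /negbTE ->. Qed.

Lemma offdiagii i x : offdiag i i x = 0.
Proof. by rewrite /offdiag eqxx. Qed.

Lemma constant_in_offdiag l i j : l != i -> l != j -> constant_in l (offdiag i j).
Proof.
move=> li lj; have [->|ij] := eqVneq i j; first by move=> x y; rewrite !offdiagii.
by rewrite offdiag_neq//; exact: constant_in_at_pair.
Qed.

Lemma section_evenX_Lfun i p (B : R) y : (0 < p)%N -> ~~ odd p ->
  (\int[mu i]_z (k y z ^+ p)%:E <= B%:E)%E -> k y \in Lfun (mu i) p%:R%:E.
Proof.
move=> p0 ep kB; apply/Lfun_evenXP => //; split; first exact: measurable_section.
apply: ge0_Lfun1 kB; first exact/measurable_funX/measurable_section.
by move=> z; exact: exprn_even_ge0.
Qed.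

Hypothesis nu_mu : resample_invariant nu mu.

Lemma integral_at_pair_le i j p (B : R) : i != j -> ~~ odd p ->
  (forall y, (\int[mu j]_z (k y z ^+ p)%:E <= B%:E)%E) ->
  (\int[nu]_x (at_pair i j x ^+ p)%:E <= B%:E)%E.
Proof.
move=> ij ep kB; apply: (integral_resample_le nu_mu (i := j)).
- by apply: measurable_funX; exact: measurable_at_pair.
- by move=> x; exact: exprn_even_ge0.
- by move=> x; under eq_integral do rewrite at_pair_resample//; exact: kB.
Qed.

Lemma Lfun_at_pair i j p (B : R) : i != j -> (0 < p)%N -> ~~ odd p ->
  (forall y, (\int[mu j]_z (k y z ^+ p)%:E <= B%:E)%E) ->
  at_pair i j \in Lfun nu p%:R%:E.
Proof.
move=> ij p0 ep kB; apply/Lfun_evenXP => //; split; first exact: measurable_at_pair.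
apply: ge0_Lfun1 (integral_at_pair_le ij ep kB).
  by apply: measurable_funX; exact: measurable_at_pair.
by move=> x; exact: exprn_even_ge0.
Qed.

Lemma Ex_at_pair_le i j p (B : R) : i != j -> ~~ odd p ->
  (forall y, (\int[mu j]_z (k y z ^+ p)%:E <= B%:E)%E) ->
  \int[nu]_x at_pair i j x ^+ p <= B.
Proof.
move=> ij ep kB; apply: ge0_Ex_le (integral_at_pair_le ij ep kB).
  by apply: measurable_funX; exact: measurable_at_pair.
by move=> x; exact: exprn_even_ge0.
Qed.

Lemma Ex_at_pair_sqr i j (a : R) : i != j -> at_pair i j \in Lfun nu 2%:E ->
  (forall y, k y \in Lfun (mu j) 2%:E) -> (forall y, \int[mu j]_z k y z ^+ 2 = a) ->
  \int[nu]_x at_pair i j x ^+ 2 = a.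
Proof.
move=> ij Lkij Lk Ek; have L2 := Lfun_evenX Lkij isT isT.
apply: (Ex_resample_cst nu_mu (i := j)) => // x.
  have Lk2 := Lfun_evenX (Lk (tnth x i)) isT isT.
  by under eq_fun do rewrite at_pair_resample//.
by under eq_Rintegral do rewrite at_pair_resample//; exact: Ek.
Qed.

End pair_kernels.

Lemma sqr_sum_le (R : realDomainType) (I : finType) (a : I -> R) :
  (\sum_i a i) ^+ 2 <= #|I|%:R * \sum_i a i ^+ 2.
Proof.
have sum2E : \sum_i \sum_j (a i ^+ 2 + a j ^+ 2) = 2 * (#|I|%:R * \sum_i a i ^+ 2).
  under eq_bigr do rewrite big_split/= sumr_const -[X in X + _]mulr_natl.
  by rewrite big_split/= -mulr_sumr sumr_const -[X in _ + X]mulr_natl; ring.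
rewrite -(@ler_pM2l _ 2)// -sum2E expr2 mulr_suml mulr_sumr; apply: ler_sum => i _.
rewrite mulr_sumr mulr_sumr; apply: ler_sum => j _.
by have := sqr_ge0 (a i - a j); rewrite sqrrB mulr2n; lra.
Qed.

Section same_support.
Context {n : nat}.

Lemma card_same_pair (i j : 'I_n) :
  (#|[pred b : 'I_n * 'I_n | [set b.1; b.2]%SET == [set i; j]%SET]| <= 4)%N.
Proof.
pose S := [set i; j]%SET; apply: (@leq_trans #|finset.setX S S|).
  apply: subset_leq_card; apply/fintype.subsetP => -[a b].
  rewrite !inE/= => /eqP /setP abS.
  by have := abS a; have := abS b; rewrite !inE !eqxx ?orbT => <- <-.
by rewrite cardsX -[4%N]/(2 * 2)%N; apply: leq_mul; rewrite cards2; case: (_ != _).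
Qed.

Lemma card_same_triple (i j k : 'I_n) :
  (#|[pred b : 'I_n * 'I_n * 'I_n |
     [set b.1.1; b.1.2; b.2]%SET == [set i; j; k]%SET]| <= 27)%N.
Proof.
pose S := [set i; j; k]%SET; have S3 : (#|S| <= 3)%N.
  by rewrite /S -finset.setUA cardsU1 cards2; case: (_ \notin _); case: (_ != _).
apply: (@leq_trans #|finset.setX (finset.setX S S) S|).
  apply: subset_leq_card; apply/fintype.subsetP => -[[a b] e].
  rewrite !inE/= => /eqP /setP abeS.
  have := abeS a; have := abeS b; have := abeS e; rewrite !inE !eqxx ?orbT/=.
  by move=> <- <- <-.
by rewrite !cardsX -[27%N]/(3 * 3 * 3)%N; do 2! apply: leq_mul => //.
Qed.

End same_support.

Record degenerate_kernel {R : realType} {d} {T : measurableType d} {n : nat}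
    (mu : 'I_n -> probability T R) (h G : T -> T -> R) (c B Q : R) : Prop := {
  measurable_kernel : measurable_fun setT (fun p : T * T => h p.1 p.2) ;
  kernelC : forall y z, h y z = h z y ;
  Ex_kernel : forall i y, \int[mu i]_z h y z = 0 ;
  integral_kernel4_le : forall i y, (\int[mu i]_z (h y z ^+ 4)%:E <= B%:E)%E ;
  measurable_iterate : measurable_fun setT (fun p : T * T => G p.1 p.2) ;
  Ex_kernelM : forall i y y', \int[mu i]_z (h y z * h y' z) = G y y' ;
  iterate_diag : forall y, G y y = c ;
  integral_iterate2_le : forall i y, (\int[mu i]_z (G y z ^+ 2)%:E <= Q%:E)%E
}.

Section degenerate_kernel_scaling.
Context {R : realType} {d : measure_display} {T : measurableType d} {n : nat}.
Variables (mu : 'I_n -> probability T R) (h G : T -> T -> R) (c B Q : R).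

Lemma degenerate_kernelZ (a : R) : degenerate_kernel mu h G c B Q ->
  degenerate_kernel mu (fun y z => a * h y z) (fun y z => a ^+ 2 * G y z)
    (a ^+ 2 * c) (a ^+ 4 * B) (a ^+ 4 * Q).
Proof.
move=> [mh hC Eh h4 mG EhM Gc G2].
have integral_scaled_le (mu' : probability T R) (k : T -> R) p q (b e : R) :
    ~~ odd p -> measurable_fun setT k -> b ^+ p = a ^+ q -> 0 <= a ^+ q ->
    (\int[mu']_z (k z ^+ p)%:E <= e%:E)%E ->
    (\int[mu']_z ((b * k z) ^+ p)%:E <= (a ^+ q * e)%:E)%E.
  move=> ep mk bp a0 ke.
  under eq_integral do rewrite exprMn bp EFinM.
  rewrite ge0_integralZl//; first by rewrite EFinM lee_pmul ?lee_fin//;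
    apply: integral_ge0 => z _; rewrite lee_fin exprn_even_ge0.
  - exact/measurable_EFinP/measurable_funX.
  - by move=> z _; rewrite lee_fin exprn_even_ge0.
have Lh i y : h y \in Lfun (mu i) 2%:E.
  exact/Lfun42/(section_evenX_Lfun mh _ _ (h4 i y)).
split.
- exact: measurable_funM.
- by move=> y z; rewrite hC.
- by move=> i y; rewrite ExZ ?Eh ?mulr0//; exact: Lfun21.
- move=> i y; apply: integral_scaled_le => //; first exact: measurable_section.
  by rewrite exprn_even_ge0.
- exact: measurable_funM.
- move=> i y y'; under eq_Rintegral do rewrite mulrACA.
  by rewrite ExZ ?EhM ?expr2//; exact: (LfunM (k := 0)).
- by move=> y; rewrite Gc.
- move=> i y; apply: integral_scaled_le => //; first exact: measurable_section.
    by rewrite -exprM.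
  by rewrite exprn_even_ge0.
Qed.

End degenerate_kernel_scaling.

Section degenerate_ustatistic.
Context {R : realType} {d : measure_display} {T : measurableType d} {n : nat}.
Variables (nu : probability (n.-tuple T) R) (mu : 'I_n -> probability T R).
Variables (h G : T -> T -> R) (c B Q : R).
Hypothesis nu_mu : resample_invariant nu mu.
Hypothesis hG : degenerate_kernel mu h G c B Q.
Hypothesis n_gt0 : (0 < n)%N.
Implicit Types (i j l : 'I_n) (x : n.-tuple T) (y z : T).
Local Notation h_ := (@offdiag R d T n h).
Local Notation G_ := (@at_pair R d T n G).

Let i0 : 'I_n := Ordinal n_gt0.
Let mh := measurable_kernel hG.
Let mG := measurable_iterate hG.

Lemma kernel_Lfun4 i y : h y \in Lfun (mu i) 4%:E.
Proof. exact: (section_evenX_Lfun mh _ _ (integral_kernel4_le hG i y)). Qed.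

Lemma kernel_Lfun2 i y : h y \in Lfun (mu i) 2%:E.
Proof. exact/Lfun42/kernel_Lfun4. Qed.

Lemma iterate_Lfun2 i y : G y \in Lfun (mu i) 2%:E.
Proof. exact: (section_evenX_Lfun mG _ _ (integral_iterate2_le hG i y)). Qed.

Lemma Ex_kernel2 i y : \int[mu i]_z h y z ^+ 2 = c.
Proof.
by under eq_Rintegral do rewrite expr2; rewrite (Ex_kernelM hG) (iterate_diag hG).
Qed.

Lemma iterateC y z : G y z = G z y.
Proof.
by rewrite -!(Ex_kernelM hG i0); apply: eq_Rintegral => ? _; rewrite mulrC.
Qed.

Lemma conditional_variance_ge0 : 0 <= c.
Proof.
by rewrite -(Ex_kernel2 i0 point); apply: Rintegral_ge0 => z _; exact: sqr_ge0.
Qed.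

Lemma kernel_bound_ge0 : 0 <= B.
Proof.
rewrite -lee_fin; apply: le_trans (integral_kernel4_le hG i0 point).
by apply: integral_ge0 => z _; rewrite lee_fin exprn_even_ge0.
Qed.

Lemma iterate_bound_ge0 : 0 <= Q.
Proof.
rewrite -lee_fin; apply: le_trans (integral_iterate2_le hG i0 point).
by apply: integral_ge0 => z _; rewrite lee_fin sqr_ge0.
Qed.

Let kernelM_integrable i y : (mu i \x mu i)%E.-integrable setT
  (fun p : T * T => (h y p.2 * h p.1 p.2)%:E).
Proof.
have mhh : measurable_fun setT (fun p : T * T => h y p.2 * h p.1 p.2).
  apply: measurable_funM => //.
  exact: (measurableT_comp (measurable_section mh y) measurable_snd).
have mf : measurable_fun setT (fun p : T * T => (h y p.2 * h p.1 p.2)%:E).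
  exact/measurable_EFinP.
apply/integrable12ltyP => //; apply: (@le_lt_trans _ _ (2 * c)%:E); last exact: ltry.
apply: (@le_trans _ _ (\int[mu i]_z cst (2 * c)%:E z)%E); last first.
  by rewrite integral_cst// [X in (_ * X)%E](probability_setT (mu i)) mule1.
apply: ge0_le_integral => //.
- by move=> z _; apply: integral_ge0 => ? _; exact: abse_ge0.
- apply: (measurable_fun_fubini_tonelli_F (m2 := mu i)
    (fun p => `|(h y p.2 * h p.1 p.2)%:E|%E)) => //.
  exact: measurableT_comp.
move=> z _; have [Ly Lz] := (kernel_Lfun2 i y, kernel_Lfun2 i z).
have Lyz : (fun w => h y w * h z w) \in Lfun (mu i) 1 by exact: (LfunM (k := 0)).
under eq_integral do rewrite abse_EFin.
rewrite -(Ex_EFin (Lfun_norm Lyz)) lee_fin.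
rewrite mulr_natl mulr2n -{1}(Ex_kernel2 i y) -(Ex_kernel2 i z).
have Ly2 := Lfun_evenX Ly isT isT.
have Lz2 := Lfun_evenX Lz isT isT.
rewrite -ExD//; apply: le_Ex; [exact: Lfun_norm|exact: rpredD|move=> w].
rewrite ler_norml; have := sqr_ge0 (h y w - h z w).
by have := sqr_ge0 (h y w + h z w); rewrite sqrrB sqrrD; lra.
Qed.

Lemma Ex_iterate i y : \int[mu i]_z G y z = 0.
Proof.
have EhM z : (\int[mu i]_w (h y w * h z w)%:E = (G y z)%:E)%E.
  rewrite -(Ex_kernelM hG i) Ex_EFin//.
  by apply: (LfunM (k := 0)); exact: kernel_Lfun2.
rewrite /Rintegral; under eq_integral do rewrite -EhM.
rewrite (Fubini (kernelM_integrable i y)) (_ : (\int[mu i]_w _)%E = 0%E)//.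
rewrite -[RHS](integral0 (mu i) setT); apply: eq_integral => w _ /=.
have Lh : (fun z => h z w) \in Lfun (mu i) 1.
  by under eq_fun do rewrite (kernelC hG); exact/Lfun21/kernel_Lfun2.
rewrite -(@Ex_EFin _ _ _ _ (fun z => h y w * h z w)); last exact: rpredZ.
rewrite ExZ//; under eq_Rintegral do rewrite (kernelC hG).
by rewrite (Ex_kernel hG) mulr0.
Qed.

Lemma offdiagC i j x : h_ i j x = h_ j i x.
Proof. by rewrite /offdiag eq_sym; case: ifP => // _; exact: kernelC hG _ _. Qed.

Lemma centred_in_offdiagr i j : i != j -> centred_in mu j (h_ i j).
Proof.
move=> ij; rewrite offdiag_neq//; apply: centred_in_at_pair => // y.
  exact/Lfun21/kernel_Lfun2.
exact: Ex_kernel hG _ _.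
Qed.

Lemma centred_in_offdiagl i j : i != j -> centred_in mu i (h_ i j).
Proof.
move=> ij; rewrite (_ : h_ i j = h_ j i).
  by apply: centred_in_offdiagr; rewrite eq_sym.
by apply/funext => x; exact: offdiagC.
Qed.

Lemma centred_in_iterater i j : i != j -> centred_in mu j (G_ i j).
Proof.
move=> ij; apply: centred_in_at_pair => // y; last exact: Ex_iterate.
exact/Lfun21/iterate_Lfun2.
Qed.

Lemma centred_in_iteratel i j : i != j -> centred_in mu i (G_ i j).
Proof.
move=> ij; rewrite (_ : G_ i j = G_ j i).
  by apply: centred_in_iterater; rewrite eq_sym.
by apply/funext => x; exact: iterateC.
Qed.

Lemma Lfun4_offdiag i j : h_ i j \in Lfun nu 4%:E.
Proof.
have [->|ij] := eqVneq i j.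
  rewrite (_ : h_ j j = cst 0); first exact: Lfun_cst.
  by apply/funext => x; rewrite offdiagii.
rewrite offdiag_neq//; apply: (Lfun_at_pair mh nu_mu) => // y.
exact: integral_kernel4_le hG _ _.
Qed.

Lemma Lfun2_offdiag i j : h_ i j \in Lfun nu 2%:E.
Proof. exact/Lfun42/Lfun4_offdiag. Qed.

Lemma Lfun2_offdiagM i j l m : (fun x => h_ i j x * h_ l m x) \in Lfun nu 2%:E.
Proof. by apply: (LfunM (k := 1)); exact: Lfun4_offdiag. Qed.

Lemma Ex_offdiag4_le i j : \int[nu]_x h_ i j x ^+ 4 <= B.
Proof.
have [->|ij] := eqVneq i j.
  under eq_Rintegral do rewrite offdiagii expr0n/=.
  by rewrite Ex_cst kernel_bound_ge0.
rewrite offdiag_neq//; apply: (Ex_at_pair_le mh nu_mu) => // y.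
exact: integral_kernel4_le hG _ _.
Qed.

Lemma Ex_offdiag2 i j : i != j -> \int[nu]_x h_ i j x ^+ 2 = c.
Proof.
move=> ij; have := Lfun2_offdiag i j; rewrite offdiag_neq// => Lhij.
by apply: (Ex_at_pair_sqr nu_mu) => // y; [exact: kernel_Lfun2|exact: Ex_kernel2].
Qed.

Lemma Ex_offdiagM2_le i j l m : \int[nu]_x (h_ i j x * h_ l m x) ^+ 2 <= B.
Proof.
under eq_Rintegral do rewrite exprMn.
by apply: ExM_le; try exact/Lfun_sqr/Lfun4_offdiag;
  under eq_Rintegral do rewrite -exprM; exact: Ex_offdiag4_le.
Qed.

Lemma Lfun2_iterate i j : i != j -> G_ i j \in Lfun nu 2%:E.
Proof.
move=> ij; apply: (Lfun_at_pair mG nu_mu) => // y.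
exact: integral_iterate2_le hG _ _.
Qed.

Lemma Ex_iterate2_le i j : i != j -> \int[nu]_x G_ i j x ^+ 2 <= Q.
Proof.
move=> ij; apply: (Ex_at_pair_le mG nu_mu) => // y.
exact: integral_iterate2_le hG _ _.
Qed.

Lemma Ex_pair_sum_sqr_le (p : pred ('I_n * 'I_n))
    (q : 'I_n * 'I_n -> n.-tuple T -> R) (S : R) : 0 <= S ->
  (forall a, p a -> q a \in Lfun nu 2%:E) ->
  (forall a, p a -> centred_in mu a.1 (q a) /\ centred_in mu a.2 (q a)) ->
  (forall a b i, p a -> p b -> (i == a.1) || (i == a.2) -> i != b.1 -> i != b.2 ->
    constant_in i (q b)) ->
  (forall a, p a -> \int[nu]_x q a x ^+ 2 <= S) ->
  \int[nu]_x (\sum_(a | p a) q a x) ^+ 2 <= 4 * n%:R ^+ 2 * S.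
Proof.
move=> S0 Lq zq cq qS; have -> : n%:R ^+ 2 = #|{: 'I_n * 'I_n}|%:R :> R.
  by rewrite card_prod card_ord natrM.
apply: (Ex_sqr_orthogonal_sum_le nu_mu (supp := fun a => [set a.1; a.2]%SET)) => //.
- by move=> a i /zq[z1 z2]; rewrite !inE => /orP[]/eqP ->.
- by move=> a b i pa pb; rewrite !inE negb_or => ia /andP[i1 i2]; exact: (cq a).
- by move=> a _; exact: card_same_pair.
Qed.

Lemma sum_offdiag (F : 'I_n -> 'I_n -> R) : (forall i, F i i = 0) ->
  \sum_i \sum_j F i j = \sum_(a : 'I_n * 'I_n | a.1 != a.2) F a.1 a.2.
Proof.
move=> F0; rewrite pair_big_dep/= [RHS]big_mkcond/=.
by apply: eq_bigr => -[i j] _ /=; case: ifPn => // /negPn/eqP ->; exact: F0.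
Qed.

Definition row_sum i x : R := \sum_j h_ i j x.

Definition ustat x : R := 2^-1 * \sum_i row_sum i x.

Definition half_energy x : R := 2^-1 * \sum_i row_sum i x ^+ 2.

Lemma row_sumE i x : row_sum i x = \sum_(j | j != i) h_ i j x.
Proof. by rewrite /row_sum (bigD1 i)//= offdiagii add0r. Qed.

Lemma Lfun4_row_sum i : row_sum i \in Lfun nu 4%:E.
Proof. by apply: Lfun_sum => // j _; exact: Lfun4_offdiag. Qed.

Lemma Lfun4_ustat : ustat \in Lfun nu 4%:E.
Proof.
by apply: rpredZ => //; apply: Lfun_sum => // i _; exact: Lfun4_row_sum.
Qed.

Lemma Lfun2_half_energy : half_energy \in Lfun nu 2%:E.
Proof.
apply: rpredZ => //; apply: Lfun_sum => // i _.
exact/Lfun_sqr/Lfun4_row_sum.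
Qed.

Lemma centred_in_row_sum i : centred_in mu i (row_sum i).
Proof.
apply: centred_in_sum => j _; have [<-|ij] := eqVneq i j; last exact: centred_in_offdiagl.
move=> x; under eq_fun do rewrite offdiagii.
by split; [exact: Lfun_cst|exact: Ex_cst].
Qed.

Lemma Ex_row_sum2_le i : \int[nu]_x row_sum i x ^+ 2 <= n%:R * c.
Proof.
under eq_Rintegral do rewrite row_sumE.
rewrite -[n%:R]mul1r -[in leRHS](card_ord n).
apply: (Ex_sqr_orthogonal_sum_le nu_mu (supp := fun j => [set j]%SET) (m := 1)).
- exact: conditional_variance_ge0.
- by move=> j _; exact: Lfun2_offdiag.
- by move=> j l ji; rewrite inE => /eqP ->; apply: centred_in_offdiagr; rewrite eq_sym.
- by move=> j l k ji li; rewrite !inE => /eqP -> jl; exact: constant_in_offdiag.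
- by move=> j ji; rewrite Ex_offdiag2// eq_sym.
- move=> j _; rewrite (eq_card (B := pred1 j)) ?card1// => l.
  by rewrite !inE; apply/eqP/eqP => [/set1_inj|->].
Qed.

Lemma ustatE x : ustat x = 2^-1 * \sum_(a : 'I_n * 'I_n | a.1 != a.2) h_ a.1 a.2 x.
Proof.
by rewrite /ustat (sum_offdiag (F := fun i j => h_ i j x))// => i; exact: offdiagii.
Qed.

Lemma Ex_ustat2_le : \int[nu]_x ustat x ^+ 2 <= n%:R ^+ 2 * c.
Proof.
pose W x := \sum_(a : 'I_n * 'I_n | a.1 != a.2) h_ a.1 a.2 x.
have LW : W \in Lfun nu 2%:E by apply: Lfun_sum => // a _; exact: Lfun2_offdiag.
under eq_Rintegral do rewrite ustatE exprMn.
rewrite ExZ; last exact: Lfun_evenX LW _ _.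
suff : \int[nu]_x W x ^+ 2 <= 4 * n%:R ^+ 2 * c by lra.
apply: Ex_pair_sum_sqr_le.
- exact: conditional_variance_ge0.
- by move=> a _; exact: Lfun2_offdiag.
- by move=> a aa; split; [exact: centred_in_offdiagl|exact: centred_in_offdiagr].
- by move=> a b i _ _ _; exact: constant_in_offdiag.
- by move=> a aa; rewrite Ex_offdiag2.
Qed.

Definition distinct_triple := [pred b : 'I_n * 'I_n * 'I_n |
  [&& b.1.2 != b.2, b.1.2 != b.1.1 & b.2 != b.1.1]].

Definition distinct_from i := [pred a : 'I_n * 'I_n |
  [&& a.1 != a.2, a.1 != i & a.2 != i]].

Lemma row_sum_sqr i x : row_sum i x ^+ 2 = \sum_j h_ i j x ^+ 2 +
  \sum_(a | distinct_from i a) h_ i a.1 x * h_ i a.2 x.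
Proof.
rewrite /row_sum expr2 big_distrlr/=.
transitivity (\sum_j (h_ i j x ^+ 2 + \sum_(k | k != j) h_ i j x * h_ i k x)).
  by apply: eq_bigr => j _; rewrite (bigD1 j)//= expr2.
rewrite big_split/=; congr (_ + _); rewrite pair_big_dep/=.
rewrite big_mkcond [RHS]big_mkcond/=; apply: eq_bigr => -[j k] _ /=.
rewrite [k == j]eq_sym; case: (j != k) => //=.
have [->|] := eqVneq j i; first by rewrite offdiagii mul0r.
by have [->|//] := eqVneq k i; rewrite offdiagii mulr0.
Qed.

Lemma Ex_sum_offdiag2_sqr_le i :
  \int[nu]_x (\sum_j h_ i j x ^+ 2) ^+ 2 <= n%:R ^+ 2 * B.
Proof.
have L4 j : (fun x => h_ i j x ^+ 4) \in Lfun nu 1.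
  exact: Lfun_evenX (Lfun4_offdiag i j) _ _.
apply: (@le_trans _ _ (\int[nu]_x (n%:R * \sum_j h_ i j x ^+ 4))).
  apply: le_Ex.
  - have : (fun x => \sum_j h_ i j x ^+ 2) \in Lfun nu 2%:E.
      by apply: Lfun_sum => // j _; exact/Lfun_sqr/Lfun4_offdiag.
    by case/Lfun_evenXP.
  - by apply: rpredZ => //; exact: Lfun_sum.
  - move=> x; apply: le_trans (sqr_sum_le _) _; rewrite card_ord.
    by under eq_bigr do rewrite -exprM.
rewrite ExZ ?Ex_sum//; last exact: Lfun_sum.
rewrite expr2 -mulrA ler_wpM2l// mulr_natl -[X in _ *+ X]card_ord -sumr_const.
by apply: ler_sum => j _; exact: Ex_offdiag4_le.
Qed.

Lemma Ex_cross_sum_sqr_le i :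
  \int[nu]_x (\sum_(a | distinct_from i a) h_ i a.1 x * h_ i a.2 x) ^+ 2 <=
  4 * n%:R ^+ 2 * B.
Proof.
apply: Ex_pair_sum_sqr_le.
- exact: kernel_bound_ge0.
- by move=> a _; exact: Lfun2_offdiagM.
- move=> a /and3P[a12 a1i a2i]; split.
    apply: centred_inM; first by apply: centred_in_offdiagr; rewrite eq_sym.
    exact: constant_in_offdiag.
  under eq_fun do rewrite mulrC.
  apply: centred_inM; first by apply: centred_in_offdiagr; rewrite eq_sym.
  by apply: constant_in_offdiag => //; rewrite eq_sym.
- move=> a b j /and3P[a12 a1i a2i] _ ja j1 j2.
  have ji : j != i by case/orP : ja => /eqP ->.
  by apply: constant_inM; exact: constant_in_offdiag.
- by move=> a _; exact: Ex_offdiagM2_le.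
Qed.

Lemma Ex_row_sum4_le i : \int[nu]_x row_sum i x ^+ 4 <= 10 * n%:R ^+ 2 * B.
Proof.
pose D x := \sum_j h_ i j x ^+ 2.
pose O x := \sum_(a | distinct_from i a) h_ i a.1 x * h_ i a.2 x.
have LD2 : (fun x => D x ^+ 2) \in Lfun nu 1.
  have : D \in Lfun nu 2%:E.
    by apply: Lfun_sum => // j _; exact/Lfun_sqr/Lfun4_offdiag.
  by case/Lfun_evenXP.
have LO2 : (fun x => O x ^+ 2) \in Lfun nu 1.
  have : O \in Lfun nu 2%:E by apply: Lfun_sum => // a _; exact: Lfun2_offdiagM.
  by case/Lfun_evenXP.
apply: (@le_trans _ _ (\int[nu]_x (2 * (D x ^+ 2 + O x ^+ 2)))).
  apply: le_Ex; first exact: Lfun_evenX (Lfun4_row_sum i) _ _.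
    by apply: rpredZ => //; exact: rpredD.
  move=> x; rewrite -[4%N]/(2 * 2)%N exprM row_sum_sqr -/(D x) -/(O x).
  by have := sqr_ge0 (D x - O x); nra.
rewrite ExZ ?ExD ?rpredD//.
have := Ex_sum_offdiag2_sqr_le i; have := Ex_cross_sum_sqr_le i.
by rewrite -/D -/O; lra.
Qed.

Definition sqr_component (a : 'I_n * 'I_n) x : R := h_ a.1 a.2 x ^+ 2 - c.

Definition cross_component (b : 'I_n * 'I_n * 'I_n) x : R :=
  h_ b.1.1 b.1.2 x * h_ b.1.1 b.2 x - G_ b.1.2 b.2 x.

Lemma Lfun2_sqr_component a : sqr_component a \in Lfun nu 2%:E.
Proof.
by apply: rpredB => //; [exact/Lfun_sqr/Lfun4_offdiag|exact: Lfun_cst].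
Qed.

Lemma Lfun2_cross_component b : distinct_triple b -> cross_component b \in Lfun nu 2%:E.
Proof.
case/and3P => jk _ _.
by apply: rpredB => //; [exact: Lfun2_offdiagM|exact: Lfun2_iterate].
Qed.

Lemma sum_distinct_pairs (a : R) :
  \sum_(e : 'I_n * 'I_n | e.1 != e.2) a = n%:R * (n%:R - 1) * a.
Proof.
rewrite -(pair_big_dep predT (fun i j => i != j) (fun _ _ => a))/=.
under eq_bigr => i _.
  rewrite sumr_const (eq_card (B := predC1 i)); last first.
    by move=> j; rewrite !inE eq_sym.
  rewrite cardC1 card_ord -subn1 -mulr_natl natrB//. over.
by rewrite sumr_const card_ord -[LHS]mulr_natl mulrA.
Qed.

Lemma sum_distinct_triples (F : 'I_n -> 'I_n -> R) :
  \sum_(b | distinct_triple b) F b.1.2 b.2 =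
  (n%:R - 2) * \sum_(a : 'I_n * 'I_n | a.1 != a.2) F a.1 a.2.
Proof.
rewrite mulr_sumr; transitivity (\sum_(a : 'I_n * 'I_n | a.1 != a.2)
    \sum_(i | (a.1 != i) && (a.2 != i)) F a.1 a.2).
  rewrite [RHS]pair_big_dep/= (reindex (fun e : 'I_n * 'I_n * 'I_n =>
      ((e.2, e.1.1), e.1.2)))/=; last first.
    by exists (fun b : 'I_n * 'I_n * 'I_n => ((b.1.2, b.2), b.1.1)) => -[[? ?] ?].
  by apply: eq_bigl => -[[j k] i].
apply: eq_bigr => -[j k] /= jk; rewrite sumr_const -[LHS]mulr_natl; congr (_ * _).
have := cardC (pred2 j k); rewrite card2 jk card_ord => /= n2.
rewrite -[in RHS]n2 natrD addrAC subrr add0r; congr (_%:R); apply: eq_card => i.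
by rewrite !unfold_in /= negb_or (eq_sym i j) (eq_sym i k).
Qed.

Lemma half_energy_hoeffding x :
  2 * (half_energy x - 2^-1 * n%:R * (n%:R - 1) * c) =
  \sum_(a : 'I_n * 'I_n | a.1 != a.2) sqr_component a x +
  \sum_(b | distinct_triple b) cross_component b x +
  (n%:R - 2) * \sum_(a : 'I_n * 'I_n | a.1 != a.2) G_ a.1 a.2 x.
Proof.
rewrite !sumrB sum_distinct_pairs -(sum_distinct_triples (fun j k => G_ j k x)).
rewrite -(sum_offdiag (F := fun i j => h_ i j x ^+ 2)); last first.
  by move=> i; rewrite offdiagii expr0n.
have -> : \sum_(b | distinct_triple b) h_ b.1.1 b.1.2 x * h_ b.1.1 b.2 x =
    \sum_i \sum_(a | distinct_from i a) h_ i a.1 x * h_ i a.2 x.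
  rewrite [RHS]pair_big_dep/= (reindex (fun e : 'I_n * ('I_n * 'I_n) =>
      ((e.1, e.2.1), e.2.2)))/=; last first.
    by exists (fun b : 'I_n * 'I_n * 'I_n => (b.1.1, (b.1.2, b.2))) => [[? []]|[[]]].
  by apply: eq_bigl => -[i [j k]].
rewrite /half_energy; under eq_bigr do rewrite row_sum_sqr.
by rewrite big_split/=; lra.
Qed.

Lemma Ex_sqr_components_le :
  \int[nu]_x (\sum_(a : 'I_n * 'I_n | a.1 != a.2) sqr_component a x) ^+ 2 <=
  4 * n%:R ^+ 2 * B.
Proof.
have centred_inr i j : i != j -> centred_in mu j (sqr_component (i, j)).
  move=> ij x; have Lh := Lfun_evenX (kernel_Lfun2 j (tnth x i)) isT isT.
  rewrite (_ : (fun y => _) = fun y => h (tnth x i) y ^+ 2 - c); last first.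
    by apply/funext => y; rewrite /sqr_component/= offdiag_neq// at_pair_resample.
  split; first by apply: rpredB => //; exact: Lfun_cst.
  by rewrite ExB ?Ex_cst ?Ex_kernel2 ?subrr//; exact: Lfun_cst.
apply: Ex_pair_sum_sqr_le.
- exact: kernel_bound_ge0.
- by move=> a _; exact: Lfun2_sqr_component.
- move=> [i j] /= ij; split; last exact: centred_inr.
  rewrite (_ : sqr_component (i, j) = sqr_component (j, i)).
    by apply: centred_inr; rewrite eq_sym.
  by apply/funext => x; rewrite /sqr_component/= offdiagC.
- by move=> a b i _ _ _ i1 i2 x y; rewrite /sqr_component constant_in_offdiag.
move=> a aa; have L2 := Lfun_evenX (Lfun2_offdiag a.1 a.2) isT isT.
have L4 := Lfun_evenX (Lfun4_offdiag a.1 a.2) isT isT.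
have sqrE x : sqr_component a x ^+ 2 =
    h_ a.1 a.2 x ^+ 4 - 2 * c * h_ a.1 a.2 x ^+ 2 + c ^+ 2.
  by rewrite /sqr_component; ring.
under eq_Rintegral do rewrite sqrE.
have Lc2 : (fun x => 2 * c * h_ a.1 a.2 x ^+ 2) \in Lfun nu 1 by exact: rpredZ.
rewrite ExD ?(ExB L4 Lc2) ?(ExZ _ L2) ?Ex_cst ?Ex_offdiag2//; last 2 first.
- by apply: rpredB => //; apply: rpredZ.
- exact: Lfun_cst.
by have := Ex_offdiag4_le a.1 a.2; have := sqr_ge0 c; nra.
Qed.

Lemma centred_in_cross_component l b : distinct_triple b ->
  l \in [set b.1.1; b.1.2; b.2]%SET -> centred_in mu l (cross_component b).
Proof.
have centred_mid i j k : j != k -> j != i -> k != i ->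
    centred_in mu j (cross_component ((i, j), k)).
  move=> jk ji ki; apply: centred_inB; last exact: centred_in_iteratel.
  apply: centred_inM; first by apply: centred_in_offdiagr; rewrite eq_sym.
  exact: constant_in_offdiag.
case: b => [[i j] k] /and3P[/= jk ji ki].
rewrite !inE/= => /orP[/orP[/eqP ->|/eqP ->]|/eqP ->]; last first.
- rewrite (_ : cross_component _ = cross_component ((i, k), j)).
    by apply: centred_mid => //; rewrite eq_sym.
  by apply/funext => x; rewrite /cross_component/= mulrC /at_pair iterateC.
- exact: centred_mid.
move=> x; have Lhh : (fun y => h (tnth x j) y * h (tnth x k) y) \in Lfun (mu i) 1.
  by apply: (LfunM (k := 0)); exact: kernel_Lfun2.
rewrite (_ : (fun y => _) = fun y =>
    h (tnth x j) y * h (tnth x k) y - G (tnth x j) (tnth x k)); last first.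
  apply/funext => y; rewrite /cross_component/= ![h_ i _ _]offdiagC.
  by rewrite !offdiag_neq// !at_pair_resample// /at_pair !tnth_resample_neq.
split; first by apply: rpredB => //; exact: Lfun_cst.
by rewrite ExB ?Ex_cst ?(Ex_kernelM hG) ?subrr//; exact: Lfun_cst.
Qed.

Lemma Ex_cross_components_le :
  \int[nu]_x (\sum_(b | distinct_triple b) cross_component b x) ^+ 2 <=
  54 * n%:R ^+ 3 * (B + Q).
Proof.
have -> : 54 * n%:R ^+ 3 * (B + Q) =
    27 * #|{: 'I_n * 'I_n * 'I_n}|%:R * (2 * B + 2 * Q) :> R.
  by rewrite !card_prod !card_ord !natrM; ring.
apply: (Ex_sqr_orthogonal_sum_le nu_mu
  (supp := fun b => [set b.1.1; b.1.2; b.2]%SET)) => //.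
- by rewrite addr_ge0// mulr_ge0// ?kernel_bound_ge0 ?iterate_bound_ge0.
- by move=> b; exact: Lfun2_cross_component.
- by move=> b l; exact: centred_in_cross_component.
- move=> a b l _ _ _; rewrite !inE !negb_or => /andP[/andP[? ?] ?] x y.
  by rewrite /cross_component !constant_in_offdiag// constant_in_at_pair.
- move=> [[i j] k] /and3P[/= jk ji ki].
  have Lhh := Lfun_evenX (Lfun2_offdiagM i j i k) isT isT.
  have LG := Lfun_evenX (Lfun2_iterate jk) isT isT.
  apply: (@le_trans _ _ (\int[nu]_x (2 * ((h_ i j x * h_ i k x) ^+ 2 + G_ j k x ^+ 2)))).
    apply: le_Ex.
    - have /Lfun2_cross_component : distinct_triple ((i, j), k) by rewrite /= jk ji ki.
      by case/Lfun_evenXP.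
    - by apply: rpredZ => //; exact: rpredD.
    - move=> x; rewrite /cross_component/=; set u := h_ i j x * _; set w := G_ j k x.
      by have := sqr_ge0 (u + w); nra.
  rewrite ExZ ?ExD ?rpredD//.
  by have := Ex_offdiagM2_le i j i k; have := Ex_iterate2_le jk; lra.
- by move=> b _; exact: card_same_triple.
Qed.

Lemma Ex_iterate_sum_sqr_le :
  \int[nu]_x (\sum_(a : 'I_n * 'I_n | a.1 != a.2) G_ a.1 a.2 x) ^+ 2 <=
  4 * n%:R ^+ 2 * Q.
Proof.
apply: Ex_pair_sum_sqr_le.
- exact: iterate_bound_ge0.
- by move=> a aa; exact: Lfun2_iterate.
- by move=> a aa; split; [exact: centred_in_iteratel|exact: centred_in_iterater].
- by move=> a b i _ _ _; exact: constant_in_at_pair.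
- by move=> a aa; exact: Ex_iterate2_le.
Qed.

Lemma half_energy_variance_le :
  \int[nu]_x (half_energy x - 2^-1 * n%:R * (n%:R - 1) * c) ^+ 2 <=
  44 * (n%:R ^+ 3 * B + n%:R ^+ 4 * Q).
Proof.
pose S1 x := \sum_(a : 'I_n * 'I_n | a.1 != a.2) sqr_component a x.
pose S2 x := \sum_(b | distinct_triple b) cross_component b x.
pose S3 x := \sum_(a : 'I_n * 'I_n | a.1 != a.2) G_ a.1 a.2 x.
have L1 : S1 \in Lfun nu 2%:E.
  by apply: Lfun_sum => // a _; exact: Lfun2_sqr_component.
have L2 : S2 \in Lfun nu 2%:E.
  by apply: Lfun_sum => // b; exact: Lfun2_cross_component.
have L3 : S3 \in Lfun nu 2%:E by apply: Lfun_sum => // a; exact: Lfun2_iterate.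
have LZ3 : (fun x => (n%:R - 2) * S3 x) \in Lfun nu 2%:E by exact: rpredZ.
have Lsum : (fun x => S1 x + S2 x + (n%:R - 2) * S3 x) \in Lfun nu 2%:E.
  by apply: rpredD => //; exact: rpredD.
have hoeffding x : (half_energy x - 2^-1 * n%:R * (n%:R - 1) * c) ^+ 2 =
    4^-1 * (S1 x + S2 x + (n%:R - 2) * S3 x) ^+ 2.
  by rewrite -half_energy_hoeffding; field.
under eq_Rintegral do rewrite hoeffding.
rewrite ExZ; last exact: Lfun_evenX Lsum isT isT.
have := Ex_sqr_sum3_le L1 L2 LZ3.
have -> : \int[nu]_x ((n%:R - 2) * S3 x) ^+ 2 =
    (n%:R - 2) ^+ 2 * \int[nu]_x S3 x ^+ 2.
  under eq_Rintegral do rewrite exprMn.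
  by rewrite ExZ//; exact: Lfun_evenX L3 isT isT.
move=> sum3_le.
have I1B : \int[nu]_x S1 x ^+ 2 <= _ := Ex_sqr_components_le.
have I2BQ : \int[nu]_x S2 x ^+ 2 <= _ := Ex_cross_components_le.
have I3Q : \int[nu]_x S3 x ^+ 2 <= _ := Ex_iterate_sum_sqr_le.
have n1 : (1 : R) <= n%:R by rewrite ler1n.
have nn : (n%:R - 2) ^+ 2 <= n%:R ^+ 2 :> R by nra.
have B0 : 0 <= B := kernel_bound_ge0; have Q0 : 0 <= Q := iterate_bound_ge0.
have B23 : n%:R ^+ 2 * B <= n%:R ^+ 3 * B by rewrite ler_wpM2r// ler_weXn2l.
have Q34 : n%:R ^+ 3 * Q <= n%:R ^+ 4 * Q by rewrite ler_wpM2r// ler_weXn2l.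
have B3 : 0 <= n%:R ^+ 3 * B by rewrite mulr_ge0.
have Q4 : 0 <= n%:R ^+ 4 * Q by rewrite mulr_ge0.
have nI3 : (n%:R - 2) ^+ 2 * \int[nu]_x S3 x ^+ 2 <= 4 * (n%:R ^+ 4 * Q).
  have -> : 4 * (n%:R ^+ 4 * Q) = n%:R ^+ 2 * (4 * n%:R ^+ 2 * Q) by ring.
  by rewrite ler_pM// ?sqr_ge0//; apply: Rintegral_ge0 => x _; exact: sqr_ge0.
lra.
Qed.

End degenerate_ustatistic.

(** * Stein's method for the normal law *)

Section quadratic_modulus.
Context {R : realType}.
Implicit Types (f g : R -> R) (M eps K : R).

(* Uniform continuity of a bounded function, in the form that is integrated
   against moments: a small constant plus a multiple of the squared distance. *)
Definition quadratic_modulus f eps K :=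
  forall a b, `|f a - f b| <= eps + K * (a - b) ^+ 2.

Lemma mean_value_between g g' a b : (forall x : R, is_derive x 1 g (g' x)) ->
  exists2 z, `|z - a| <= `|b| & g a - g (a - b) = b * g' z.
Proof.
move=> dg; have cg : continuous g.
  by move=> x; apply: differentiable_continuous; apply/derivable1_diffP; case: (dg x).
have [b0|b0] := leP 0 b.
  have ab : a - b <= a by rewrite gerBl.
  have [z] := MVT_segment ab (fun x _ => dg x) (continuous_subspaceT cg).
  rewrite in_itv/= => /andP[z1 z2] E; exists z; last by rewrite E; ring.
  by rewrite (ger0_norm b0) ler0_norm; lra.
have ab : a <= a - b by rewrite lerDl oppr_ge0 ltW.
have [z] := MVT_segment ab (fun x _ => dg x) (continuous_subspaceT cg).
rewrite in_itv/= => /andP[z1 z2] E; exists z; last by rewrite -opprB E; ring.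
by rewrite (ltr0_norm b0) ger0_norm; lra.
Qed.

Lemma quadratic_modulus_taylor g g' eps K :
  (forall x : R, is_derive x 1 g (g' x)) -> 0 <= K -> quadratic_modulus g' eps K ->
  forall a b, `|g a - g (a - b) - b * g' a| <= `|b| * (eps + K * b ^+ 2).
Proof.
move=> dg K0 g'K a b; have [z zb ->] := mean_value_between a b dg.
rewrite -mulrBr normrM ler_wpM2l//; apply: le_trans (g'K _ _) _.
rewrite lerD2l ler_wpM2l//.
by rewrite -(real_normK (num_real b)) -(real_normK (num_real (z - a)))
  lerXn2r ?nnegrE.
Qed.

Lemma continuous_segment_unif f a b eps : continuous f -> 0 < eps ->
  exists2 delta, 0 < delta & forall x y, a <= x <= b -> `|y - x| < delta ->
    `|f y - f x| <= eps.
Proof.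
move=> cf e0.
pose P (i x : R) := forall y, `|y - x| < i -> `|f y - f x| <= eps.
suff : \forall i \near (0:R)^'+, `[a, b] `<=` P i.
  move=> nearP; have /filter_ex[i [i0 Pi]] :
      \forall i \near (0:R)^'+, 0 < i /\ `[a, b] `<=` P i.
    by near=> i; split; near: i => //; exact: nbhs_right_gt.
  by exists i => // x y xab; apply: Pi; rewrite /= in_itv.
have /compact_near_coveringP := @segment_compact R a b; apply => x _.
have e2 : 0 < eps / 2 by rewrite divr_gt0.
have /cvgrPdist_lt/(_ _ e2) /nbhs_ballP[r /= r0 fr] := cf x.
have r2 : 0 < r / 2 by rewrite divr_gt0.
exists (ball x (r / 2), [set i | i < r / 2]) => /=.
  by split; [exact: nbhsx_ballx|exact: nbhs_right_lt].
move=> [x' i] /= [xx' ir] y yx'.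
have r2r : r / 2 <= r by rewrite ler_pdivrMr// ler_pMr ?ler1n.
have fx' := fr _ (le_ball r2r xx').
have xy : ball x r y.
  rewrite /ball/= distrC; rewrite /ball/= in xx'.
  rewrite (_ : y - x = (y - x') - (x - x')); last ring.
  by apply: le_lt_trans (ler_normB _ _) _; rewrite (splitr r) ltrD// (lt_trans yx').
rewrite (_ : f y - f x' = (f x - f x') - (f x - f y)); last ring.
apply: le_trans (ler_normB _ _) _; rewrite (splitr eps) ltW// ltrD// fr.
Unshelve. all: by end_near. Qed.

Definition supported_in M f := forall x, M <= `|x| -> f x = 0.

Lemma compact_support_bounded f M : continuous f -> supported_in M f ->
  exists2 C, 0 <= C & forall x, `|f x| <= C.
Proof.
move=> cf f0; have [M0|M0] := ltP M 0.
  by exists 0 => // x; rewrite f0 ?normr0// (le_trans (ltW M0)).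
have MM : - M <= M by rewrite ge0_cp.
have cnf : {within `[- M, M], continuous (fun x => `|f x|)}.
  apply: continuous_subspaceT => x.
  by apply: continuous_comp; [exact: cf|exact: norm_continuous].
have [c _ cmax] := EVT_max MM cnf; exists `|f c| => // x.
have [xM|xM] := leP M `|x|; first by rewrite f0// normr0.
by apply: cmax; rewrite in_itv/= -ler_norml ltW.
Qed.

Lemma compact_support_unif f M eps : continuous f -> supported_in M f -> 0 < eps ->
  exists2 delta, 0 < delta & forall x y, `|y - x| < delta -> `|f y - f x| <= eps.
Proof.
move=> cf f0 e0.
have [r r0 fr] := continuous_segment_unif (- (M + 1)) (M + 1) cf e0.
exists (Num.min r 1); first by rewrite lt_min r0 ltr01.
move=> x y; rewrite lt_min => /andP[yxr yx1].
have [xM|xM] := leP `|x| (M + 1); first by apply: fr; rewrite // -ler_norml.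
have := lerB_dist x y; rewrite distrC => xy.
by rewrite !f0 ?subrr ?normr0 ?ltW//; lra.
Qed.

Lemma compact_support_quadratic_modulus f M eps : continuous f ->
  supported_in M f -> 0 < eps -> exists2 K, 0 <= K & quadratic_modulus f eps K.
Proof.
move=> cf f0 e0; have [C C0 fC] := compact_support_bounded cf f0.
have [r r0 fr] := compact_support_unif cf f0 e0.
have K0 : 0 <= 2 * C / r ^+ 2 by rewrite divr_ge0 ?sqr_ge0// mulr_ge0.
exists (2 * C / r ^+ 2) => // a b; have [ab|ab] := ltP `|a - b| r.
  by apply: le_trans (fr _ _ ab) _; rewrite lerDl mulr_ge0 ?sqr_ge0.
apply: (@le_trans _ _ (2 * C)).
  by apply: le_trans (ler_normB _ _) _; have := fC a; have := fC b; lra.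
apply: (@le_trans _ _ (2 * C / r ^+ 2 * (a - b) ^+ 2)); last by rewrite lerDr ltW.
rewrite -mulrA ler_peMr ?mulr_ge0// mulrC ler_pdivlMr ?exprn_gt0// mul1r.
by rewrite -[leRHS]real_normK ?num_real// lerXn2r ?nnegrE// ltW.
Qed.

End quadratic_modulus.

Record stein_test {R : realType} (g g' : R -> R) (M : R) : Prop := {
  stein_is_derive : forall x : R, is_derive x 1 g (g' x) ;
  stein_continuous : continuous g' ;
  stein_bounded : forall x, `|g x| <= M ;
  stein_derive_bounded : forall x, `|g' x| <= M ;
  stein_modulus : forall eps, 0 < eps ->
    exists2 K, 0 <= K & quadratic_modulus g' eps K
}.

Section stein_equation.
Context {R : realType}.
Local Notation lambda := (@lebesgue_measure R).
Local Notation phi := (@normal_pdf R 0 1).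
Local Notation N01 := (normal_prob 0 1 : probability (measurableTypeR R) R).

Lemma integral_normal_prob (m s : R) (h : R -> R) :
  measurable_fun setT h ->
  h \in Lfun (normal_prob m s : probability (measurableTypeR R) R) 1 ->
  (\int[normal_prob m s]_x (h x)%:E =
   \int[lambda]_x (h x * normal_pdf m s x)%:E)%E.
Proof.
move=> mh /Lfun1_integrable ih; have dom := normal_prob_dominates m s.
rewrite -[LHS](Radon_Nikodym_change_of_variables dom)//=.
under [RHS]eq_integral do rewrite EFinM.
have mEh : measurable_fun setT (EFin \o h) by exact/measurable_EFinP.
apply: ae_eq_integral => //.
- by apply: emeasurable_funM => //; apply: (measurable_int lambda).
- apply: emeasurable_funM => //=; apply/measurableT_comp => //=.
  exact: measurable_normal_pdf.
- apply: ae_eqe_mul2l => /=; rewrite Radon_NikodymE//=.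
  case: cid => /= f [f0 intf fE]; apply: integral_ae_eq => //=.
  + by apply/measurableT_comp => //; exact: measurable_normal_pdf.
  + by move=> E _ mE; rewrite -fE.
Qed.

Lemma normal_pdf01_gt0 x : 0 < phi x.
Proof. by rewrite normal_pdfE// mulr_gt0 ?expR_gt0// normal_peak_gt0. Qed.

Lemma inv_normal_pdf01 x : (phi x)^-1 = (normal_peak 1)^-1 * expR (x ^+ 2 / 2).
Proof.
by rewrite normal_pdfE// invfM /normal_fun -expRN subr0 expr1n mulNr opprK.
Qed.

Lemma is_derive_inv_normal_pdf (x : R) :
  is_derive x 1 (fun t => (phi t)^-1) (x / phi x).
Proof.
rewrite inv_normal_pdf01 (funext inv_normal_pdf01).
apply: is_derive_eq; rewrite /GRing.scale/=; field.
by rewrite gt_eqF// normal_peak_gt0.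
Qed.

Variables (h : R -> R) (M : R).
Hypotheses (h_cont : continuous h) (h_supp : supported_in M h).

Let f t := h t * phi t.

Let continuous_f : continuous f.
Proof. by move=> x; apply: cvgM; [exact: h_cont|exact: continuous_normal_pdf]. Qed.

Let f_integrable : lambda.-integrable setT (EFin \o f).
Proof.
have [C C0 hC] := compact_support_bounded h_cont h_supp.
apply: (@le_integrable _ _ _ lambda setT _ _ (fun x => C%:E * (phi x)%:E)%E) => //.
- by apply/measurable_EFinP; exact: continuous_measurable_fun.
- move=> x _ /=; rewrite lee_fin !normrM ler_wpM2r//.
  exact: le_trans (hC x) (ler_norm _).
- by apply: integrableZl => //; exact: integrable_normal_pdf.
Qed.

Definition stein_primitive y : R := \int[lambda]_(t in [set` `]-oo, y]]) f t.

Definition stein_solution x : R := stein_primitive x / phi x.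

Lemma is_derive_stein_primitive (y : R) : is_derive y 1 stein_primitive (f y).
Proof.
have yy : y < y + 1 by rewrite ltrDl.
have iy : lambda.-integrable [set` `]-oo, (y + 1)]] (EFin \o f).
  exact: integrableS f_integrable.
have [dF FE] :=
  @continuous_FTC1 R f (BInfty _ true) y (y + 1) yy iy (ltNyr _) (@continuous_f y).
by apply: DeriveDef; [exact: dF|rewrite -derive1E].
Qed.

Lemma is_derive_stein_solution (x : R) :
  is_derive x 1 stein_solution (h x + x * stein_solution x).
Proof.
have dF := is_derive_stein_primitive x; have dphi := is_derive_inv_normal_pdf x.
apply: is_derive_eq; rewrite /GRing.scale/= /stein_solution /f; field.
by rewrite gt_eqF// normal_pdf01_gt0.
Qed.

Hypothesis Eh : \int[N01]_x h x = 0.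

Lemma stein_primitive_supported : supported_in M stein_primitive.
Proof.
move=> y My; have [y0|y0] := leP 0 y.
  transitivity (\int[lambda]_t f t).
    rewrite /stein_primitive Rintegral_mkcond; apply: eq_Rintegral => t _.
    rewrite patchE; case: ifPn => //; rewrite notin_setE/= in_itv/= => /negP.
    rewrite -ltNge => yt; rewrite /f h_supp ?mul0r// (le_trans My)// ger0_norm//.
    exact: le_trans (ltW yt) (ler_norm _).
  have [C C0 hC] := compact_support_bounded h_cont h_supp.
  have mh := continuous_measurable_fun h_cont.
  rewrite -Eh; apply: (congr1 fine); rewrite integral_normal_prob//.
  exact: (Lfun_bounded N01 mh hC (lexx 1)).
rewrite /stein_primitive -[RHS](_ : \int[lambda]_(t in [set` `]-oo, y]]) 0 = _).
  apply: eq_Rintegral => t; rewrite inE/= in_itv/= => ty.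
  rewrite /f h_supp ?mul0r// (le_trans My)// !ltr0_norm// ?lerN2//.
  exact: le_lt_trans y0.
by rewrite /Rintegral integral0.
Qed.

Lemma stein_solution_test : exists M',
  stein_test stein_solution (fun x => h x + x * stein_solution x) M'.
Proof.
pose g := stein_solution; pose g' x := h x + x * g x.
have dg := is_derive_stein_solution.
have cg : continuous g.
  by move=> x; apply: differentiable_continuous; apply/derivable1_diffP; case: (dg x).
have cg' : continuous g'.
  by move=> x; apply: cvgD; [exact: h_cont|apply: cvgM; [exact: cvg_id|exact: cg]].
have g0 : supported_in M g.
  by move=> x Mx; rewrite /g /stein_solution stein_primitive_supported// mul0r.
have g'0 : supported_in M g' by move=> x Mx; rewrite /g' g0// h_supp// mulr0 addr0.
have [C C0 gC] := compact_support_bounded cg g0.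
have [C' C'0 g'C'] := compact_support_bounded cg' g'0.
exists (C + C'); split=> //.
- by move=> x; rewrite (le_trans (gC x))// lerDl.
- by move=> x; rewrite (le_trans (g'C' x))// lerDr.
- by move=> eps; exact: compact_support_quadratic_modulus cg' g'0.
Qed.

End stein_equation.

Section convergence_in_law.
Context {R : realType}.

Definition cvg_in_law (d : measure_display) (Omega : nat -> measurableType d)
    (P : forall n, probability (Omega n) R) (W : forall n, Omega n -> R)
    (N : probability (measurableTypeR R) R) :=
  forall f : R -> R, continuous f -> (exists M : R, forall x, `|f x| <= M) ->
    (fun n => \int[P n]_w f (W n w)) @ \oo --> \int[N]_x f x.

Definition cutoff (k : nat) : R -> R :=
  cst 0 \max (cst 1 \min (fun x => k.+1%:R - `|x|)).

Lemma continuous_cutoff k : continuous (cutoff k).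
Proof.
move=> x; apply: continuous_max; first exact: cvg_cst.
apply: continuous_min; first exact: cvg_cst.
by apply: cvgB; [exact: cvg_cst|exact: norm_continuous].
Qed.

Lemma measurable_cutoff k : measurable_fun setT (cutoff k : measurableTypeR R -> R).
Proof. by apply: continuous_measurable_fun; exact: continuous_cutoff. Qed.

Lemma cutoff1 k x : `|x| <= k%:R -> cutoff k x = 1.
Proof.
move=> xk; rewrite /cutoff/= min_l; first by rewrite max_r.
by rewrite -natr1; lra.
Qed.

Lemma cutoff_supported k : supported_in k.+1%:R (cutoff k).
Proof.
move=> x kx; have kx0 : k.+1%:R - `|x| <= 0 by rewrite subr_le0.
by rewrite /cutoff/= min_r ?max_l// (le_trans kx0).
Qed.

Lemma cutoff_ge0 k x : 0 <= cutoff k x.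
Proof. by rewrite le_max lexx. Qed.

Lemma cutoff_le1 k x : cutoff k x <= 1.
Proof. by rewrite ge_max ler01 ge_min lexx. Qed.

Lemma normr_cutoff_le1 k x : `|cutoff k x| <= 1.
Proof. by rewrite ger0_norm ?cutoff_ge0 ?cutoff_le1. Qed.

Lemma cutoff_tail_le k x : 1 - cutoff k.+1 x <= x ^+ 2 / k.+1%:R ^+ 2.
Proof.
have k0 : 0 < k.+1%:R ^+ 2 :> R by rewrite exprn_gt0.
have [xk|xk] := leP `|x| k.+1%:R.
  by rewrite cutoff1// subrr divr_ge0 ?sqr_ge0.
apply: (@le_trans _ _ 1); first by rewrite gerBl cutoff_ge0.
rewrite ler_pdivlMr// mul1r -(real_normK (num_real x)).
by rewrite lerXn2r ?nnegrE// ltW.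
Qed.

Variable N : probability (measurableTypeR R) R.

Lemma Lfun1_cutoffM k f : f \in Lfun N 1 -> (fun x => cutoff k x * f x) \in Lfun N 1.
Proof. exact: Lfun1_bounded_mul (measurable_cutoff k) (normr_cutoff_le1 k). Qed.

Lemma Ex_cutoff_cvg f : f \in Lfun N 1 ->
  (fun k => \int[N]_x (cutoff k x * f x)) @ \oo --> \int[N]_x f x.
Proof.
move=> Lf; have mf := Lfun_measurable Lf.
have mEf : measurable_fun setT (EFin \o f) by exact/measurable_EFinP.
have mc k : measurable_fun setT (fun x : measurableTypeR R => (cutoff k x * f x)%:E).
  by apply/measurable_EFinP/measurable_funM => //; exact: measurable_cutoff.
have cutoff_cvg : {ae N, forall x, setT x ->
    (fun k => (cutoff k x * f x)%:E) @ \oo --> (EFin \o f) x}.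
  apply: aeW => x _; apply: cvg_near_cst.
  exists (Num.truncn `|x|).+1 => // k /= xk.
  rewrite cutoff1 ?mul1r//; apply: ltW; apply: lt_le_trans (truncnS_gt _) _.
  by rewrite ler_nat.
have cutoff_dom : {ae N, forall x k, setT x ->
    (`|(cutoff k x * f x)%:E| <= `|f x|%:E)%E}.
  by apply: aeW => x k _; rewrite lee_fin normrM ler_piMl// normr_cutoff_le1.
have /Lfun1_integrable inf := Lfun_norm Lf.
have [_ _] := dominated_convergence measurableT mc mEf cutoff_cvg inf cutoff_dom.
rewrite -Ex_EFin// => /fine_cvgP[_].
exact.
Qed.

Definition cutoff_mean k f : R :=
  (\int[N]_x (cutoff k x * f x)) / \int[N]_x cutoff k x.

Definition centred_cutoff k f x : R := cutoff k x * (f x - cutoff_mean k f).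

Lemma Ex_cutoff_cvg1 : (fun k => \int[N]_x cutoff k x) @ \oo --> (1 : R).
Proof.
have := Ex_cutoff_cvg (Lfun_cst N 1 1); rewrite Ex_cst.
rewrite (_ : (fun k => _) = fun k => \int[N]_x cutoff k x)//.
by apply/funext => k; apply: eq_Rintegral => x _; rewrite mulr1.
Qed.

Lemma cutoff_mean_cvg f : f \in Lfun N 1 ->
  (fun k => cutoff_mean k f) @ \oo --> \int[N]_x f x.
Proof.
move=> Lf; rewrite -[X in _ --> X]mulr1 -[X in _ * X]invr1.
apply: cvgM; first exact: Ex_cutoff_cvg.
by apply: cvgV; [exact: oner_neq0|exact: Ex_cutoff_cvg1].
Qed.

Lemma continuous_centred_cutoff k f : continuous f -> continuous (centred_cutoff k f).
Proof.
move=> cf x; apply: cvgM; first exact: continuous_cutoff.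
by apply: cvgB; [exact: cf|exact: cvg_cst].
Qed.

Lemma centred_cutoff_supported k f : supported_in k.+1%:R (centred_cutoff k f).
Proof. by move=> x kx; rewrite /centred_cutoff cutoff_supported// mul0r. Qed.

Lemma Ex_centred_cutoff k f : f \in Lfun N 1 -> \int[N]_x cutoff k x != 0 ->
  \int[N]_x centred_cutoff k f x = 0.
Proof.
move=> Lf nz.
have Lc : cutoff k \in Lfun N 1.
  exact: Lfun_bounded (measurable_cutoff k) (normr_cutoff_le1 k) (lexx 1).
have cE x : centred_cutoff k f x = cutoff k x * f x - cutoff_mean k f * cutoff k x.
  by rewrite /centred_cutoff; ring.
under eq_Rintegral do rewrite cE.
rewrite ExB ?ExZ ?divfK ?subrr//; [exact: Lfun1_cutoffM|exact: rpredZ].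
Qed.

Lemma centred_cutoff_dist k f M x : (forall x, `|f x| <= M) -> f \in Lfun N 1 ->
  `|f x - \int[N]_x f x - centred_cutoff k.+1 f x| <=
  2 * M / k.+1%:R ^+ 2 * x ^+ 2 + `|cutoff_mean k.+1 f - \int[N]_x f x|.
Proof.
move=> fM Lf; set m := \int[N]_x f x; set b := cutoff_mean _ _.
have mM : `|m| <= M.
  by rewrite -[leRHS](Ex_cst N); apply: normr_Ex_le => //; exact: Lfun_cst.
rewrite (_ : _ - _ - _ = (1 - cutoff k.+1 x) * (f x - m) + cutoff k.+1 x * (b - m)).
  apply: le_trans (ler_normD _ _) _; apply: lerD; rewrite normrM.
    rewrite ger0_norm ?subr_ge0 ?cutoff_le1//.
    rewrite -mulrA mulrC [_ * x ^+ 2]mulrC; apply: ler_pM => //.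
    - by rewrite subr_ge0 cutoff_le1.
    - by apply: le_trans (ler_normB _ _) _; have := fM x; lra.
    - exact: cutoff_tail_le.
  by rewrite ler_piMl// normr_cutoff_le1.
by rewrite /centred_cutoff -/b; ring.
Qed.

Lemma Lfun1_comp_bounded (d : measure_display) (Omega : measurableType d)
    (P : probability Omega R) (W : Omega -> R) f M : measurable_fun setT W ->
  continuous f -> (forall x, `|f x| <= M) -> (fun w => f (W w)) \in Lfun P 1.
Proof.
move=> mW cf fM; apply: (Lfun_bounded _ _ (fun w => fM (W w))) => //.
exact: measurableT_comp (continuous_measurable_fun cf) mW.
Qed.

Lemma Ex_centred_cutoff_dist (d : measure_display) (Omega : measurableType d)
    (P : probability Omega R) (W : Omega -> R) k f M (A : R) :
  W \in Lfun P 2%:E -> \int[P]_w W w ^+ 2 <= A ->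
  continuous f -> (forall x, `|f x| <= M) ->
  `|\int[P]_w f (W w) - \int[N]_x f x - \int[P]_w centred_cutoff k.+1 f (W w)| <=
  2 * M / k.+1%:R ^+ 2 * A + `|cutoff_mean k.+1 f - \int[N]_x f x|.
Proof.
move=> LW EW cf fM; have mW := Lfun_measurable LW.
have Lf : f \in Lfun N 1 := Lfun_bounded N (continuous_measurable_fun cf) fM (lexx 1).
have LfW := Lfun1_comp_bounded P mW cf fM.
have cc := continuous_centred_cutoff (k := k.+1) cf.
have [C _ /(Lfun1_comp_bounded P mW cc) LhW] :=
  compact_support_bounded cc (@centred_cutoff_supported k.+1 f).
have LW2 := Lfun_evenX LW isT isT.
set m := \int[N]_x f x; set b := `|_ - m|; set a := 2 * M / k.+1%:R ^+ 2.
have LfWm : (fun w => f (W w) - m) \in Lfun P 1.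
  by apply: rpredB => //; exact: Lfun_cst.
rewrite -[X in _ - X - _](Ex_cst P) -ExB//; last exact: Lfun_cst.
rewrite -ExB//; have LaW2 : (fun w => a * W w ^+ 2) \in Lfun P 1 by exact: rpredZ.
apply: (@le_trans _ _ (\int[P]_w (a * W w ^+ 2 + b))).
  apply: normr_Ex_le; first exact: rpredB.
    by apply: rpredD => //; exact: Lfun_cst.
  by move=> w; exact: centred_cutoff_dist.
rewrite (ExD LaW2 (Lfun_cst _ _ _)) (ExZ _ LW2) Ex_cst lerD2r ler_wpM2l//.
by rewrite divr_ge0 ?sqr_ge0// mulr_ge0// (le_trans _ (fM 0)).
Qed.

Lemma centred_cutoff_error_cvg f M (A : R) : f \in Lfun N 1 ->
  (fun k => 2 * M / k.+1%:R ^+ 2 * A + `|cutoff_mean k.+1 f - \int[N]_x f x|)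
    @ \oo --> (0 : R).
Proof.
move=> Lf; rewrite -[X in _ --> X](addr0 (0 : R)); apply: cvgD.
  rewrite -[X in _ --> X](mul0r A); apply: cvgM; last exact: cvg_cst.
  rewrite -[X in _ --> X](mulr0 (2 * M)); apply: cvgM; first exact: cvg_cst.
  rewrite (_ : (fun k => _) = fun k => k.+1%:R^-1 * k.+1%:R^-1).
    by rewrite -[X in _ --> X](mulr0 (0 : R)); apply: cvgM; exact: cvg_harmonic.
  by apply/funext => k; rewrite -exprVn expr2.
set m := \int[N]_x f x; have mean_cvg : (fun k => cutoff_mean k.+1 f) @ \oo --> m.
  by rewrite (cvg_shiftS (cutoff_mean ^~ f)); exact: cutoff_mean_cvg.
rewrite -[X in _ --> X](normr0 R) -(subrr m).
by apply: cvg_norm; apply: cvgB => //; exact: cvg_cst.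
Qed.

Lemma cvg_in_law_centred_tests (d : measure_display)
    (Omega : nat -> measurableType d) (P : forall n, probability (Omega n) R)
    (W : forall n, Omega n -> R) (A : R) :
  (\forall n \near \oo, W n \in Lfun (P n) 2%:E /\ \int[P n]_w (W n w) ^+ 2 <= A) ->
  (forall (h : R -> R) (M : R), continuous h -> supported_in M h ->
    \int[N]_x h x = 0 -> (fun n => \int[P n]_w h (W n w)) @ \oo --> (0 : R)) ->
  cvg_in_law P W N.
Proof.
move=> W2 test f cf [M fM]; apply/cvgrPdist_le => eps e0.
have e2 : 0 < eps / 2 by rewrite divr_gt0.
have Lf : f \in Lfun N 1 := Lfun_bounded N (continuous_measurable_fun cf) fM (lexx 1).
have /cvgrPdist_le/(_ _ e2) small_error := centred_cutoff_error_cvg M A Lf.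
have /cvgr_neq0 -/(_ (oner_neq0 _)) cutoff_nz :
    (fun k => \int[N]_x cutoff k.+1 x) @ \oo --> (1 : R).
  by rewrite (cvg_shiftS (fun k => \int[N]_x cutoff k x)); exact: Ex_cutoff_cvg1.
have [k [error_k nz_k]] := filter_ex (filterI small_error cutoff_nz).
have /cvgrPdist_le/(_ _ e2) small_test := test _ _
  (continuous_centred_cutoff (k := k.+1) cf) (@centred_cutoff_supported k.+1 f)
  (Ex_centred_cutoff Lf nz_k).
near=> n.
have [LW EW] : W n \in Lfun (P n) 2%:E /\ \int[P n]_w (W n w) ^+ 2 <= A by near: n.
have test_n : `|0 - \int[P n]_w centred_cutoff k.+1 f (W n w)| <= eps / 2 by near: n.
have dist_n := Ex_centred_cutoff_dist k LW EW cf fM.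
move: error_k test_n dist_n; rewrite !sub0r !normrN => /(le_trans (ler_norm _)).
set I := \int[P n]_w f _; set J := \int[P n]_w _; set m := \int[N]_x f x => ek tn dn.
rewrite distrC (_ : I - m = (I - m - J) + J); last by ring.
by apply: le_trans (ler_normD _ _) _; rewrite (splitr eps) lerD// (le_trans dn).
Unshelve. all: by end_near. Qed.

End convergence_in_law.

Lemma stein_cvg_in_law (R : realType) (d : measure_display)
    (Omega : nat -> measurableType d) (P : forall n, probability (Omega n) R)
    (W : forall n, Omega n -> R) (A : R) :
  (\forall n \near \oo, W n \in Lfun (P n) 2%:E /\ \int[P n]_w (W n w) ^+ 2 <= A) ->
  (forall g g' M, stein_test g g' M ->
    (fun n => \int[P n]_w (g' (W n w) - W n w * g (W n w))) @ \oo --> (0 : R)) ->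
  cvg_in_law P W (normal_prob 0 1).
Proof.
move=> W2 test; apply: (cvg_in_law_centred_tests W2) => h M h_cont h_supp Eh.
have [M' /test] := stein_solution_test h_cont h_supp Eh.
rewrite (_ : (fun n => _) = (fun n => \int[P n]_w h (W n w)))//.
by apply/funext => n; apply: eq_Rintegral => w _; rewrite addrK.
Qed.

Lemma normr_le_quadratic (R : realFieldType) (t delta : R) : 0 < delta ->
  `|t| <= delta + delta^-1 * t ^+ 2.
Proof.
move=> d0; rewrite -(ler_pM2l d0) mulrDr mulVKf ?gt_eqF//.
rewrite -(real_normK (num_real t)); have := sqr_ge0 (delta - `|t|).
by have := sqr_ge0 (delta + `|t|); nra.
Qed.

Section leave_one_out.
Context {R : realType} {d : measure_display} {T : measurableType d} {n : nat}.
Variables (nu : probability (n.-tuple T) R) (mu : 'I_n -> probability T R).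
Variables (h G : T -> T -> R) (c B Q : R) (g g' : R -> R) (M : R).
Hypothesis nu_mu : resample_invariant nu mu.
Hypothesis hG : degenerate_kernel mu h G c B Q.
Hypothesis n_gt0 : (0 < n)%N.
Hypothesis gg' : stein_test g g' M.
Implicit Types (i j : 'I_n) (x : n.-tuple T).
Local Notation W := (@ustat R d T n h).
Local Notation W_ := (@row_sum R d T n h).
Local Notation U := (@half_energy R d T n h).

Definition leave_out i x : R := W x - W_ i x.

Lemma leave_outE i x :
  leave_out i x = 2^-1 * \sum_(j | j != i) \sum_(l | l != i) offdiag h j l x.
Proof.
have WE : W x = 2^-1 * (W_ i x + (\sum_(j | j != i) offdiag h j i x +
    \sum_(j | j != i) \sum_(l | l != i) offdiag h j l x)).
  rewrite /ustat (bigD1 i)//= -big_split/=; congr (_ * (_ + _)).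
  by apply: eq_bigr => j _; rewrite /row_sum (bigD1 i).
have colE : \sum_(j | j != i) offdiag h j i x = W_ i x.
  by rewrite row_sumE; apply: eq_bigr => j _; rewrite (offdiagC hG).
by rewrite /leave_out WE colE; lra.
Qed.

Lemma constant_in_leave_out i : constant_in i (leave_out i).
Proof.
move=> x y; rewrite !leave_outE; congr (_ * _); apply: eq_bigr => j ji.
by apply: eq_bigr => l li; apply: constant_in_offdiag; rewrite eq_sym.
Qed.

Lemma stein_test_measurable : measurable_fun setT g /\ measurable_fun setT g'.
Proof.
split; apply: continuous_measurable_fun; last exact: stein_continuous gg'.
move=> x; apply: differentiable_continuous; apply/derivable1_diffP.
by case: (stein_is_derive gg' x).
Qed.

Let mW : measurable_fun setT W := Lfun_measurable (Lfun4_ustat nu_mu hG).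

Let mW_ i : measurable_fun setT (W_ i) := Lfun_measurable (Lfun4_row_sum nu_mu hG i).

Let mg'W : measurable_fun setT (g' \o W).
Proof. exact: measurableT_comp stein_test_measurable.2 mW. Qed.

Let mgW : measurable_fun setT (g \o W).
Proof. exact: measurableT_comp stein_test_measurable.1 mW. Qed.

Let mg_leave_out i : measurable_fun setT (g \o leave_out i).
Proof. exact: measurableT_comp stein_test_measurable.1 (measurable_funB mW (mW_ i)). Qed.

Let row_sum_leave_out_Lfun1 i : (fun x => W_ i x * g (leave_out i x)) \in Lfun nu 1.
Proof.
under eq_fun do rewrite mulrC.
apply: (Lfun1_bounded_mul (mg_leave_out i)) => [x|]; first exact: stein_bounded gg' _.
exact/Lfun21/Lfun42/(Lfun4_row_sum nu_mu hG).
Qed.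

Lemma Ex_row_sum_leave_out i : \int[nu]_x (W_ i x * g (leave_out i x)) = 0.
Proof.
apply: (Ex_centred nu_mu (i := i)); first exact: row_sum_leave_out_Lfun1.
apply: centred_inM; first exact: centred_in_row_sum hG i.
by move=> x y; rewrite constant_in_leave_out.
Qed.

Definition stein_remainder i x : R :=
  W_ i x * (W_ i x * g' (W x) - g (W x) + g (leave_out i x)).

Lemma stein_decomposition x : g' (W x) - W x * g (W x) =
  g' (W x) * (1 - U x) + 2^-1 * \sum_i stein_remainder i x -
  2^-1 * \sum_i W_ i x * g (leave_out i x).
Proof.
have remE : \sum_i stein_remainder i x - \sum_i W_ i x * g (leave_out i x) =
    g' (W x) * \sum_i W_ i x ^+ 2 - g (W x) * \sum_i W_ i x.
  rewrite !mulr_sumr -!sumrB; apply: eq_bigr => i _.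
  by rewrite /stein_remainder; ring.
have WE : \sum_i W_ i x = 2 * W x by rewrite /ustat; lra.
have UE : \sum_i W_ i x ^+ 2 = 2 * U x by rewrite /half_energy; lra.
by move: remE; rewrite WE UE; nra.
Qed.

Section remainder.
Variables (eps K : R).
Hypotheses (eps0 : 0 <= eps) (K0 : 0 <= K) (g'K : quadratic_modulus g' eps K).

Let row_sum_moments_Lfun1 i :
  (fun x => eps * W_ i x ^+ 2) \in Lfun nu 1 /\
  (fun x => K * W_ i x ^+ 4) \in Lfun nu 1.
Proof.
have L4 := Lfun4_row_sum nu_mu hG i.
by split; apply: rpredZ => //;
  [exact: Lfun_evenX (Lfun42 L4) _ _|exact: Lfun_evenX L4 _ _].
Qed.

Let normr_stein_remainder_le i x :
  `|stein_remainder i x| <= eps * W_ i x ^+ 2 + K * W_ i x ^+ 4.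
Proof.
have := quadratic_modulus_taylor (stein_is_derive gg') K0 g'K (W x) (W_ i x).
rewrite -/(leave_out i x) /stein_remainder.
set w := W_ i x; set g0 := g (W x); set g1 := g _; set g2 := g' _.
rewrite -normrN (_ : - (g0 - g1 - w * g2) = w * g2 - g0 + g1); last by ring.
move=> /(ler_wpM2l (normr_ge0 w)); rewrite -normrM => /le_trans; apply.
rewrite mulrA -expr2 real_normK ?num_real//.
by rewrite le_eqVlt; apply/orP; left; apply/eqP; ring.
Qed.

Lemma stein_remainder_Lfun1 i : stein_remainder i \in Lfun nu 1.
Proof.
have [L2 L4] := row_sum_moments_Lfun1 i.
apply: Lfun_dom (normr_stein_remainder_le i) => //; last exact: rpredD.
apply: measurable_funM => //; apply: measurable_funD; last exact: mg_leave_out.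
by apply: measurable_funB => //; exact: measurable_funM.
Qed.

Lemma normr_Ex_stein_remainder_le i : `|\int[nu]_x stein_remainder i x| <=
  eps * (n%:R * c) + K * (10 * n%:R ^+ 2 * B).
Proof.
have [L2 L4] := row_sum_moments_Lfun1 i; have L := Lfun4_row_sum nu_mu hG i.
apply: le_trans (normr_Ex_le (stein_remainder_Lfun1 i) _
  (normr_stein_remainder_le i)) _; first exact: rpredD.
rewrite ExD// !ExZ; [|exact: Lfun_evenX L _ _|exact: Lfun_evenX (Lfun42 L) _ _].
apply: lerD; rewrite ler_wpM2l//.
  exact: (Ex_row_sum2_le nu_mu hG n_gt0).
exact: (Ex_row_sum4_le nu_mu hG n_gt0).
Qed.

End remainder.

Let energy_defect_Lfun1 : (fun x => g' (W x) * (1 - U x)) \in Lfun nu 1.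
Proof.
apply: (Lfun1_bounded_mul mg'W) => [x|]; first exact: stein_derive_bounded gg' _.
by apply: rpredB => //; [exact: Lfun_cst|exact/Lfun21/(Lfun2_half_energy nu_mu hG)].
Qed.

Lemma normr_Ex_energy_defect_le (delta : R) : 0 < delta ->
  `|\int[nu]_x (g' (W x) * (1 - U x))| <=
  M * (`|2^-1 * n%:R * (n%:R - 1) * c - 1| + delta +
       44 * (n%:R ^+ 3 * B + n%:R ^+ 4 * Q) / delta).
Proof.
move=> d0; set u := 2^-1 * n%:R * (n%:R - 1) * c.
have LU2 : (fun x => (U x - u) ^+ 2) \in Lfun nu 1.
  have LU : (fun x => U x - u) \in Lfun nu 2%:E.
    by apply: rpredB => //; [exact: (Lfun2_half_energy nu_mu hG)|exact: Lfun_cst].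
  exact: Lfun_evenX LU _ _.
have LV : (fun x => delta^-1 * (U x - u) ^+ 2) \in Lfun nu 1 by exact: rpredZ.
have LD : (fun x => `|u - 1| + delta + delta^-1 * (U x - u) ^+ 2) \in Lfun nu 1.
  by apply: rpredD => //; exact: Lfun_cst.
apply: (@le_trans _ _ (\int[nu]_x (M * (`|u - 1| + delta + delta^-1 * (U x - u) ^+ 2)))).
  apply: normr_Ex_le => //; first exact: rpredZ.
  move=> x; rewrite normrM ler_pM ?(stein_derive_bounded gg')//.
  rewrite (_ : 1 - U x = - (u - 1) - (U x - u)); last by ring.
  apply: le_trans (ler_normB _ _) _; rewrite normrN -addrA lerD2l.
  exact: normr_le_quadratic.
have M0 : 0 <= M by exact: le_trans (stein_bounded gg' 0).
rewrite ExZ// ler_wpM2l// (ExD (Lfun_cst _ _ _) LV) Ex_cst lerD2l.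
rewrite ExZ// mulrC ler_wpM2r// ?invr_ge0 ?(ltW d0)//.
exact: (half_energy_variance_le nu_mu hG n_gt0).
Qed.

Lemma ustat_stein_bound (eps K delta : R) :
  0 <= eps -> 0 <= K -> quadratic_modulus g' eps K -> 0 < delta ->
  `|\int[nu]_x (g' (W x) - W x * g (W x))| <=
  2^-1 * (eps * (n%:R ^+ 2 * c) + K * (10 * n%:R ^+ 3 * B)) +
  M * (`|2^-1 * n%:R * (n%:R - 1) * c - 1| + delta +
       44 * (n%:R ^+ 3 * B + n%:R ^+ 4 * Q) / delta).
Proof.
move=> eps0 K0 g'K d0; under eq_Rintegral do rewrite stein_decomposition.
have LR i := stein_remainder_Lfun1 K0 g'K i.
have LsumR : (fun x => \sum_i stein_remainder i x) \in Lfun nu 1 by exact: Lfun_sum.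
have Lsum0 : (fun x => \sum_i W_ i x * g (leave_out i x)) \in Lfun nu 1.
  by apply: Lfun_sum => // i _; exact: row_sum_leave_out_Lfun1.
rewrite ExB; [|by apply: rpredD => //; exact: rpredZ|exact: rpredZ].
rewrite ExD//; last exact: rpredZ.
rewrite !ExZ// !Ex_sum//.
rewrite [X in _ - _ * X]big1 => [|i _]; last exact: Ex_row_sum_leave_out.
rewrite mulr0 subr0 addrC; apply: le_trans (ler_normD _ _) _.
apply: lerD; last exact: normr_Ex_energy_defect_le.
rewrite normrM ger0_norm// ler_wpM2l//; apply: le_trans (ler_norm_sum _ _ _) _.
apply: (@le_trans _ _ (\sum_(i < n) (eps * (n%:R * c) + K * (10 * n%:R ^+ 2 * B)))).
  by apply: ler_sum => i _; exact: normr_Ex_stein_remainder_le.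
rewrite sumr_const card_ord -[leLHS]mulr_natl.
by rewrite le_eqVlt; apply/orP; left; apply/eqP; ring.
Qed.

End leave_one_out.

Lemma cvg_natV (R : realType) : (fun n : nat => n%:R^-1) @ \oo --> (0 : R).
Proof.
apply/gtr0_cvgV0; last exact: cvgr_idn.
by near=> n; rewrite ltr0n; near: n; exact: nbhs_infty_gt.
Unshelve. all: by end_near. Qed.

Section degenerate_ustat_clt.
Context {R : realType} {d : measure_display}.
Variables (T : nat -> measurableType d).
Variables (nu : forall n, probability (n.-tuple (T n)) R).
Variables (mu : forall n, 'I_n -> probability (T n) R).
Variables (h G : forall n, T n -> T n -> R) (c B Q : nat -> R).
Hypothesis nu_mu : forall n, resample_invariant (nu n) (@mu n).
Hypothesis hG : \forall n \near \oo,
  degenerate_kernel (@mu n) (@h n) (@G n) (c n) (B n) (Q n).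
Hypothesis c_cvg : (fun n => n%:R ^+ 2 * c n) @ \oo --> (2 : R).
Hypothesis B_cvg : (fun n => n%:R ^+ 3 * B n) @ \oo --> (0 : R).
Hypothesis Q_cvg : (fun n => n%:R ^+ 4 * Q n) @ \oo --> (0 : R).
Local Notation W n := (@ustat R d (T n) n (@h n)).

Let mean_energy_cvg :
  (fun n => 2^-1 * n%:R * (n%:R - 1) * c n) @ \oo --> (1 : R).
Proof.
have : (fun n => 2^-1 * ((1 - n%:R^-1) * (n%:R ^+ 2 * c n))) @ \oo --> (1 : R).
  rewrite -[X in _ --> X](_ : 2^-1 * ((1 - 0) * 2) = 1 :> R); last by field.
  apply: cvgM; first exact: cvg_cst.
  by apply: cvgM => //; apply: cvgB; [exact: cvg_cst|exact: cvg_natV].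
apply: cvg_trans; apply: near_eq_cvg; near=> n.
have n0 : n%:R != 0 :> R.
  by rewrite pnatr_eq0 -lt0n; near: n; exact: nbhs_infty_gt.
by field.
Unshelve. all: by end_near. Qed.

Let ustat_stein_cvg g g' M : stein_test g g' M ->
  (fun n => \int[nu n]_x (g' (W n x) - W n x * g (W n x))) @ \oo --> (0 : R).
Proof.
move=> gg'; have M0 : 0 <= M by exact: le_trans (stein_bounded gg' 0).
have M1 : 0 < M + 1 by rewrite ltr_wpDl.
apply/cvgr0Pnorm_le => e e0.
have [K K0 g'K] := stein_modulus gg' (divr_gt0 e0 (ltr0n R 4)).
pose delta := e / 4 / (M + 1); have delta0 : 0 < delta by rewrite !divr_gt0.
pose bound n : R := 2^-1 * (e / 4 * (n%:R ^+ 2 * c n) + K * (10 * (n%:R ^+ 3 * B n))) +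
  M * (`|2^-1 * n%:R * (n%:R - 1) * c n - 1| + delta +
       44 * (n%:R ^+ 3 * B n + n%:R ^+ 4 * Q n) / delta).
have bound_cvg : bound @ \oo --> (2^-1 * (e / 4 * 2 + K * (10 * 0)) +
    M * (`|1 - 1| + delta + 44 * (0 + 0) / delta) : R).
  apply: cvgD; (apply: cvgM; first exact: cvg_cst); apply: cvgD.
  - by apply: cvgM => //; exact: cvg_cst.
  - by apply: cvgM; [exact: cvg_cst|apply: cvgM => //; exact: cvg_cst].
  - apply: cvgD; last exact: cvg_cst.
    by apply: cvg_norm; apply: cvgB => //; exact: cvg_cst.
  - apply: cvgM; last exact: cvg_cst.
    by apply: cvgM; [exact: cvg_cst|exact: cvgD].
have bound_lim : 2^-1 * (e / 4 * 2 + K * (10 * 0)) +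
    M * (`|1 - 1| + delta + 44 * (0 + 0) / delta) < e.
  have Md : M * delta <= e / 4.
    rewrite /delta mulrCA ler_piMr ?divr_ge0 ?(ltW e0)// ler_pdivrMr// mul1r.
    by rewrite lerDl.
  by rewrite subrr normr0 !addr0 !mulr0 mul0r !addr0 add0r; lra.
near=> n; apply: (@le_trans _ _ (bound n)).
  rewrite /bound !mulrA; have : (0 < n)%N by near: n; exact: nbhs_infty_gt.
  have hGn : degenerate_kernel (@mu n) (@h n) (@G n) (c n) (B n) (Q n) by near: n.
  move=> n0; have e4 : 0 <= e / 4 by rewrite divr_ge0// ltW.
  have := ustat_stein_bound (@nu_mu n) hGn n0 gg' e4 K0 g'K delta0.
  by rewrite !mulrA.
apply/ltW; near: n; exact: (cvgr_lt _ bound_cvg).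
Unshelve. all: by end_near. Qed.

Lemma degenerate_ustat_clt : cvg_in_law nu (fun n => W n) (normal_prob 0 1).
Proof.
apply: (@stein_cvg_in_law _ _ _ _ _ 3); last exact: ustat_stein_cvg.
near=> n; have n0 : (0 < n)%N by near: n; exact: nbhs_infty_gt.
have hGn : degenerate_kernel (@mu n) (@h n) (@G n) (c n) (B n) (Q n) by near: n.
split; first exact: (Lfun42 (Lfun4_ustat (@nu_mu n) hGn)).
apply: le_trans (Ex_ustat2_le (@nu_mu n) hGn n0) _; apply/ltW.
by near: n; apply: (cvgr_lt _ c_cvg); rewrite ltr_nat.
Unshelve. all: by end_near. Qed.

End degenerate_ustat_clt.

(** * Gegenbauer polynomials and the sphere *)

Section gegenbauer_polynomials.
Context {R : realType}.
Variable lam : R.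
Implicit Types (k n : nat) (x : R).
Local Notation l := (lam%:P).

Fixpoint gegenbauer_poly_pair k : {poly R} * {poly R} :=
  match k with
  | 0 => (1, 2 * l * 'X)
  | k'.+1 =>
      let p := gegenbauer_poly_pair k' in
      (p.2, (k'.+2%:R^-1)%:P *
        (2 * 'X * (k'.+1%:R + l) * p.2 - (k'%:R + 2 * l) * p.1))
  end.

Definition gegenbauer_poly := locked (fun k => (gegenbauer_poly_pair k).1).
Local Notation C := gegenbauer_poly.

Let horner_nat n x : (n%:R : {poly R}).[x] = n%:R.
Proof. by rewrite -polyC_natr hornerC. Qed.

Let deriv_lam : l^`() = 0 :> {poly R}.
Proof. exact: derivC. Qed.

Let deriv_nat n : (n%:R : {poly R})^`() = 0.
Proof. by rewrite -polyC_natr derivC. Qed.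

Lemma gegenbauer_poly0 : C 0 = 1. Proof. by rewrite /C -lock. Qed.

Lemma gegenbauer_poly1 : C 1 = 2 * l * 'X. Proof. by rewrite /C -lock. Qed.

Lemma gegenbauer_polyE k x : gegenbauer k lam x = (C k).[x].
Proof.
rewrite /C -lock /gegenbauer; suff -> : gegen_pair lam x k =
    ((gegenbauer_poly_pair k).1.[x], (gegenbauer_poly_pair k).2.[x]) by [].
elim: k => [|k IHk] /=.
  by rewrite !hornerM !horner_nat hornerC hornerX ?hornerC.
rewrite IHk /=; congr (_, _).
by rewrite !(hornerM, hornerD, hornerN, horner_nat, hornerC, hornerX) mulrC.
Qed.

Lemma gegenbauer_polySS k : (k%:R + 2) * C k.+2 =
  2 * (k%:R + 1 + l) * 'X * C k.+1 - (k%:R + 2 * l) * C k.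
Proof.
rewrite /C -lock/= mulrA.
have -> : (k%:R + 2) * (k.+2%:R^-1)%:P = 1 :> {poly R}.
  by rewrite -natrD addn2 -polyC_natr -polyCM mulfV// pnatr_eq0.
by rewrite -[k.+1]addn1 natrD; ring.
Qed.

Lemma deriv_gegenbauer_poly_ladder k :
  'X * (C k.+1)^`() - (C k)^`() = (k%:R + 1) * C k.+1 /\
  (C k.+1)^`() - 'X * (C k)^`() = (k%:R + 2 * l) * C k.
Proof.
elim: k => [|k [down up]].
  rewrite gegenbauer_poly0 gegenbauer_poly1 -polyC1 derivC !derivM derivX.
  by rewrite deriv_lam -[2]polyC_natr derivC; split; ring.
have upS : (C k.+2)^`() - 'X * (C k.+1)^`() = (k%:R + 1 + 2 * l) * C k.+1.
  have k2 : (k%:R + 2 : {poly R}) != 0.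
    by rewrite -natrD -polyC_natr polyC_eq0 pnatr_eq0 addn2.
  apply: (mulfI k2); have := congr1 (fun p => p^`()) (gegenbauer_polySS k) => /=.
  rewrite derivB !derivM !derivD !derivM derivX deriv_lam !deriv_nat (deriv_nat 1).
  move: down up; move: (C k) (C k.+1) (C k.+2) => a b c down up dS.
  have -> : (k%:R + 2) * (c^`() - 'X * b^`()) =
     ((0 + (0 + 0)) * c + (k%:R + 2) * c^`()) - (k%:R + 2) * ('X * b^`()) by ring.
  rewrite dS; have -> : a^`() = 'X * b^`() - (k%:R + 1) * b by rewrite -down; ring.
  by ring.
rewrite -[k.+1%:R]natr1; split => //.
have -> : (k%:R + 1 + 1) * C k.+2 = (k%:R + 2) * C k.+2 by ring.
rewrite gegenbauer_polySS.
have -> : (C k.+2)^`() = 'X * (C k.+1)^`() + (k%:R + 1 + 2 * l) * C k.+1.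
  by rewrite -upS; ring.
have -> : 'X * ('X * (C k.+1)^`() + (k%:R + 1 + 2 * l) * C k.+1) - (C k.+1)^`() =
   'X * ('X * (C k.+1)^`() - (C k)^`()) - ((C k.+1)^`() - 'X * (C k)^`()) +
   (k%:R + 1 + 2 * l) * 'X * C k.+1 by ring.
by rewrite down up; ring.
Qed.

Lemma deriv_gegenbauer_poly1 : (C 1)^`() = 2 * l * C 0.
Proof.
have [_] := deriv_gegenbauer_poly_ladder 0.
by rewrite gegenbauer_poly0 (deriv_nat 1) mulr0 subr0 add0r.
Qed.

Lemma deriv_gegenbauer_polySS k :
  (C k.+2)^`() = (C k)^`() + 2 * (k%:R + 1 + l) * C k.+1.
Proof.
have [down _] := deriv_gegenbauer_poly_ladder k.
have [_] := deriv_gegenbauer_poly_ladder k.+1; rewrite -[k.+1%:R]natr1 => up.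
have -> : (C k.+2)^`() = ((C k.+2)^`() - 'X * (C k.+1)^`()) +
  ('X * (C k.+1)^`() - (C k)^`()) + (C k)^`() by ring.
by rewrite down up; ring.
Qed.

Lemma gegenbauer_poly_ode k : (1 - 'X ^+ 2) * (C k)^`()^`() =
  (2 * l + 1) * 'X * (C k)^`() - k%:R * (k%:R + 2 * l) * C k.
Proof.
case: k => [|k]; first by rewrite gegenbauer_poly0 -polyC1 !derivC; ring.
have [] := deriv_gegenbauer_poly_ladder k; move: (C k) (C k.+1) => a b down up.
have ddown := congr1 (fun p => p^`()) down; have dup := congr1 (fun p => p^`()) up.
rewrite /= !derivB !derivM !derivD ?derivM derivX ?deriv_lam ?deriv_nat in ddown dup.
rewrite (deriv_nat 1) in ddown.
have -> : (1 - 'X ^+ 2) * b^`()^`() =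
  (b^`()^`() - (1 * a^`() + 'X * a^`()^`())) + (a^`() + 'X * a^`()^`()) -
  'X * ((1 * b^`() + 'X * b^`()^`()) - a^`()^`()) + 'X * b^`() - 'X * a^`()^`() by ring.
rewrite ddown dup -[k.+1%:R]natr1.
have -> : a^`() = 'X * b^`() - (k%:R + 1) * b by rewrite -down; ring.
by ring.
Qed.

Lemma gegenbauer_poly_at1 p k : 2 * lam = p.+1%:R -> (C k).[1] = 'C(k + p, k)%:R.
Proof.
move=> lamE; have recE n : (n%:R + 2) * (C n.+2).[1] =
    (2 * n%:R + 2 + p.+1%:R) * (C n.+1).[1] - (n%:R + p.+1%:R) * (C n).[1].
  have := congr1 (fun q => q.[1]) (gegenbauer_polySS n) => /=.
  rewrite !(hornerM, hornerD, hornerN, horner_nat, hornerC, hornerX, horner_nat 1).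
  by move=> ->; rewrite -lamE; ring.
have at0 : (C 0).[1] = 1 by rewrite gegenbauer_poly0 (horner_nat 1).
have stepE n : (n%:R + 1) * (C n.+1).[1] = (n%:R + p.+1%:R) * (C n).[1].
  elim: n => [|n IHn].
    rewrite at0 gegenbauer_poly1 !(hornerM, horner_nat, hornerC, hornerX).
    by rewrite !mulr1 lamE !add0r mul1r.
  have := recE n; rewrite -IHn -[n.+1%:R]natr1 => rec_n.
  transitivity ((n%:R + 2) * (C n.+2).[1]); first by ring.
  by rewrite rec_n; ring.
elim: k => [|k IHk]; first by rewrite at0 bin0.
have k0 : k%:R + 1 != 0 :> R by rewrite natr1 pnatr_eq0.
apply: (mulfI k0); rewrite stepE IHk natr1 -natrD -!natrM; congr (_%:R).
by rewrite addnS addSn -mul_bin_diag.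
Qed.

Lemma gegenbauer_index_gt0 m : (2 <= m)%N -> 2 * lam + 1 = m%:R -> 0 < lam.
Proof.
move=> m_ge2 lamE; have : (1 : R) < m%:R by rewrite ltr1n.
by rewrite -lamE; lra.
Qed.

Lemma dkd_gegenbauer m k : (2 <= m)%N -> 2 * lam + 1 = m%:R -> (0 < k)%N ->
  (1 + k%:R / lam) * (C k).[1] = (dkd k m)%:R.
Proof.
case: m => [|[|p]]// _ lamE; case: k => // j _.
have lam2E : 2 * lam = p.+1%:R by apply: (addIr 1); rewrite lamE natr1.
rewrite (gegenbauer_poly_at1 _ lam2E) /dkd.
have -> : (p.+2 + j.+1 - 2 = j.+1 + p)%N by lia.
have -> : (p.+2 + j.+1 - 1 = (j.+1 + p).+1)%N by lia.
have -> : (p.+2 - 1 = p.+1)%N by lia.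
rewrite binS -[in LHS](@bin_sub (j.+1 + p) j.+1) ?leq_addr// addKn.
move: ('C(j.+1 + p, p.+1)) ('C(j.+1 + p, p)) (mul_bin_left (j.+1 + p) p) => b e be.
rewrite !natrD; have p0 : p.+1%:R != 0 :> R by rewrite pnatr_eq0.
have -> : b%:R = j.+1%:R * e%:R / p.+1%:R :> R.
  rewrite -[in RHS]natrM (_ : (j.+1 * e = p.+1 * b)%N) ?natrM; last by rewrite be addnK.
  by rewrite [RHS]mulrC mulKf.
have -> : lam = p.+1%:R / 2 by rewrite -lam2E; field.
by move: (p.+1%:R) p0 => p1 p0; field.
Qed.

End gegenbauer_polynomials.

Lemma householder_orthogonal (R : realType) (m : nat) (w : 'rV[R]_m) (s : R) :
  s != 0 -> w *m w^T = s%:M -> orthogonal_mx (1%:M - (2 / s) *: (w^T *m w)).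
Proof.
move=> s0 wws; set A := w^T *m w.
have AT : A^T = A by rewrite trmx_mul trmxK.
have AA : A *m A = s *: A by rewrite mulmxA -(mulmxA w^T) wws mul_mx_scalar -scalemxAl.
have QT : (1%:M - (2 / s) *: A)^T = 1%:M - (2 / s) *: A.
  by rewrite linearB linearZ/= tr_scalar_mx AT.
rewrite /orthogonal_mx QT mulmxBl mul1mx mulmxBr mulmx1 -scalemxAl -scalemxAr AA.
by apply/matrixP => a b; rewrite !mxE; field.
Qed.

Section sphere.
Context {R : realType} {m : nat}.
Local Notation T := (m.+1.-tuple R).
Local Notation S := (@unit_sphere R m).
Implicit Types (x y z : T) (i j k : 'I_m.+1) (Q : 'M[R]_m.+1).

Lemma innerC x y : inner x y = inner y x.
Proof. by apply: eq_bigr => k _; rewrite mulrC. Qed.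

Lemma sum_delta k (F : 'I_m.+1 -> R) : \sum_i (i == k)%:R * F i = F k.
Proof.
rewrite (bigD1 k)//= eqxx mul1r big1 ?addr0// => i /negbTE ->.
by rewrite mul0r.
Qed.

Lemma measurable_inner d (V : measurableType d) (f g : V -> T) :
  measurable_fun setT f -> measurable_fun setT g ->
  measurable_fun setT (fun v => inner (f v) (g v)).
Proof.
move=> /measurable_fun_tnthP mf /measurable_fun_tnthP mg.
by apply: measurable_sum => k; apply: measurable_funM; [exact: mf|exact: mg].
Qed.

Lemma measurable_sphere : measurable S.
Proof.
have mi : measurable_fun setT (fun x : T => inner x x).
  by apply: measurable_inner; exact: measurable_id.
rewrite (_ : S = setT `&` (fun x => inner x x) @^-1` [set 1]); first exact: mi.
by rewrite setTI; apply/seteqP; split.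
Qed.

Lemma sphere_coord x k : S x -> `|tnth x k| <= 1.
Proof.
move=> Sx; rewrite -(@expr_le1 _ 2)// real_normK ?num_real// -[leRHS]Sx /inner.
by rewrite (bigD1 k)//= -expr2 lerDl sumr_ge0// => j _; rewrite -expr2 sqr_ge0.
Qed.

Definition pole : T := [tuple (k == ord0)%:R | k < m.+1].

Lemma pole_sphere : S pole.
Proof.
rewrite /unit_sphere/= /inner; under eq_bigr do rewrite tnth_mktuple.
by rewrite sum_delta eqxx.
Qed.

(* Kernels on the sphere are extended to all tuples by composition with
   [to_sphere]; a uniform law does not see the difference. *)
Definition to_sphere x : T := if x \in S then x else pole.

Lemma to_sphereP x : S (to_sphere x).
Proof. by rewrite /to_sphere; case: ifPn => [/set_mem//|_]; exact: pole_sphere. Qed.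

Lemma to_sphere_id x : S x -> to_sphere x = x.
Proof. by move=> /mem_set Sx; rewrite /to_sphere Sx. Qed.

Lemma measurable_to_sphere : measurable_fun setT to_sphere.
Proof.
apply: measurable_fun_if => //; apply: (measurable_fun_bool true); rewrite setTI.
rewrite (_ : _ @^-1` _ = S); first exact: measurable_sphere.
by apply/seteqP; split => x /=; [move/set_mem|move/mem_set].
Qed.

Lemma tnth_mat_act Q x k : tnth (mat_act Q x) k = \sum_j Q k j * tnth x j.
Proof. by rewrite tnth_mktuple. Qed.

Lemma measurable_mat_act Q : measurable_fun setT (mat_act Q).
Proof.
apply/measurable_fun_tnthP => k.
rewrite (_ : _ \o _ = fun x => \sum_j Q k j * tnth x j); last first.
  by apply/funext => x /=; rewrite tnth_mat_act.
by apply: measurable_sum => j; apply: measurable_funM => //; exact: measurable_tnth.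
Qed.

Lemma inner_mat_act Q x y : orthogonal_mx Q ->
  inner (mat_act Q x) (mat_act Q y) = inner x y.
Proof.
move=> oQ; transitivity (\sum_a \sum_b (Q^T *m Q) a b * (tnth x a * tnth y b)).
  transitivity (\sum_k \sum_a \sum_b (Q k a * Q k b) * (tnth x a * tnth y b)).
    apply: eq_bigr => k _; rewrite !tnth_mat_act mulr_suml; apply: eq_bigr => a _.
    by rewrite mulr_sumr; apply: eq_bigr => b _; ring.
  rewrite exchange_big/=; apply: eq_bigr => a _; rewrite exchange_big/=.
  apply: eq_bigr => b _; rewrite mxE mulr_suml; apply: eq_bigr => k _.
  by rewrite mxE.
rewrite oQ; apply: eq_bigr => a _; under eq_bigr do rewrite mxE eq_sym.
exact: (sum_delta a (fun b => tnth x a * tnth y b)).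
Qed.

Lemma mat_act_sphere Q x : orthogonal_mx Q -> S x -> S (mat_act Q x).
Proof. by move=> oQ Sx; rewrite /unit_sphere/= inner_mat_act. Qed.

Lemma sphere_transitive x y : S x -> S y ->
  exists2 Q, orthogonal_mx Q & mat_act Q x = y.
Proof.
move=> Sx Sy; have [->|xy] := eqVneq x y.
  exists 1%:M; first by rewrite /orthogonal_mx trmx1 mulmx1.
  apply: eq_from_tnth => k; rewrite tnth_mat_act.
  by under eq_bigr do rewrite mxE eq_sym; exact: sum_delta.
pose w : 'rV[R]_m.+1 := \row_k (tnth x k - tnth y k); pose s := \sum_k w 0 k ^+ 2.
have wx : \sum_j w 0 j * tnth x j = inner x x - inner x y.
  by rewrite /inner -sumrB; apply: eq_bigr => j _; rewrite mxE; ring.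
have sE : s = 2 * (inner x x - inner x y).
  transitivity (inner x x + inner y y - 2 * inner x y); last by rewrite Sx Sy; ring.
  rewrite /inner mulr_sumr -big_split -sumrB/=; apply: eq_bigr => k _.
  by rewrite mxE; ring.
have s0 : s != 0.
  apply: contraNneq xy => s0; apply/eqP/eq_from_tnth => k.
  have /eqP := s0; rewrite psumr_eq0 => [/allP/(_ k)|j _]; last exact: sqr_ge0.
  by rewrite mem_index_enum sqrf_eq0 mxE subr_eq0 => /(_ isT)/eqP.
exists (1%:M - (2 / s) *: (w^T *m w)).
  apply: householder_orthogonal s0 _; apply/matrixP => a b.
  rewrite !ord1 mxE [RHS]mxE eqxx mulr1n; apply: eq_bigr => k _.
  by rewrite [w^T k 0]mxE expr2.
apply: eq_from_tnth => k; rewrite tnth_mat_act.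
transitivity (\sum_j ((j == k)%:R * tnth x j - 2 / s * w 0 k * (w 0 j * tnth x j))).
  by apply: eq_bigr => j _; rewrite !mxE big_ord1 !mxE eq_sym; ring.
rewrite sumrB -mulr_sumr (sum_delta k (fun j => tnth x j)) wx mxE.
have -> : inner x x - inner x y = s / 2 by rewrite sE; field.
by field.
Qed.

End sphere.

Section uniform_measure.
Context {R : realType} {m : nat}.
Local Notation T := (m.+1.-tuple R).
Local Notation S := (@unit_sphere R m).
Implicit Types (x y z : T) (mu nu : probability T R) (Q : 'M[R]_m.+1).

Definition sphere_uniform mu := mu S = 1%E /\
  forall Q, orthogonal_mx Q ->
  forall A, measurable A -> mu A = mu (mat_act Q @^-1` A).

Section invariance.
Variable mu : probability T R.
Hypothesis mu_unif : sphere_uniform mu.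

Lemma integral_to_sphere (F : T -> \bar R) : measurable_fun setT F ->
  (\int[mu]_z F z = \int[mu]_z F (to_sphere z))%E.
Proof.
move=> mF; apply: ae_eq_integral => //.
  by apply: (measurableT_comp mF); exact: measurable_to_sphere.
exists (~` S); split.
- by apply: measurableC; exact: measurable_sphere.
- by rewrite [LHS](probability_setC mu measurable_sphere) mu_unif.1 subee.
- by move=> z /= FN Sz; apply: FN => _; rewrite to_sphere_id.
Qed.

Lemma ge0_integral_mat_act Q (F : T -> \bar R) : orthogonal_mx Q ->
  measurable_fun setT F -> (forall z, 0 <= F z)%E ->
  (\int[mu]_z F (mat_act Q z) = \int[mu]_z F z)%E.
Proof.
move=> oQ mF F0; have mQ := measurable_mat_act Q.
transitivity (\int[pushforward mu (mat_act Q)]_z F z)%E.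
  by rewrite ge0_integral_pushforward// preimage_setT.
by apply: eq_measure_integral => A mA _; rewrite [RHS](mu_unif.2 Q oQ A mA).
Qed.

Lemma integral_mat_act Q (F : T -> \bar R) : orthogonal_mx Q ->
  measurable_fun setT F ->
  (\int[mu]_z F (mat_act Q z) = \int[mu]_z F z)%E.
Proof.
move=> oQ mF; rewrite integralE [RHS]integralE; congr (_ - _)%E.
- have mFp : measurable_fun setT (F^\+)%E by exact: measurable_funepos.
  rewrite -(ge0_integral_mat_act oQ mFp)//.
  by apply: eq_integral => z _; rewrite funepos_comp.
- have mFn : measurable_fun setT (F^\-)%E by exact: measurable_funeneg.
  rewrite -(ge0_integral_mat_act oQ mFn)//.
  by apply: eq_integral => z _; rewrite funeneg_comp.
Qed.

Lemma integral_mat_act_to_sphere Q (F : T -> \bar R) : orthogonal_mx Q ->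
  measurable_fun setT F ->
  (\int[mu]_z F (mat_act Q (to_sphere z)) = \int[mu]_z F (to_sphere z))%E.
Proof.
move=> oQ mF; rewrite -integral_to_sphere// -(integral_mat_act oQ mF).
rewrite -(@integral_to_sphere (fun z => F (mat_act Q z)))//.
by apply: (measurableT_comp mF); exact: measurable_mat_act.
Qed.

Lemma integral_zonal (phi : R -> \bar R) x y : measurable_fun setT phi ->
  S x -> S y ->
  (\int[mu]_z phi (inner x (to_sphere z)) = \int[mu]_z phi (inner y (to_sphere z)))%E.
Proof.
move=> mphi Sx Sy; have [Q oQ Qx] := sphere_transitive Sx Sy.
rewrite -(@integral_mat_act_to_sphere Q (fun z => phi (inner y z)))//.
  by apply: eq_integral => z _; rewrite -Qx inner_mat_act.
apply: (measurableT_comp mphi); apply: measurable_inner; first exact: measurable_cst.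
exact: measurable_id.
Qed.

End invariance.

(* Both sides are the integral of [phi (inner z w)] against the product law. *)
Lemma eq_integral_zonal mu nu (phi : R -> \bar R) x y :
  sphere_uniform mu -> sphere_uniform nu -> measurable_fun setT phi ->
  (forall t, 0 <= phi t)%E -> S x -> S y ->
  (\int[mu]_z phi (inner x (to_sphere z)) = \int[nu]_z phi (inner y (to_sphere z)))%E.
Proof.
move=> mu_unif nu_unif mphi phi0 Sx Sy.
have averageE (la la' : probability T R) w : sphere_uniform la -> S w ->
    (\int[la]_z phi (inner w (to_sphere z)) =
     \int[la']_w \int[la]_z phi (inner (to_sphere w) (to_sphere z)))%E.
  move=> la_unif Sw.
  transitivity (\int[la']_w' cst (\int[la]_z phi (inner w (to_sphere z)))%E w')%E.
    by rewrite integral_cst// [X in (_ * X)%E](probability_setT la') mule1.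
  apply: eq_integral => w' _ /=.
  exact: (integral_zonal la_unif mphi Sw (to_sphereP w')).
rewrite (averageE mu nu)// (averageE nu mu)//.
pose F (p : T * T) := phi (inner (to_sphere p.1) (to_sphere p.2)).
have mF : measurable_fun setT F.
  apply: (measurableT_comp mphi); apply: measurable_inner;
    apply: (measurableT_comp measurable_to_sphere);
    [exact: measurable_fst|exact: measurable_snd].
have F0 p : (0 <= F p)%E by exact: phi0.
transitivity (\int[mu]_z \int[nu]_w F (w, z))%E.
  exact: (fubini_tonelli (m1 := nu) (m2 := mu) F mF F0).
by apply: eq_integral => z _; apply: eq_integral => w _; rewrite /F innerC.
Qed.

End uniform_measure.

(** * Integration by parts for zonal polynomials *)

Section planar_rotations.
Context {R : realType} {m : nat}.
Local Notation T := (m.+1.-tuple R).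
Local Notation S := (@unit_sphere R m).
Implicit Types (x y z : T) (k : 'I_m.+1) (u v : T -> R) (t : R).
Variables i j : 'I_m.+1.
Hypothesis ij : i != j.

Definition planar_rotation (c s : R) : 'M[R]_m.+1 :=
  1%:M + (c - 1) *: (delta_mx i i + delta_mx j j) +
  s *: (delta_mx j i - delta_mx i j).

Lemma planar_rotation_orthogonal (c s : R) : c ^+ 2 + s ^+ 2 = 1 ->
  orthogonal_mx (planar_rotation c s).
Proof.
move=> cs; have ji : j != i by rewrite eq_sym.
pose A : 'M[R]_m.+1 := delta_mx i i + delta_mx j j.
pose J : 'M[R]_m.+1 := delta_mx j i - delta_mx i j.
have AT : A^T = A by rewrite linearD/= !trmx_delta.
have JT : J^T = - J by rewrite linearB/= !trmx_delta opprB.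
have AA : A *m A = A.
  by rewrite mulmxDl !mulmxDr !mul_delta_mx !mul_delta_mx_0// addr0 add0r.
have AJ : A *m J = J.
  by rewrite mulmxDl !mulmxBr !mul_delta_mx !mul_delta_mx_0// sub0r subr0 addrC.
have JA : J *m A = J.
  by rewrite mulmxBl !mulmxDr !mul_delta_mx !mul_delta_mx_0// addr0 add0r.
have JJ : J *m J = - A.
  by rewrite mulmxBl !mulmxBr !mul_delta_mx !mul_delta_mx_0// sub0r subr0 opprD addrC.
rewrite /orthogonal_mx /planar_rotation -/A -/J; clearbody A J.
rewrite !linearD/= !linearZ/= trmx1 AT JT scalerN.
rewrite mulmx1 !mulmxDl !mul1mx !mulNmx -!scalemxAl AA AJ JA JJ.
apply/matrixP => a b; rewrite !mxE.
move: (A a b) (J a b) => p q.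
rewrite [RHS](_ : _ = (a == b)%:R + (c ^+ 2 + s ^+ 2 - 1) * p); first by ring.
by rewrite cs subrr mul0r addr0.
Qed.

Lemma tnth_planar_rotation (c s : R) z k :
  tnth (mat_act (planar_rotation c s) z) k = tnth z k +
  (c - 1) * ((k == i)%:R * tnth z i + (k == j)%:R * tnth z j) +
  s * ((k == j)%:R * tnth z i - (k == i)%:R * tnth z j).
Proof.
rewrite tnth_mat_act; transitivity (\sum_a ((a == k)%:R * tnth z a +
   (c - 1) * ((k == i)%:R * ((a == i)%:R * tnth z a) +
              (k == j)%:R * ((a == j)%:R * tnth z a)) +
   s * ((k == j)%:R * ((a == i)%:R * tnth z a) -
        (k == i)%:R * ((a == j)%:R * tnth z a)))).
  by apply: eq_bigr => a _; rewrite !mxE -!mulnb !natrM [k == a]eq_sym; ring.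
by rewrite !big_split/= -!mulr_sumr big_split/= sumrB -!mulr_sumr
  !(sum_delta _ (fun a => tnth z a)).
Qed.

(* The rational parametrisation of the circle keeps the rotated coordinates
   algebraic in t; it has speed 2 at t = 0. *)
Definition rotate t z : T :=
  mat_act (planar_rotation ((1 - t ^+ 2) / (1 + t ^+ 2)) (2 * t / (1 + t ^+ 2))) z.

Let circle_den t : 1 + t ^+ 2 != 0.
Proof. by rewrite gt_eqF// ltr_pwDl// sqr_ge0. Qed.

Lemma rotate_orthogonal t : orthogonal_mx
  (planar_rotation ((1 - t ^+ 2) / (1 + t ^+ 2)) (2 * t / (1 + t ^+ 2))).
Proof. by apply: planar_rotation_orthogonal; field; exact: circle_den. Qed.

Lemma rotate_sphere t z : S z -> S (rotate t z).
Proof. exact/mat_act_sphere/rotate_orthogonal. Qed.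

Lemma measurable_rotate t : measurable_fun setT (rotate t).
Proof. exact: measurable_mat_act. Qed.

Definition rotation_derivative u u' := [/\ measurable_fun setT u,
  measurable_fun setT u' & exists B : R, forall z, S z ->
  [/\ `|u z| <= B, `|u' z| <= B & forall t, `|t| <= 1 ->
      `|u (rotate t z) - u z - t * u' z| <= B * t ^+ 2]].

Lemma rotation_derivative_ext u u' v v' : rotation_derivative u u' ->
  u =1 v -> u' =1 v' -> rotation_derivative v v'.
Proof. by move=> du /funext <- /funext <-. Qed.

Lemma rotation_derivative_cst (a : R) : rotation_derivative (cst a) (cst 0).
Proof.
split=> //; exists `|a| => z _; split=> //; first by rewrite normr0.
by move=> t _; rewrite subrr mulr0 subr0 normr0 mulr_ge0// sqr_ge0.
Qed.

Lemma rotation_derivative_coord k : rotation_derivative (fun z => tnth z k)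
  (fun z => 2 * ((k == j)%:R * tnth z i - (k == i)%:R * tnth z j)).
Proof.
split; first exact: measurable_tnth.
  apply: measurable_funM => //; apply: measurable_funB;
    by apply: measurable_funM => //; exact: measurable_tnth.
exists 8 => z Sz; have z1 a : `|tnth z a| <= 1 := sphere_coord a Sz.
have bz1 (b : bool) a : `|b%:R * tnth z a| <= 1.
  by case: b; rewrite ?mul1r// mul0r normr0.
set p := (k == j)%:R * tnth z i; set q := (k == i)%:R * tnth z j.
have pq2 : `|p - q| <= 2.
  by apply: le_trans (ler_normB _ _) _; rewrite -[2]/(1 + 1) lerD ?bz1.
split; [by rewrite (le_trans (z1 k))// ler1n|by rewrite normrM ger0_norm//; lra|].
move=> t t1; rewrite /rotate tnth_planar_rotation -/p -/q.
set e := _ * tnth z i + _; have e2 : `|e| <= 2.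
  by apply: le_trans (ler_normD _ _) _; rewrite -[2]/(1 + 1) lerD ?bz1.
rewrite (_ : _ - _ - _ = - (2 * (t ^+ 2 / (1 + t ^+ 2)) * (e + t * (p - q))));
  last by field; exact: circle_den.
have t20 := sqr_ge0 t; have den_gt0 : 0 < 1 + t ^+ 2 by rewrite ltr_pwDl.
have quot_le : t ^+ 2 / (1 + t ^+ 2) <= t ^+ 2.
  by rewrite ler_pdivrMr// ler_peMr// lerDl.
have epq : `|e + t * (p - q)| <= 4.
  apply: le_trans (ler_normD _ _) _; have : `|t * (p - q)| <= 1 * 2.
    by rewrite normrM ler_pM.
  lra.
rewrite normrN normrM ger0_norm; last by rewrite mulr_ge0// divr_ge0// ltW.
rewrite (_ : 8 * t ^+ 2 = 2 * t ^+ 2 * 4); last by ring.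
by rewrite ler_pM ?ler_wpM2l// mulr_ge0// divr_ge0// ltW.
Qed.

Lemma rotation_derivativeD u u' v v' : rotation_derivative u u' ->
  rotation_derivative v v' ->
  rotation_derivative (fun z => u z + v z) (fun z => u' z + v' z).
Proof.
move=> [mu_ mu' [B uB]] [mv mv' [C vC]].
split; [exact: measurable_funD|exact: measurable_funD|].
exists (B + C) => z Sz; have [u1 u2 u3] := uB z Sz; have [v1 v2 v3] := vC z Sz.
split; try by apply: le_trans (ler_normD _ _) _; exact: lerD.
move=> t t1; rewrite (_ : _ - _ - _ = (u (rotate t z) - u z - t * u' z) +
   (v (rotate t z) - v z - t * v' z)); last by ring.
rewrite mulrDl; apply: le_trans (ler_normD _ _) _.
by apply: lerD; [exact: u3|exact: v3].
Qed.

Lemma rotation_derivativeM u u' v v' : rotation_derivative u u' ->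
  rotation_derivative v v' ->
  rotation_derivative (fun z => u z * v z) (fun z => u' z * v z + u z * v' z).
Proof.
move=> [mu_ mu' [B uB]] [mv mv' [C vC]].
split; [exact: measurable_funM|by apply: measurable_funD; exact: measurable_funM|].
have normrM_le (a b p q : R) : `|a| <= p -> `|b| <= q -> `|a * b| <= p * q.
  by move=> ap bq; rewrite normrM ler_pM.
exists (4 * (B * C)) => z Sz; have [u1 u2 u3] := uB z Sz; have [v1 v2 v3] := vC z Sz.
have BC0 : 0 <= B * C by exact: le_trans (normrM_le _ _ _ _ u1 v1).
split; first by apply: le_trans (normrM_le _ _ _ _ u1 v1) _; lra.
  apply: le_trans (ler_normD _ _) _; have := normrM_le _ _ _ _ u2 v1.
  by have := normrM_le _ _ _ _ u1 v2; lra.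
move=> t t1; have [ut1 _ _] := uB _ (rotate_sphere t Sz).
rewrite (_ : _ - _ - _ = u (rotate t z) * (v (rotate t z) - v z - t * v' z) +
  t * (v' z * (u (rotate t z) - u z - t * u' z)) + t ^+ 2 * (u' z * v' z) +
  v z * (u (rotate t z) - u z - t * u' z)); last by ring.
move: (u (rotate t z) - _ - _) (v (rotate t z) - _ - _) (u3 t t1) (v3 t t1) =>
  r s rB sC.
rewrite (_ : 4 * (B * C) * t ^+ 2 = B * (C * t ^+ 2) + 1 * (C * (B * t ^+ 2)) +
  t ^+ 2 * (B * C) + C * (B * t ^+ 2)); last by ring.
apply: le_trans (ler_normD _ _) _; apply: lerD; last exact: normrM_le.
apply: le_trans (ler_normD _ _) _; apply: lerD; last first.
  by apply: (normrM_le) (normrM_le _ _ _ _ u2 v2); rewrite ger0_norm ?sqr_ge0.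
apply: le_trans (ler_normD _ _) _; apply: lerD; first exact: normrM_le.
by apply: (normrM_le) => //; exact: normrM_le.
Qed.

Lemma rotation_derivative_sum I (s : seq I) (u u' : I -> T -> R) :
  (forall a, rotation_derivative (u a) (u' a)) ->
  rotation_derivative (fun z => \sum_(a <- s) u a z) (fun z => \sum_(a <- s) u' a z).
Proof.
move=> du; elim: s => [|a s IHs].
  by apply: (rotation_derivative_ext (rotation_derivative_cst 0)) => z; rewrite big_nil.
by apply: (rotation_derivative_ext (rotation_derivativeD (du a) IHs)) => z;
  rewrite big_cons.
Qed.

Lemma rotation_derivativeZ (a : R) u u' : rotation_derivative u u' ->
  rotation_derivative (fun z => a * u z) (fun z => a * u' z).
Proof.
move=> du; apply: (rotation_derivative_ext
  (rotation_derivativeM (rotation_derivative_cst a) du)) => // z.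
by rewrite mul0r add0r.
Qed.

Lemma rotation_derivative_inner x : rotation_derivative (inner x)
  (fun z => 2 * (tnth x j * tnth z i - tnth x i * tnth z j)).
Proof.
have dcoord k := rotation_derivativeZ (tnth x k) (rotation_derivative_coord k).
apply: (rotation_derivative_ext (rotation_derivative_sum (index_enum _) dcoord)) => // z.
rewrite -(sum_delta j (fun a => tnth x a * tnth z i)).
rewrite -(sum_delta i (fun a => tnth x a * tnth z j)) -sumrB mulr_sumr.
by apply: eq_bigr => a _; ring.
Qed.

Lemma rotation_derivative_minor y :
  rotation_derivative (fun z => tnth y j * tnth z i - tnth y i * tnth z j)
  (fun z => 2 * (- (tnth y j * tnth z j) - tnth y i * tnth z i)).
Proof.
apply: (rotation_derivative_ext (rotation_derivativeD
  (rotation_derivativeZ (tnth y j) (rotation_derivative_coord i))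
  (rotation_derivativeZ (- tnth y i) (rotation_derivative_coord j)))) => z.
  by ring.
by rewrite !eqxx [j == i]eq_sym (negbTE ij) /=; ring.
Qed.

Lemma rotation_derivative_horner x (p : {poly R}) :
  rotation_derivative (fun z => p.[inner x z])
  (fun z => p^`().[inner x z] * (2 * (tnth x j * tnth z i - tnth x i * tnth z j))).
Proof.
elim/poly_ind: p => [|p a IHp].
  apply: (rotation_derivative_ext (rotation_derivative_cst 0)) => z.
    by rewrite horner0.
  by rewrite deriv0 horner0 mul0r.
apply: (rotation_derivative_ext (rotation_derivativeD
  (rotation_derivativeM IHp (rotation_derivative_inner x))
  (rotation_derivative_cst a))) => z; first by rewrite hornerMXaddC.
by rewrite derivMXaddC hornerD hornerMX /=; ring.
Qed.

Variable mu : probability T R.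
Hypothesis mu_unif : sphere_uniform mu.

Lemma sphere_bounded_Lfun (r : R) u (B : R) : measurable_fun setT u ->
  (forall z, S z -> `|u z| <= B) -> 1 <= r -> (fun z => u (to_sphere z)) \in Lfun mu r%:E.
Proof.
move=> mu_ uB; apply: Lfun_bounded => [|z]; last exact/uB/to_sphereP.
by apply: (measurableT_comp mu_); exact: measurable_to_sphere.
Qed.

Lemma rotation_derivative_Lfun u u' : rotation_derivative u u' ->
  (fun z => u (to_sphere z)) \in Lfun mu 1 /\
  (fun z => u' (to_sphere z)) \in Lfun mu 1.
Proof.
move=> [mu_ mu' [B uB]].
by split; apply: (@sphere_bounded_Lfun 1 _ B) => // z /uB[].
Qed.

(* The mean of [u] is invariant under rotations; differentiate at t = 0. *)
Lemma Ex_rotation_derivative u u' : rotation_derivative u u' ->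
  \int[mu]_z u' (to_sphere z) = 0.
Proof.
move=> du; have [L L'] := rotation_derivative_Lfun du; case: du => mu_ mu' [B uB].
have [uB0 _ _] := uB _ pole_sphere; have B0 : 0 <= B by exact: le_trans uB0.
have small t : 0 < t -> t <= 1 -> `|\int[mu]_z u' (to_sphere z)| <= B * t.
  move=> t0 t1; have t1' : `|t| <= 1 by rewrite gtr0_norm.
  have Lrot : (fun z => u (rotate t (to_sphere z))) \in Lfun mu 1.
    apply: (@sphere_bounded_Lfun 1 (u \o rotate t) B) => //.
      by apply: (measurableT_comp mu_); exact: measurable_rotate.
    by move=> z Sz; have [] := uB _ (rotate_sphere t Sz).
  have Erot : \int[mu]_z u (rotate t (to_sphere z)) = \int[mu]_z u (to_sphere z).
    apply: (congr1 fine).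
    apply: (integral_mat_act_to_sphere mu_unif (rotate_orthogonal t) (F := EFin \o u)).
    exact/measurable_EFinP.
  have : `|\int[mu]_z (u (rotate t (to_sphere z)) - u (to_sphere z) -
      t * u' (to_sphere z))| <= \int[mu]_z (B * t ^+ 2).
    apply: normr_Ex_le; [|exact: Lfun_cst|].
      by apply: rpredB => //; [exact: rpredB|exact: rpredZ].
    by move=> z; have [_ _] := uB _ (to_sphereP z); exact.
  rewrite Ex_cst ExB; [|exact: rpredB|exact: rpredZ].
  rewrite ExB// Erot subrr sub0r normrN ExZ// normrM gtr0_norm//.
  by rewrite expr2 mulrCA ler_pM2l.
apply/eqP; rewrite -normr_le0; apply/ler_addgt0Pr => e e0; rewrite add0r.
have B1 : 0 < B + 1 by rewrite ltr_wpDl.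
pose t := Num.min 1 (e / (B + 1)).
have t0 : 0 < t by rewrite lt_min ltr01 divr_gt0.
have te : t <= e / (B + 1) by rewrite ge_min lexx orbT.
apply: le_trans (small t t0 _) _; first by rewrite ge_min lexx.
apply: le_trans (ler_wpM2l B0 te) _.
by rewrite mulrCA ler_piMr ?(ltW e0)// ler_pdivrMr// mul1r lerDl.
Qed.

End planar_rotations.

Section zonal_pairing.
Context {R : realType} {m : nat}.
Local Notation T := (m.+1.-tuple R).
Local Notation S := (@unit_sphere R m).
Implicit Types (x y z : T) (i j : 'I_m.+1) (p q f g : {poly R}).

Lemma binet_cauchy x y z w :
  \sum_i \sum_j tnth x i * tnth y j * (tnth z j * tnth w i - tnth z i * tnth w j) =
  inner x w * inner y z - inner x z * inner y w.
Proof.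
rewrite /inner !big_distrlr/= -sumrB; apply: eq_bigr => i _; rewrite -sumrB.
by apply: eq_bigr => j _; ring.
Qed.

Lemma sum_skewM x y z :
  \sum_i \sum_j (tnth x j * tnth z i - tnth x i * tnth z j) *
    (tnth y j * tnth z i - tnth y i * tnth z j) =
  2 * (inner z z * inner x y - inner x z * inner y z).
Proof.
pose w i j := tnth y j * tnth z i - tnth y i * tnth z j.
transitivity (\sum_i \sum_j tnth z i * tnth x j * w i j -
    \sum_i \sum_j tnth x i * tnth z j * w i j).
  rewrite -sumrB; apply: eq_bigr => i _; rewrite -sumrB.
  by apply: eq_bigr => j _; rewrite /w; ring.
by rewrite !binet_cauchy [inner z y]innerC; ring.
Qed.

Lemma sum_offdiag_inner y z : \sum_i \sum_j (i != j)%:R *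
  (2 * (- (tnth y j * tnth z j) - tnth y i * tnth z i)) = - (4 * m%:R * inner y z).
Proof.
have sum_neq (b : 'I_m.+1 -> R) : \sum_i \sum_j (i != j)%:R * b j = m%:R * \sum_j b j.
  rewrite exchange_big/= mulr_sumr; apply: eq_bigr => j _; rewrite -mulr_suml.
  by rewrite -natr_sum -big_mkcond/= sum1_card cardC1 card_ord.
have sum_neqC (b : 'I_m.+1 -> R) : \sum_i \sum_j (i != j)%:R * b i = m%:R * \sum_j b j.
  rewrite exchange_big -sum_neq; apply: eq_bigr => j _; apply: eq_bigr => i _.
  by rewrite eq_sym.
transitivity (- 2 * (\sum_i \sum_j (i != j)%:R * (tnth y j * tnth z j) +
    \sum_i \sum_j (i != j)%:R * (tnth y i * tnth z i))).
  rewrite -big_split mulr_sumr; apply: eq_bigr => i _.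
  by rewrite -big_split mulr_sumr; apply: eq_bigr => j _ /=; ring.
by rewrite sum_neq sum_neqC -/(inner y z); ring.
Qed.

Variable mu : probability T R.
Hypothesis mu_unif : sphere_uniform mu.

Definition zpair x y p q : R :=
  \int[mu]_z (p.[inner x (to_sphere z)] * q.[inner y (to_sphere z)]).

Lemma zonal_bounded x p :
  exists B : R, forall z, `|p.[inner x (to_sphere z)]| <= B.
Proof.
elim/poly_ind: p => [|p a [B pB]]; first by exists 0 => z; rewrite horner0 normr0.
exists (B * (\sum_k `|tnth x k|) + `|a|) => z; rewrite hornerMXaddC.
apply: le_trans (ler_normD _ _) _; rewrite lerD2r normrM ler_pM//.
apply: le_trans (ler_norm_sum _ _ _) _; apply: ler_sum => k _.
by rewrite normrM ler_piMr// sphere_coord//; exact: to_sphereP.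
Qed.

Lemma measurable_zonal x (f : R -> R) : measurable_fun setT f ->
  measurable_fun setT (fun z : T => f (inner x (to_sphere z))).
Proof.
move=> mf; apply: (measurableT_comp mf); apply: measurable_inner.
  exact: measurable_cst.
exact: measurable_to_sphere.
Qed.

Lemma zonal_Lfun x p (r : R) : 1 <= r ->
  (fun z => p.[inner x (to_sphere z)]) \in Lfun mu r%:E.
Proof.
have [B pB] := zonal_bounded x p; apply: (Lfun_bounded _ _ pB).
by apply: (measurable_zonal x); apply: continuous_measurable_fun;
  exact: continuous_horner.
Qed.

Lemma zonalM_Lfun1 x y p q :
  (fun z => p.[inner x (to_sphere z)] * q.[inner y (to_sphere z)]) \in Lfun mu 1.
Proof. by apply: (LfunM (k := 0)); apply: zonal_Lfun; rewrite ler1n. Qed.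

Lemma zpairC x y p q : zpair x y p q = zpair y x q p.
Proof. by apply: eq_Rintegral => z _; rewrite mulrC. Qed.

Lemma zpairDl x y p p' q : zpair x y (p + p') q = zpair x y p q + zpair x y p' q.
Proof.
rewrite /zpair -ExD; [|exact: zonalM_Lfun1|exact: zonalM_Lfun1].
by apply: eq_Rintegral => z _; rewrite hornerD mulrDl.
Qed.

Lemma zpairZl x y (a : R) p q : zpair x y (a%:P * p) q = a * zpair x y p q.
Proof.
rewrite /zpair -ExZ; last exact: zonalM_Lfun1.
by apply: eq_Rintegral => z _; rewrite hornerM hornerC mulrA.
Qed.

Lemma zpairDr x y p q q' : zpair x y p (q + q') = zpair x y p q + zpair x y p q'.
Proof. by rewrite zpairC zpairDl ![zpair y x _ _]zpairC. Qed.

Lemma zpairZr x y (a : R) p q : zpair x y p (a%:P * q) = a * zpair x y p q.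
Proof. by rewrite zpairC zpairZl [zpair y x _ _]zpairC. Qed.

Lemma zpair0l x y q : zpair x y 0 q = 0.
Proof. by rewrite -(mul0r (0 : {poly R})) -polyC0 zpairZl mul0r. Qed.

Lemma zpair0r x y p : zpair x y p 0 = 0.
Proof. by rewrite zpairC zpair0l. Qed.

Lemma zpair11 x y : zpair x y 1 1 = 1.
Proof.
rewrite -[RHS](Ex_cst mu); apply: eq_Rintegral => z _.
by rewrite -polyC1 !hornerC mulr1.
Qed.

Lemma Ex_sum_rotation_derivatives (a : 'I_m.+1 -> 'I_m.+1 -> R)
    (D : 'I_m.+1 -> 'I_m.+1 -> T -> R) :
  (forall i j, i != j -> exists u, rotation_derivative i j u (D i j)) ->
  (forall i z, D i i z = 0) ->
  \int[mu]_z (\sum_i \sum_j a i j * D i j (to_sphere z)) = 0.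
Proof.
move=> dD D0; have LE i j : (fun z => D i j (to_sphere z)) \in Lfun mu 1 /\
    \int[mu]_z D i j (to_sphere z) = 0.
  have [->|ij] := eqVneq i j.
    rewrite (_ : (fun z => _) = cst 0); last by apply/funext => z; exact: D0.
    by rewrite Ex_cst; split=> //; exact: Lfun_cst.
  have [u du] := dD i j ij; split; last exact: (Ex_rotation_derivative ij mu_unif du).
  by have [] := rotation_derivative_Lfun mu du.
have L i j : (fun z => a i j * D i j (to_sphere z)) \in Lfun mu 1.
  by apply: rpredZ => //; case: (LE i j).
rewrite Ex_sum => [|i _]; last by apply: Lfun_sum.
rewrite big1// => i _; rewrite Ex_sum// big1// => j _.
by have [LD ED] := LE i j; rewrite ExZ// ED mulr0.
Qed.

Lemma zpair_first_order x y f g : S x -> S y ->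
  inner x y * zpair x y (f^`() * 'X) g - zpair x y f^`() (g * 'X) +
  zpair x y (f * 'X) g^`() - inner x y * zpair x y f (g^`() * 'X) = 0.
Proof.
move=> Sx Sy; set rho := inner x y.
pose D i j z :=
  f^`().[inner x z] * (2 * (tnth x j * tnth z i - tnth x i * tnth z j)) * g.[inner y z] +
  f.[inner x z] * (g^`().[inner y z] * (2 * (tnth y j * tnth z i - tnth y i * tnth z j))).
have sumD z : \sum_i \sum_j tnth x i * tnth y j * D i j z =
    2 * (f^`().[inner x z] * g.[inner y z]) * (rho * inner x z - inner y z) +
    2 * (f.[inner x z] * g^`().[inner y z]) * (inner x z - rho * inner y z).
  have := binet_cauchy x y x z; have := binet_cauchy x y y z.
  rewrite [inner x x]Sx [inner y y]Sy [inner y x]innerC -/rho mulr1 mul1r mulrC => <-.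
  rewrite [inner x z * _]mulrC => <-; rewrite !mulr_sumr -big_split.
  apply: eq_bigr => i _; rewrite !mulr_sumr -big_split; apply: eq_bigr => j _.
  by rewrite /D/=; ring.
have L p q := zonalM_Lfun1 x y p q.
have intD : \int[mu]_z (\sum_i \sum_j tnth x i * tnth y j * D i j (to_sphere z)) = 0.
  apply: (Ex_sum_rotation_derivatives (fun i j => tnth x i * tnth y j)) => [i j ij|i z];
    last by rewrite /D; ring.
  exists (fun z => f.[inner x z] * g.[inner y z]).
  exact: (rotation_derivativeM ij (rotation_derivative_horner ij x f)
    (rotation_derivative_horner ij y g)).
have two_neq0 : 2 != 0 :> R by rewrite pnatr_eq0.
apply: (mulfI two_neq0); rewrite mulr0 -[RHS]intD /zpair.
rewrite -!(ExZ rho (L _ _)) -ExB// -?ExD// -?ExB// -?ExZ//;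
  do ?[by do ?[exact: L|apply: rpredZ|apply: rpredB|apply: rpredD]].
apply: eq_Rintegral => z _; rewrite sumD !hornerMX; ring.
Qed.

Lemma zpair_second_order x y f g : S x -> S y ->
  inner x y * zpair x y f^`() g^`() - zpair x y (f^`() * 'X) (g^`() * 'X) +
  zpair x y f ((1 - 'X ^+ 2) * g^`()^`() - m%:R%:P * ('X * g^`())) = 0.
Proof.
move=> Sx Sy; set rho := inner x y.
pose w i j z := tnth y j * tnth z i - tnth y i * tnth z j.
pose w' i j z : R := (i != j)%:R * (2 * (- (tnth y j * tnth z j) - tnth y i * tnth z i)).
pose D i j z :=
  f^`().[inner x z] * (2 * (tnth x j * tnth z i - tnth x i * tnth z j)) *
    (g^`().[inner y z] * w i j z) +
  f.[inner x z] * (g^`()^`().[inner y z] * (2 * w i j z) * w i j z +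
    g^`().[inner y z] * w' i j z).
have dw i j : i != j -> rotation_derivative i j (w i j) (w' i j).
  move=> ij; apply: (rotation_derivative_ext (rotation_derivative_minor ij y)) => // z.
  by rewrite /w' ij mul1r.
have sumD z : S z -> \sum_i \sum_j D i j z =
    4 * (f^`().[inner x z] * g^`().[inner y z] * (rho - inner x z * inner y z) +
    f.[inner x z] * (g^`()^`().[inner y z] * (1 - inner y z ^+ 2) -
       m%:R * (inner y z * g^`().[inner y z]))).
  move=> Sz; transitivity (2 * (f^`().[inner x z] * g^`().[inner y z]) *
        \sum_i \sum_j (tnth x j * tnth z i - tnth x i * tnth z j) * w i j z +
      2 * (f.[inner x z] * g^`()^`().[inner y z]) *
        \sum_i \sum_j (tnth y j * tnth z i - tnth y i * tnth z j) * w i j z +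
      f.[inner x z] * g^`().[inner y z] * \sum_i \sum_j w' i j z).
    rewrite !mulr_sumr -!big_split/=; apply: eq_bigr => i _.
    by rewrite !mulr_sumr -!big_split/=; apply: eq_bigr => j _; rewrite /D /w; ring.
  by rewrite !sum_skewM sum_offdiag_inner [inner y y]Sy [inner z z]Sz -/rho; ring.
have intD : \int[mu]_z (\sum_i \sum_j 1 * D i j (to_sphere z)) = 0.
  apply: (Ex_sum_rotation_derivatives (fun=> fun=> 1)) => [i j ij|i z]; last first.
    by rewrite /D /w /w' eqxx /=; ring.
  exists (fun z => f.[inner x z] * (g^`().[inner y z] * w i j z)).
  exact: (rotation_derivativeM ij (rotation_derivative_horner ij x f)
    (rotation_derivativeM ij (rotation_derivative_horner ij y g^`()) (dw i j ij))).
have L p q := zonalM_Lfun1 x y p q.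
have four_neq0 : 4 != 0 :> R by rewrite pnatr_eq0.
apply: (mulfI four_neq0); rewrite mulr0 -[RHS]intD /zpair.
rewrite -!(ExZ rho (L _ _)) -ExB// -?ExD// -?ExZ//;
  do ?[by do ?[exact: L|apply: rpredZ|apply: rpredB|apply: rpredD]].
apply: eq_Rintegral => z _.
under [RHS]eq_bigr do under eq_bigr do rewrite mul1r.
rewrite (sumD _ (to_sphereP z)) !hornerMX hornerD hornerN !hornerM.
by rewrite hornerD hornerN hornerXn hornerX !hornerC; ring.
Qed.

End zonal_pairing.

Section gegenbauer_convolution.
Context {R : realType} {m : nat}.
Local Notation T := (m.+1.-tuple R).
Local Notation S := (@unit_sphere R m).
Implicit Types (x y : T) (k n : nat).
Variable mu : probability T R.
Hypothesis mu_unif : sphere_uniform mu.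
Hypothesis m_ge2 : (2 <= m)%N.
Variable lam : R.
Hypothesis lamE : 2 * lam + 1 = m%:R.
Local Notation C := (gegenbauer_poly lam).
Local Notation zpair := (zpair mu).

Let lam_gt0 : 0 < lam := gegenbauer_index_gt0 m_ge2 lamE.

Let deriv_C0 : (C 0)^`() = 0.
Proof. by rewrite gegenbauer_poly0 -polyC1 derivC. Qed.

Let deriv_C1 : (C 1)^`() = (2 * lam)%:P * C 0.
Proof. by rewrite deriv_gegenbauer_poly1 polyCM polyC_natr. Qed.

Let deriv_CSS k : (C k.+2)^`() = (C k)^`() + (2 * (k%:R + 1 + lam))%:P * C k.+1.
Proof. by rewrite deriv_gegenbauer_polySS polyCM !polyCD !polyC_natr polyC1. Qed.

Let deriv_CSMX k : (C k.+1)^`() * 'X = (C k)^`() + (k%:R + 1)%:P * C k.+1.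
Proof.
have [down _] := deriv_gegenbauer_poly_ladder lam k.
by rewrite polyCD polyC_natr polyC1 -down; ring.
Qed.

Let C0MX : (2 * lam)%:P * (C 0 * 'X) = C 1.
Proof. by rewrite gegenbauer_poly0 gegenbauer_poly1 polyCM polyC_natr; ring. Qed.

Let CSMX k : (2 * (k%:R + 1 + lam))%:P * (C k.+1 * 'X) =
  (k%:R + 2)%:P * C k.+2 + (k%:R + 2 * lam)%:P * C k.
Proof.
rewrite !(polyCM, polyCD, polyC_natr, polyC1) gegenbauer_polySS; ring.
Qed.

Lemma zpair_gegenbauer_orth x y k n : S x -> S y -> k != n -> zpair x y (C k) (C n) = 0.
Proof.
move=> Sx Sy kn; pose eig a : R := a%:R * (a%:R + 2 * lam).
have odeE a : (1 - 'X ^+ 2) * (C a)^`()^`() - m%:R%:P * ('X * (C a)^`()) =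
    (- eig a)%:P * C a.
  rewrite gegenbauer_poly_ode -lamE /eig.
  by rewrite !polyCD polyCN !polyCM !polyCD !polyCM !polyC_natr polyC1; ring.
have kn_id := zpair_second_order mu_unif (C k) (C n) Sx Sy.
have nk_id := zpair_second_order mu_unif (C n) (C k) Sy Sx.
rewrite odeE zpairZr in kn_id.
rewrite odeE zpairZr innerC ![zpair y x _ _]zpairC in nk_id.
have : (eig k - eig n) * zpair x y (C k) (C n) = 0 by lra.
move=> /eqP; rewrite mulf_eq0 => /orP[|/eqP//].
rewrite (_ : _ - _ = (k%:R - n%:R) * (k%:R + n%:R + 2 * lam)); last by rewrite /eig; ring.
rewrite mulf_eq0 subr_eq0 eqr_nat (negbTE kn)/= gt_eqF//.
by rewrite ltr_wpDl ?addr_ge0// mulr_gt0.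
Qed.

Lemma zpair_deriv_gegenbauer_ge x y k n : S x -> S y -> (k <= n)%N ->
  zpair x y (C k)^`() (C n) = 0.
Proof.
move=> Sx Sy; elim/ltn_ind: k => -[|[|k]] IHk kn.
- by rewrite deriv_C0 zpair0l.
- by rewrite deriv_C1 zpairZl zpair_gegenbauer_orth ?mulr0// neq_ltn kn.
- rewrite deriv_CSS zpairDl zpairZl zpair_gegenbauer_orth//; last by rewrite neq_ltn kn.
  by rewrite mulr0 addr0 IHk// ltnW// ltnW.
Qed.

Lemma zpair_deriv_gegenbauerS x y k : S x -> S y ->
  zpair x y (C k.+1)^`() (C k) = 2 * (k%:R + lam) * zpair x y (C k) (C k).
Proof.
move=> Sx Sy; case: k => [|k]; first by rewrite deriv_C1 zpairZl add0r.
rewrite deriv_CSS zpairDl zpairZl zpair_deriv_gegenbauer_ge//.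
by rewrite add0r -[k.+1%:R]natr1.
Qed.

Lemma zpair_deriv_gegenbauerSS_mulX x y k : S x -> S y ->
  zpair x y (C k.+2)^`() (C k * 'X) =
  inner x y * (2 * (k%:R + lam) * zpair x y (C k) (C k)).
Proof.
move=> Sx Sy.
have SMX_deriv : zpair x y (C k.+2 * 'X) (C k)^`() = 0.
  have a0 : 2 * (k.+1%:R + 1 + lam) != 0.
    by rewrite gt_eqF// mulr_gt0// ltr_wpDl// addr_ge0.
  apply: (mulfI a0); rewrite mulr0 -zpairZl CSMX zpairDl !zpairZl.
  rewrite ![zpair x y _ (C k)^`()]zpairC !zpair_deriv_gegenbauer_ge ?mulr0 ?addr0//.
  by rewrite ltnW// ltnW.
have S_derivMX : zpair x y (C k.+2) ((C k)^`() * 'X) = 0.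
  case: k {SMX_deriv} => [|k]; first by rewrite deriv_C0 mul0r zpair0r.
  rewrite deriv_CSMX zpairDr zpairZr zpair_gegenbauer_orth//; last by lia.
  by rewrite zpairC zpair_deriv_gegenbauer_ge ?mulr0 ?addr0//; lia.
have := zpair_first_order mu_unif (C k.+2) (C k) Sx Sy.
rewrite SMX_deriv S_derivMX deriv_CSMX zpairDl zpairZl zpair_deriv_gegenbauerS//.
by rewrite (@zpair_gegenbauer_orth x y k.+2 k)//; [lra|lia].
Qed.

Lemma zpair_gegenbauer_conv x y k : S x -> S y ->
  (k%:R + lam) * zpair x y (C k) (C k) = lam * (C k).[inner x y].
Proof.
move=> Sx Sy; set rho := inner x y.
have pair00 : zpair x y (C 0) (C 0) = 1 by rewrite gegenbauer_poly0 zpair11.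
have eval0 : (C 0).[rho] = 1 by rewrite gegenbauer_poly0 -polyC1 hornerC.
elim/ltn_ind: k => -[|[|k]] IHk.
- by rewrite pair00 eval0 add0r.
- have := zpair_deriv_gegenbauerSS_mulX 0 Sx Sy.
  have := congr1 (zpair x y (C 2)^`()) C0MX; rewrite zpairZr zpair_deriv_gegenbauerS//.
  rewrite pair00 add0r -/rho => pairE pair0E.
  have -> : (C 1).[rho] = 2 * lam * rho.
    by rewrite -C0MX hornerM hornerC hornerMX eval0 mul1r.
  by rewrite pair0E in pairE; lra.
- have := zpair_deriv_gegenbauerSS_mulX k.+1 Sx Sy; rewrite -mulrA IHk// -/rho => derivE.
  have := congr1 (zpair x y (C k.+3)^`()) (CSMX k).
  rewrite zpairZr zpairDr !zpairZr zpair_deriv_gegenbauerS// derivE.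
  rewrite (deriv_CSS k.+1) zpairDl zpairZl zpair_deriv_gegenbauerS//
    -(mulrA 2 (k%:R + lam)) (IHk k)//.
  rewrite (@zpair_gegenbauer_orth x y k.+2 k)//; last by lia.
  have := congr1 (fun p => lam * p.[rho]) (CSMX k).
  rewrite /= hornerD !hornerM !hornerC hornerX -/rho => recE pairE.
  have k2 : k%:R + 2 != 0 :> R by rewrite gt_eqF// ltr_wpDl.
  apply: (mulfI k2); lra.
Qed.

End gegenbauer_convolution.

(** * Zonal kernels *)

Section zonal_kernel.
Context {R : realType} {m : nat}.
Local Notation T := (m.+1.-tuple R).
Implicit Types (x y z : T) (mu : probability T R).

Definition zonal_kernel (psi : R -> R) x y : R := psi (inner (to_sphere x) (to_sphere y)).

Variables (mu0 : probability T R) (psi : R -> R) (c B Q : R).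
Variables p q : nat -> {poly R}.
Hypothesis mu0_unif : sphere_uniform mu0.
Hypothesis mpsi : measurable_fun setT psi.
Hypothesis psi_moment2 :
  (\int[mu0]_z ((psi (inner pole (to_sphere z))) ^+ 2)%:E = c%:E)%E.
Hypothesis psi_moment4_le :
  (\int[mu0]_z ((psi (inner pole (to_sphere z))) ^+ 4)%:E <= B%:E)%E.
Hypothesis psi_cvg : (fun k => (\int[mu0]_z ((psi (inner pole (to_sphere z)) -
  (p k).[inner pole (to_sphere z)]) ^+ 2)%:E)%E) @ \oo --> 0%E.
Hypothesis zpair_p1 : forall mu x k, sphere_uniform mu -> unit_sphere x ->
  zpair mu x x (p k) 1 = 0.
Hypothesis zpair_pp : forall mu x y k, sphere_uniform mu -> unit_sphere x ->
  unit_sphere y -> zpair mu x y (p k) (p k) = (q k).[inner x y].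
Hypothesis zpair_qq_le : forall mu x k, sphere_uniform mu -> unit_sphere x ->
  zpair mu x x (q k) (q k) <= Q.

Local Notation h := (zonal_kernel psi).

Definition zonal_conv x y : R :=
  limn (fun k => (q k).[inner (to_sphere x) (to_sphere y)]).

Lemma measurable_zonal_kernel (f : R -> R) : measurable_fun setT f ->
  measurable_fun setT (fun xy : T * T => zonal_kernel f xy.1 xy.2).
Proof.
move=> mf; apply: (measurableT_comp mf); apply: measurable_inner.
  by apply: (measurableT_comp measurable_to_sphere); exact: measurable_fst.
by apply: (measurableT_comp measurable_to_sphere); exact: measurable_snd.
Qed.

Lemma zonal_kernelC x y : h x y = h y x.
Proof. by rewrite /zonal_kernel innerC. Qed.

Lemma integral_zonal_kernel mu (f : R -> R) x : sphere_uniform mu ->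
  measurable_fun setT f -> (forall t, 0 <= f t) ->
  (\int[mu]_z (zonal_kernel f x z)%:E = \int[mu0]_z (f (inner pole (to_sphere z)))%:E)%E.
Proof.
move=> mu_unif mf f0.
apply: (@eq_integral_zonal _ _ mu mu0 (EFin \o f)) => //.
- exact/measurable_EFinP.
- exact: to_sphereP.
- exact: pole_sphere.
Qed.

Section fixed_law.
Variable mu : probability T R.
Hypothesis mu_unif : sphere_uniform mu.

Lemma integral_zonal_kernel4_le x : (\int[mu]_z (h x z ^+ 4)%:E <= B%:E)%E.
Proof.
rewrite (integral_zonal_kernel (f := fun t => psi t ^+ 4))//.
  exact: measurable_funX.
by move=> t; rewrite exprn_even_ge0.
Qed.

Let integral_zonal_kernel2 x : (\int[mu]_z (h x z ^+ 2)%:E = c%:E)%E.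
Proof.
rewrite (integral_zonal_kernel (f := fun t => psi t ^+ 2))//.
  exact: measurable_funX.
by move=> t; rewrite sqr_ge0.
Qed.

Lemma zonal_kernel_Lfun2 x : h x \in Lfun mu 2%:E.
Proof.
have mh : measurable_fun setT (h x).
  exact: (measurable_section (measurable_zonal_kernel mpsi)).
apply/Lfun_evenXP => //; split=> //; apply: (@ge0_Lfun1 _ _ _ _ _ c) => [|z|].
- exact: measurable_funX.
- exact: sqr_ge0.
- by rewrite integral_zonal_kernel2.
Qed.

Lemma Ex_zonal_kernel2 x : \int[mu]_z h x z ^+ 2 = c.
Proof. by rewrite /Rintegral integral_zonal_kernel2. Qed.

Let approx k x z := (p k).[inner (to_sphere x) (to_sphere z)].
Let error k x z := h x z - approx k x z.
Let error2 k := \int[mu0]_z error k pole z ^+ 2.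

Let approx_Lfun2 k x : approx k x \in Lfun mu 2%:E.
Proof. by apply: zonal_Lfun; rewrite ler1n. Qed.

Let error_Lfun2 k x : error k x \in Lfun mu 2%:E.
Proof. by apply: rpredB => //; exact: zonal_kernel_Lfun2. Qed.

Let Ex_error2 k x : \int[mu]_z error k x z ^+ 2 = error2 k.
Proof.
pose f t := (psi t - (p k).[t]) ^+ 2.
have mf : measurable_fun setT f.
  apply: measurable_funX; apply: measurable_funB => //.
  by apply: continuous_measurable_fun; exact: continuous_horner.
have f0 t : 0 <= f t by exact: sqr_ge0.
have fE mu' x' : sphere_uniform mu' -> \int[mu']_z error k x' z ^+ 2 =
    fine (\int[mu0]_z (f (inner pole (to_sphere z)))%:E)%E.
  by move=> mu'_unif; congr fine; exact: (integral_zonal_kernel (f := f)).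
by rewrite /error2 !fE.
Qed.

Let error2_cvg : error2 @ \oo --> (0 : R).
Proof.
have /fine_cvgP[_] := psi_cvg; apply: cvg_trans; apply: near_eq_cvg.
near=> k; rewrite /= /error2 /error /approx /zonal_kernel to_sphere_id//.
exact: pole_sphere.
Unshelve. all: by end_near. Qed.

Let sqrt_error2_cvg (a : R) : (fun k => Num.sqrt (a * error2 k)) @ \oo --> (0 : R).
Proof.
rewrite -[X in _ --> X]sqrtr0 -[X in Num.sqrt X](mulr0 a).
apply: continuous_cvg; first exact: sqrt_continuous.
by apply: cvgM => //; exact: cvg_cst.
Qed.

Lemma normr_conv_approx_le k x y :
  `|\int[mu]_z (h x z * h y z) - (q k).[inner (to_sphere x) (to_sphere y)]| <=
  2 * Num.sqrt (c * error2 k) + error2 k.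
Proof.
rewrite -(zpair_pp k mu_unif (to_sphereP x) (to_sphereP y)).
have Lh := zonal_kernel_Lfun2.
have L1M (u w : T -> R) : u \in Lfun mu 2%:E -> w \in Lfun mu 2%:E ->
  (fun z => u z * w z) \in Lfun mu 1 by move=> Lu Lw; exact: (LfunM (k := 0) Lu Lw).
have -> : \int[mu]_z (h x z * h y z) - zpair mu (to_sphere x) (to_sphere y) (p k) (p k) =
    \int[mu]_z (h y z * error k x z) + \int[mu]_z (h x z * error k y z) -
    \int[mu]_z (error k x z * error k y z).
  have Lyx := L1M _ _ (Lh y) (error_Lfun2 k x).
  have Lxy := L1M _ _ (Lh x) (error_Lfun2 k y).
  rewrite -(ExB (L1M _ _ (Lh x) (Lh y)) (L1M _ _ (approx_Lfun2 k x) (approx_Lfun2 k y))).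
  rewrite -(ExD Lyx Lxy) -ExB ?rpredD ?L1M//.
  by apply: eq_Rintegral => z _; rewrite /error /approx; ring.
have CS (u w : T -> R) b1 b2 : u \in Lfun mu 2%:E -> w \in Lfun mu 2%:E ->
    \int[mu]_z u z ^+ 2 = b1 -> \int[mu]_z w z ^+ 2 = b2 ->
    `|\int[mu]_z (u z * w z)| <= Num.sqrt (b1 * b2).
  by move=> Lu Lw <- <-; exact: normr_ExM_le.
have error2_ge0 : 0 <= error2 k by apply: Rintegral_ge0 => z _; rewrite sqr_ge0.
have := CS _ _ _ _ (Lh y) (error_Lfun2 k x) (Ex_zonal_kernel2 y) (Ex_error2 k x).
have := CS _ _ _ _ (Lh x) (error_Lfun2 k y) (Ex_zonal_kernel2 x) (Ex_error2 k y).
have := CS _ _ _ _ (error_Lfun2 k x) (error_Lfun2 k y) (Ex_error2 k x) (Ex_error2 k y).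
rewrite -[error2 k * error2 k]expr2 sqrtr_sqr (ger0_norm error2_ge0) => b12 b2 b1.
apply: le_trans (ler_normB _ _) _; apply: lerD => //.
by apply: le_trans (ler_normD _ _) _; rewrite mulrDl !mul1r; exact: lerD.
Qed.

Lemma conv_approx_cvg x y : (fun k => (q k).[inner (to_sphere x) (to_sphere y)])
  @ \oo --> \int[mu]_z (h x z * h y z).
Proof.
have bound_cvg : (fun k => 2 * Num.sqrt (c * error2 k) + error2 k) @ \oo --> (0 : R).
  rewrite -[X in _ --> X](addr0 (0 : R)); apply: cvgD => //.
  by rewrite -[X in _ --> X](mulr0 (2 : R)); apply: cvgM => //; exact: cvg_cst.
apply/cvgrPdist_le => e e0; near=> k.
apply: le_trans (normr_conv_approx_le k x y) _; apply/ltW.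
by near: k; exact: (cvgr_lt _ bound_cvg).
Unshelve. all: by end_near. Qed.

Lemma Ex_zonal_kernel x : \int[mu]_z h x z = 0.
Proof.
have Lh := zonal_kernel_Lfun2 x.
have Ex_le k : `|\int[mu]_z h x z| <= Num.sqrt (1 * error2 k).
  have Ex_approx : \int[mu]_z approx k x z = 0.
    rewrite -(zpair_p1 k mu_unif (to_sphereP x)); apply: eq_Rintegral => z _.
    by rewrite -polyC1 hornerC mulr1.
  have -> : \int[mu]_z h x z = \int[mu]_z (1 * error k x z).
    rewrite -[LHS]subr0 -Ex_approx -ExB; [|exact: Lfun21|exact: Lfun21].
    by apply: eq_Rintegral => z _; rewrite mul1r.
  apply: le_trans (normr_ExM_le (Lfun_cst _ _ _) (error_Lfun2 k x)) _.
  have -> : \int[mu]_z (cst 1 z : R) ^+ 2 = 1 by rewrite /cst expr1n Ex_cst.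
  by rewrite Ex_error2.
apply/eqP; rewrite -normr_le0; apply: cvgr_to_ge (sqrt_error2_cvg 1) _.
exact: nearW.
Qed.

End fixed_law.

Lemma Ex_zonal_kernelM mu x y : sphere_uniform mu ->
  \int[mu]_z (h x z * h y z) = zonal_conv x y.
Proof.
by move=> mu_unif; rewrite /zonal_conv (cvg_lim _ (@conv_approx_cvg mu mu_unif x y)).
Qed.

Lemma measurable_zonal_conv :
  measurable_fun setT (fun xy : T * T => zonal_conv xy.1 xy.2).
Proof.
apply: (@measurable_fun_cvg _ _ _ setT
  (fun k (xy : T * T) => zonal_kernel (fun t => (q k).[t]) xy.1 xy.2)).
  move=> k; apply: measurable_zonal_kernel.
  by apply: continuous_measurable_fun; exact: continuous_horner.
move=> [x y] _; rewrite -(Ex_zonal_kernelM _ _ mu0_unif).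
exact: conv_approx_cvg.
Qed.

Lemma integral_zonal_conv2_le mu x : sphere_uniform mu ->
  (\int[mu]_y (zonal_conv x y ^+ 2)%:E <= Q%:E)%E.
Proof.
move=> mu_unif; pose g k y := (q k).[inner (to_sphere x) (to_sphere y)].
have Lg k : g k \in Lfun mu 2%:E by apply: zonal_Lfun; rewrite ler1n.
apply: (integral_limit_le (f := fun k y => g k y ^+ 2)) => [k|k y|y|k].
- exact/measurable_funX/Lfun_measurable/Lg.
- exact: sqr_ge0.
- by rewrite -(Ex_zonal_kernelM _ _ mu_unif); apply: cvgM; exact: conv_approx_cvg.
- rewrite -Ex_EFin; last exact: Lfun_evenX (Lg k) isT isT.
  rewrite lee_fin; apply: le_trans (zpair_qq_le k mu_unif (to_sphereP x)).
  by under eq_Rintegral do rewrite expr2.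
Qed.

Lemma degenerate_zonal_kernel n (mu : 'I_n -> probability T R) :
  (forall i, sphere_uniform (mu i)) -> degenerate_kernel mu h zonal_conv c B Q.
Proof.
move=> mu_unif; split.
- exact: measurable_zonal_kernel.
- exact: zonal_kernelC.
- by move=> i; exact: Ex_zonal_kernel.
- by move=> i; exact: integral_zonal_kernel4_le.
- exact: measurable_zonal_conv.
- by move=> i y y'; exact: Ex_zonal_kernelM.
- move=> y; rewrite -(Ex_zonal_kernelM _ _ mu0_unif) -(Ex_zonal_kernel2 mu0_unif y).
  by apply: eq_Rintegral => z _; rewrite expr2.
- by move=> i y; exact: integral_zonal_conv2_le.
Qed.

End zonal_kernel.

Section zonal_sums.
Context {R : realType} {m : nat}.
Local Notation S := (@unit_sphere R m).
Implicit Types (x y : m.+1.-tuple R) (u w : nat -> R) (K : nat).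
Hypothesis m_ge2 : (2 <= m)%N.
Variable lam : R.
Hypothesis lamE : 2 * lam + 1 = m%:R.
Local Notation C := (gegenbauer_poly lam).

Let lam_gt0 : 0 < lam := gegenbauer_index_gt0 m_ge2 lamE.

Let coef k : R := 1 + k%:R / lam.

(* [(1 + k / lam) C_k] is the reproducing kernel of the spherical harmonics of
   degree k, so zonal convolution multiplies the weights. *)
Definition zonal_sum w K : {poly R} := \sum_(1 <= k < K.+1) (coef k * w k)%:P * C k.

Lemma horner_zonal_sum w K t :
  (zonal_sum w K).[t] = \sum_(1 <= k < K.+1) coef k * w k * (C k).[t].
Proof. by rewrite horner_sum; apply: eq_bigr => k _; rewrite hornerM hornerC. Qed.

Lemma psi_partial_zonal_sum (v : nat -> nat -> R) K t :
  psi_partial v m K t = (zonal_sum (fun k => v k m ^+ 2) K).[t].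
Proof.
rewrite horner_zonal_sum; apply: eq_bigr => k _.
have lam_half : lam = (m%:R - 1) / 2 by rewrite -lamE; field.
rewrite /psi_term m_ge2 gegenbauer_polyE -lam_half; congr (_ * _ * _).
have m1 : m%:R - 1 != 0 :> R by rewrite subr_eq0 pnatr_eq1; lia.
by rewrite /coef lam_half; field.
Qed.

Lemma measurable_psi_partial (v : nat -> nat -> R) K :
  measurable_fun setT (psi_partial v m K).
Proof.
rewrite (funext (psi_partial_zonal_sum v K)).
by apply: continuous_measurable_fun; exact: continuous_horner.
Qed.

Lemma zonal_sum_at1 w K :
  (zonal_sum w K).[1] = \sum_(1 <= k < K.+1) w k * (dkd k m)%:R.
Proof.
rewrite horner_zonal_sum; apply: eq_big_nat => k /andP[k0 _].
by rewrite -(dkd_gegenbauer m_ge2 lamE k0) /coef; ring.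
Qed.

Variable mu : probability (m.+1.-tuple R) R.
Hypothesis mu_unif : sphere_uniform mu.

Let zpair_suml x y (s : seq nat) (F : nat -> {poly R}) q :
  zpair mu x y (\sum_(k <- s) F k) q = \sum_(k <- s) zpair mu x y (F k) q.
Proof.
by apply: (big_morph (fun p => zpair mu x y p q)) => [p p'|]; rewrite ?zpairDl ?zpair0l.
Qed.

Lemma zpair_zonal_sum1 x w K : S x -> zpair mu x x (zonal_sum w K) 1 = 0.
Proof.
move=> Sx; rewrite zpair_suml big_nat big1// => k /andP[k0 _].
rewrite zpairZl -(gegenbauer_poly0 lam) (zpair_gegenbauer_orth mu_unif m_ge2 lamE)//.
  by rewrite mulr0.
by rewrite -lt0n.
Qed.

Lemma zpair_zonal_sum x y u w K : S x -> S y ->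
  zpair mu x y (zonal_sum u K) (zonal_sum w K) =
  (zonal_sum (fun k => u k * w k) K).[inner x y].
Proof.
move=> Sx Sy; rewrite zpair_suml horner_zonal_sum; apply: eq_big_nat => k kK.
rewrite zpairZl zpairC zpair_suml (bigD1_seq k) ?iota_uniq ?mem_index_iota//=.
rewrite big1 => [|l lk]; last first.
  by rewrite zpairZl zpairC (zpair_gegenbauer_orth mu_unif m_ge2 lamE) ?mulr0// eq_sym.
rewrite addr0 zpairZl zpairC.
have := zpair_gegenbauer_conv mu_unif m_ge2 lamE k Sx Sy.
have kl : k%:R + lam != 0 by rewrite gt_eqF// ltr_wpDl.
move=> /(canRL (mulKf kl)) ->; rewrite /coef.
by field; rewrite kl gt_eqF.
Qed.

End zonal_sums.

Section spherical_kernel.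
Context {R : realType} {m n : nat}.
Variables (mu : 'I_n -> probability (m.+1.-tuple R) R).
Variable mu0 : probability (m.+1.-tuple R) R.
Variables (psi : R -> R) (v : nat -> nat -> R) (c B Q : R).
Hypothesis m_ge2 : (2 <= m)%N.
Hypothesis mu_unif : forall i, sphere_uniform (mu i).
Hypothesis mu0_unif : sphere_uniform mu0.
Hypothesis mpsi : measurable_fun setT psi.
Hypothesis psi_moment2 :
  (\int[mu0]_z ((psi (inner pole (to_sphere z))) ^+ 2)%:E = c%:E)%E.
Hypothesis psi_moment4_le :
  (\int[mu0]_z ((psi (inner pole (to_sphere z))) ^+ 4)%:E <= B%:E)%E.
Hypothesis psi_cvg : (fun K => (\int[mu0]_z ((psi (inner pole (to_sphere z)) -
  psi_partial v m K (inner pole (to_sphere z))) ^+ 2)%:E)%E) @ \oo --> 0%E.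
Hypothesis v8_le : forall K, \sum_(1 <= k < K.+1) v k m ^+ 8 * (dkd k m)%:R <= Q.

Let lam : R := (m%:R - 1) / 2.
Let lamE : 2 * lam + 1 = m%:R. Proof. by rewrite /lam; field. Qed.

Definition spherical_conv : m.+1.-tuple R -> m.+1.-tuple R -> R :=
  zonal_conv (zonal_sum lam (fun k => v k m ^+ 4)).

Lemma degenerate_spherical_kernel :
  degenerate_kernel mu (zonal_kernel psi) spherical_conv c B Q.
Proof.
apply: (@degenerate_zonal_kernel _ _ mu0 _ _ _ _ (zonal_sum lam (fun k => v k m ^+ 2)))
  => //.
- apply: cvg_trans psi_cvg; apply: near_eq_cvg; apply: nearW => K.
  by apply: eq_integral => z _; rewrite (psi_partial_zonal_sum m_ge2 lamE).
- by move=> mu' x k unif' Sx; exact: zpair_zonal_sum1.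
- move=> mu' x y k unif' Sx Sy; rewrite (zpair_zonal_sum m_ge2 lamE unif')//.
  by congr (zonal_sum lam _ k).[_]; apply/funext => l; rewrite -exprD.
- move=> mu' x k unif' Sx; rewrite (zpair_zonal_sum m_ge2 lamE unif')//.
  rewrite [inner x x]Sx (zonal_sum_at1 m_ge2 lamE); apply: le_trans (v8_le k).
  by rewrite le_eqVlt; apply/orP; left; apply/eqP; apply: eq_bigr => l _; rewrite -exprD.
Qed.

End spherical_kernel.

Lemma half_sum_symmetric (R : numFieldType) (n : nat) (F : 'I_n -> 'I_n -> R) :
  (forall i j, F i j = F j i) -> (forall i, F i i = 0) ->
  2^-1 * \sum_i \sum_j F i j = \sum_(i < n) \sum_(j < n | (i < j)%N) F i j.
Proof.
move=> FC F0; set upper := RHS.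
have -> : \sum_i \sum_j F i j = upper + \sum_(i < n) \sum_(j < n | (j < i)%N) F i j.
  rewrite -big_split/=; apply: eq_bigr => i _.
  rewrite (bigID (fun j : 'I_n => (i < j)%N))/=; congr (_ + _).
  rewrite (bigD1 i) ?ltnn//= F0 add0r; apply: eq_bigl => j.
  by rewrite -leqNgt ltn_neqAle andbC; congr (_ && _).
have -> : \sum_(i < n) \sum_(j < n | (j < i)%N) F i j = upper.
  rewrite (exchange_big_dep predT)//=; apply: eq_bigr => i _.
  by apply: eq_bigr => j _.
by field.
Qed.

Section spherical_statistic.
Context {R : realType} {d0 : measure_display} {Omega : measurableType d0}.
Variables (P : probability Omega R) (m n : nat) (X : nat -> Omega -> m.+1.-tuple R).
Variables (psi : R -> R) (sigma2 : R).
Local Notation T := (m.+1.-tuple R).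
Local Notation S := (@unit_sphere R m).
Hypothesis mX : forall i, (i < n)%N -> measurable_fun setT (X i).
Hypothesis indX : mutually_independent P n X.
Hypothesis unifX : forall i, (i < n)%N -> uniform_on_sphere P (X i).
Hypothesis mpsi : measurable_fun setT psi.
Local Notation mu := (marginal P mX).
Local Notation nu := (sample_law P mX).

Lemma marginal_sphere_uniform i : sphere_uniform (mu i).
Proof.
by have [_ XS XQ] := unifX (ltn_ord i); split=> // Q oQ A mA; exact: XQ.
Qed.

Lemma ae_sample_sphere : {ae P, forall w, forall i : 'I_n, S (X i w)}.
Proof.
apply: filter_forall => i; have [_ XS _] := unifX (ltn_ord i).
have mS : measurable (X i @^-1` S).
  rewrite -[X in measurable X]setTI; apply: mX => //; exact: measurable_sphere.
exists (~` (X i @^-1` S)); split; first exact: measurableC.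
- by rewrite [LHS](probability_setC P mS) [X in (_ - X)%E]XS subee.
- by move=> w.
Qed.

Lemma integral_inner_pair (i j : 'I_n) (f : R -> R) : i != j ->
  measurable_fun setT f -> (forall t, 0 <= f t) ->
  (\int[P]_w (f (inner (X i w) (X j w)))%:E =
   \int[mu i]_z (f (inner pole (to_sphere z)))%:E)%E.
Proof.
move=> ij mf f0; pose F (x : n.-tuple T) := at_pair (zonal_kernel f) i j x.
have mF : measurable_fun setT (EFin \o F).
  apply/measurable_EFinP; exact: (measurable_at_pair (measurable_zonal_kernel mf)).
have F0 x : (0 <= (EFin \o F) x)%E by rewrite lee_fin; exact: f0.
transitivity (\int[P]_w (EFin \o F) (sample X w : n.-tuple T))%E.
  apply: ae_eq_integral => //.
  - apply/measurable_EFinP/(measurableT_comp mf).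
    by apply: measurable_inner; exact: mX.
  - by apply: (measurableT_comp mF); exact: measurable_sample.
  - apply: filterS ae_sample_sphere => w Sw _.
    by rewrite /F /at_pair /zonal_kernel /= !tnth_mktuple !to_sphere_id.
rewrite -ge0_integral_sample//.
rewrite (ge0_integral_resample (sample_law_resample_invariant mX indX) j mF F0).
transitivity (\int[nu]_x cst (\int[mu i]_z (f (inner pole (to_sphere z)))%:E)%E x)%E.
  apply: eq_integral => x _ /=.
  under eq_integral do rewrite /F at_pair_resample//.
  apply: (@eq_integral_zonal _ _ (mu j) (mu i) (EFin \o f)) => //.
  - exact: marginal_sphere_uniform.
  - exact: marginal_sphere_uniform.
  - exact/measurable_EFinP.
  - exact: to_sphereP.
  - exact: pole_sphere.
by rewrite integral_cst// [X in (_ * X)%E](probability_setT nu) mule1.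
Qed.

Definition standardized_kernel (y z : T) : R :=
  2 / n%:R / Num.sqrt sigma2 * zonal_kernel psi y z.

Lemma Tstat_ustat w : (forall i : 'I_n, S (X i w)) ->
  (Num.sqrt sigma2)^-1 * Tstat n psi X w =
  ustat standardized_kernel (sample X w : n.-tuple T).
Proof.
move=> Sw; rewrite /ustat /row_sum half_sum_symmetric => [|i j|i]; last 2 first.
- have [->//|ij] := eqVneq i j.
  rewrite (offdiag_neq _ ij) offdiag_neq; last by rewrite eq_sym.
  by rewrite /at_pair /standardized_kernel zonal_kernelC.
- exact: offdiagii.
rewrite /Tstat mulrA mulr_sumr; apply: eq_bigr => i _.
rewrite mulr_sumr; apply: eq_bigr => j ij.
rewrite offdiag_neq; last by rewrite neq_ltn ij.
rewrite /at_pair /standardized_kernel /zonal_kernel !tnth_mktuple !to_sphere_id//.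
by ring.
Qed.

Lemma measurable_standardized_ustat :
  measurable_fun setT (ustat standardized_kernel : n.-tuple T -> R).
Proof.
have mk : measurable_fun setT (fun p : T * T => standardized_kernel p.1 p.2).
  by apply: measurable_funM => //; exact: measurable_zonal_kernel.
apply: measurable_funM => //; apply: measurable_sum => i.
apply: measurable_sum => j; rewrite /offdiag; case: eqP => _.
  exact: measurable_cst.
exact: measurable_at_pair.
Qed.

Lemma measurable_Tstat : measurable_fun setT (Tstat n psi X).
Proof.
apply: measurable_funM => //; apply: measurable_sum => i.
rewrite (_ : (fun w => _) = fun w => \sum_(j < n)
    (i < j)%N%:R * psi (inner (X i w) (X j w))); last first.
  apply/funext => w; rewrite big_mkcond; apply: eq_bigr => j _.
  by case: (i < j)%N; rewrite ?mul1r ?mul0r.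
apply: measurable_sum => j; apply: measurable_funM => //.
by apply: (measurableT_comp mpsi); apply: measurable_inner; exact: mX.
Qed.

Lemma integral_Tstat (f : R -> R) (M : R) : continuous f -> (forall t, `|f t| <= M) ->
  (\int[P]_w (f ((Num.sqrt sigma2)^-1 * Tstat n psi X w))%:E)%E =
  (\int[nu]_x f (ustat standardized_kernel x))%:E.
Proof.
move=> cf fM; have mf := continuous_measurable_fun cf.
have mfu := measurableT_comp mf measurable_standardized_ustat.
rewrite Ex_EFin; last exact: Lfun_bounded mfu (fun x => fM _) (lexx _).
have mfus := measurableT_comp mfu (measurable_sample mX).
rewrite (@integral_sample _ _ _ _ _ _ _ mX (EFin \o (f \o ustat standardized_kernel)));
  last 2 first.
- exact/measurable_EFinP.
- exact/Lfun1_integrable/(Lfun_bounded _ mfus (fun w => fM _))/lexx.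
apply: ae_eq_integral => //.
- apply/measurable_EFinP/(measurableT_comp mf).
  by apply: measurable_funM => //; exact: measurable_Tstat.
- exact/measurable_EFinP.
- by apply: filterS ae_sample_sphere => w /Tstat_ustat -> _.
Qed.

Variables (v : nat -> nat -> R) (C q : R).
Hypothesis m_ge2 : (2 <= m)%N.
Hypothesis n_ge2 : (2 <= n)%N.
Hypothesis sigma2_gt0 : 0 < sigma2.
Hypothesis psi_cvg : (fun K => (\int[P]_w ((psi (inner (X 0 w) (X 1 w)) -
  psi_partial v m K (inner (X 0 w) (X 1 w))) ^+ 2)%:E)%E) @ \oo --> 0%E.
Hypothesis psi_moment2 :
  (\int[P]_w ((psi (inner (X 0 w) (X 1 w))) ^+ 2)%:E = (sigma2 / 2)%:E)%E.
Hypothesis psi_moment4_le :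
  (\int[P]_w ((psi (inner (X 0 w) (X 1 w))) ^+ 4)%:E <= (C * sigma2 ^+ 2)%:E)%E.
Hypothesis v8_le : forall K,
  \sum_(1 <= k < K.+1) v k m ^+ 8 * (dkd k m)%:R <= q * sigma2 ^+ 2.

Definition standardized_conv (y z : T) : R :=
  (2 / n%:R / Num.sqrt sigma2) ^+ 2 * spherical_conv v y z.

Lemma degenerate_standardized_kernel :
  degenerate_kernel mu standardized_kernel standardized_conv
    (2 / n%:R ^+ 2) (16 * C / n%:R / n%:R ^+ 3) (16 * q / n%:R ^+ 4).
Proof.
pose i0 : 'I_n := Ordinal (ltnW n_ge2); pose i1 : 'I_n := Ordinal n_ge2.
have pairE (f : R -> R) : measurable_fun setT f -> (forall t, 0 <= f t) ->
    (\int[mu i0]_z (f (inner pole (to_sphere z)))%:E =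
     \int[P]_w (f (inner (X 0 w) (X 1 w)))%:E)%E.
  by move=> mf f0; rewrite -(@integral_inner_pair i0 i1).
have n_neq0 : n%:R != 0 :> R by rewrite pnatr_eq0 -lt0n ltnW.
have sigma2_neq0 : sigma2 != 0 by rewrite gt_eqF.
pose a := 2 / n%:R / Num.sqrt sigma2.
have a2E : a ^+ 2 = 4 / n%:R ^+ 2 / sigma2.
  by rewrite /a !exprMn !exprVn sqr_sqrtr ?ltW//; congr (_ / _ / _); ring.
have a4E : a ^+ 4 = 16 / n%:R ^+ 4 / sigma2 ^+ 2.
  by rewrite -[4%N]/(2 * 2)%N exprM a2E; field; rewrite sigma2_neq0 n_neq0.
have -> : 2 / n%:R ^+ 2 = a ^+ 2 * (sigma2 / 2).
  by rewrite a2E; field; rewrite sigma2_neq0 n_neq0.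
have -> : 16 * C / n%:R / n%:R ^+ 3 = a ^+ 4 * (C * sigma2 ^+ 2).
  by rewrite a4E; field; rewrite sigma2_neq0 n_neq0.
have -> : 16 * q / n%:R ^+ 4 = a ^+ 4 * (q * sigma2 ^+ 2).
  by rewrite a4E; field; rewrite sigma2_neq0 n_neq0.
apply/degenerate_kernelZ/(@degenerate_spherical_kernel _ _ _ _ (mu i0)) => //.
- exact: marginal_sphere_uniform.
- exact: marginal_sphere_uniform.
- rewrite (pairE (fun t => psi t ^+ 2))//; first exact: measurable_funX.
  by move=> t; exact: sqr_ge0.
- rewrite (pairE (fun t => psi t ^+ 4))//; first exact: measurable_funX.
  by move=> t; exact: exprn_even_ge0.
- apply: cvg_trans psi_cvg; apply: near_eq_cvg; apply: nearW => K.
  rewrite (pairE (fun t => (psi t - psi_partial v m K t) ^+ 2))//.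
    apply: measurable_funX; apply: measurable_funB => //.
    by apply: (measurable_psi_partial m_ge2 (lam := (m%:R - 1) / 2)); field.
  by move=> t; exact: sqr_ge0.
Qed.

End spherical_statistic.

Lemma cvg_natX_divX (R : realType) (u : nat -> R) (l : R) (k : nat) :
  u @ \oo --> l -> (fun n => n%:R ^+ k * (u n / n%:R ^+ k)) @ \oo --> l.
Proof.
apply: cvg_trans; apply: near_eq_cvg; near=> n.
rewrite mulrC divfK// expf_neq0// pnatr_eq0 -lt0n.
by near: n; exact: nbhs_infty_gt.
Unshelve. all: by end_near. Qed.

Lemma partial_sum_le_nneseries (R : realType) (a : R) (u : nat -> R) (K : nat) :
  0 < a -> (forall k, 0 <= u k) ->
  ((a^-1)%:E * \sum_(1 <= k <oo) (u k)%:E)%E \is a fin_num ->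
  \sum_(1 <= k < K.+1) u k <= fine ((a^-1)%:E * \sum_(1 <= k <oo) (u k)%:E)%E * a.
Proof.
move=> a0 u0 fin_sum; rewrite -lee_fin EFinM fineK// muleC muleA -EFinM divff ?gt_eqF//.
rewrite mul1e -sumEFin; apply: nneseries_lim_ge => k _.
by rewrite lee_fin.
Qed.

Section spherical_statistic_clt.
Context {R : realType} {d0 : measure_display}.
Variables (dn : nat -> nat) (Omega : nat -> measurableType d0).
Variables (P : forall n, probability (Omega n) R).
Variables (X : forall n, nat -> Omega n -> (dn n).+1.-tuple R).
Variables (v : nat -> nat -> R) (psi : nat -> R -> R) (sigma2 q : nat -> R) (C : R).
Hypothesis dn_ge2 : \forall n \near \oo, (2 <= dn n)%N.
Hypothesis indX : forall n, mutually_independent (P n) n (@X n).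
Hypothesis unifX : forall n i, (i < n)%N -> uniform_on_sphere (P n) (@X n i).
Hypothesis mpsi : forall n, measurable_fun setT (psi n).
Local Notation X12 n w := (inner (@X n 0 w) (@X n 1 w)).
Hypothesis psi_cvg : forall n, (2 <= n)%N -> (fun K => (\int[P n]_w
  ((psi n (X12 n w) - psi_partial v (dn n) K (X12 n w)) ^+ 2)%:E)%E) @ \oo --> 0%E.
Hypothesis sigma2_gt0 : forall n, 0 < sigma2 n.
Hypothesis psi_moment2 : forall n, (2 <= n)%N ->
  (\int[P n]_w ((psi n (X12 n w)) ^+ 2)%:E = (sigma2 n / 2)%:E)%E.
Hypothesis psi_moment4_le : \forall n \near \oo,
  (\int[P n]_w ((psi n (X12 n w)) ^+ 4)%:E <= (C * sigma2 n ^+ 2)%:E)%E.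
Hypothesis v8_le : \forall n \near \oo, forall K,
  \sum_(1 <= k < K.+1) v k (dn n) ^+ 8 * (dkd k (dn n))%:R <= q n * sigma2 n ^+ 2.
Hypothesis q_cvg : q @ \oo --> (0 : R).

Lemma spherical_statistic_clt (f : R -> R) : continuous f ->
  (exists M : R, forall x, `|f x| <= M) ->
  (fun n => (\int[P n]_w (f ((Num.sqrt (sigma2 n))^-1 * Tstat n (psi n) (@X n) w))%:E)%E)
  @ \oo --> (\int[normal_prob 0 1]_x (f x)%:E)%E.
Proof.
move=> cf [M fM]; have mX n i : (i < n)%N -> measurable_fun setT (@X n i).
  by move=> ni; have [] := unifX ni.
pose nu n := sample_law (P n) (mX n).
pose h n := standardized_kernel (m := dn n) n (psi n) (sigma2 n).
have B_cvg : (fun n => 16 * C / n%:R) @ \oo --> (0 : R).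
  rewrite -[X in _ --> X](mulr0 (16 * C)).
  by apply: cvgM; [exact: cvg_cst|exact: cvg_natV].
have Q_cvg : (fun n => 16 * q n) @ \oo --> (0 : R).
  by rewrite -[X in _ --> X](mulr0 (16 : R)); apply: cvgM => //; exact: cvg_cst.
have clt : cvg_in_law nu (fun n => ustat (h n)) (normal_prob 0 1).
  apply: (@degenerate_ustat_clt _ _ _ _ (fun n => marginal (P n) (mX n)) h
    (fun n => standardized_conv (m := dn n) n (sigma2 n) v) (fun n => 2 / n%:R ^+ 2)
    (fun n => 16 * C / n%:R / n%:R ^+ 3) (fun n => 16 * q n / n%:R ^+ 4)).
  - by move=> n; exact: sample_law_resample_invariant.
  - near=> n; have n_ge2 : (2 <= n)%N by near: n; exact: nbhs_infty_ge.
    apply: degenerate_standardized_kernel => //.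
    + by move=> i; exact: unifX.
    + by near: n.
    + exact: psi_cvg.
    + exact: psi_moment2.
    + by near: n.
    + by near: n.
  - by apply: (@cvg_natX_divX _ (cst 2)); exact: cvg_cst.
  - exact: cvg_natX_divX B_cvg.
  - exact: cvg_natX_divX Q_cvg.
have mf : measurable_fun setT (f : measurableTypeR R -> R).
  exact: continuous_measurable_fun.
have Lf := @Lfun_bounded _ _ _ (normal_prob 0 1) 1 _ _ mf fM (lexx _).
rewrite -(Ex_EFin Lf) (_ : (fun n => _) =
    EFin \o (fun n => \int[nu n]_x f (ustat (h n) x))).
  by apply: cvg_EFin; [exact: nearW|apply: clt => //; exists M].
apply/funext => n; exact: (integral_Tstat _ (mX n) (@unifX n) (mpsi n) cf fM).
Unshelve. all: by end_near. Qed.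

End spherical_statistic_clt.

Theorem theorem1 (R : realType) (dn : nat -> nat)
  (d0 : measure_display) (Omega : nat -> measurableType d0)
  (P : forall n, probability (Omega n) R)
  (X : forall n, nat -> Omega n -> (dn n).+1.-tuple R)
  (v : nat -> nat -> R) (psi : nat -> R -> R) :
  (* d_n positive integers, d_n -> oo *)
  (forall n, (0 < dn n)%N) ->
  (forall M : nat, exists N : nat, forall n, (N <= n)%N -> (M <= dn n)%N) ->
  (* X_{n,1..n} mutually independent, uniform on S^{d_n} *)
  (forall n, mutually_independent (P n) n (X n)) ->
  (forall n i, (i < n)%N -> uniform_on_sphere (P n) (X n i)) ->
  (* psi_n is the L^2 sum of its defining series *)
  (forall n, measurable_fun setT (psi n)) ->
  (forall n, (2 <= n)%N ->
     (fun K => (\int[P n]_w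
        ((psi n (inner (X n 0 w) (X n 1 w))
          - psi_partial v (dn n) K (inner (X n 0 w) (X n 1 w))) ^+ 2)%:E)%E)
     @ \oo --> 0%E) ->
  (* (i) *)
  (forall n, (\sum_(1 <= k <oo) ((v k (dn n)) ^+ 4 * (dkd k (dn n))%:R)%:E
               < +oo)%E) ->
  (forall n, (2 <= n)%N ->
     (\int[P n]_w ((psi n (inner (X n 0 w) (X n 1 w))) ^+ 2)%:E
      = \sum_(1 <= k <oo) ((v k (dn n)) ^+ 4 * (dkd k (dn n))%:R)%:E)%E) ->
  (* sigma_n > 0 (implicit: sigma_n^{-1}, sigma_n^{-4} are used) *)
  (forall n, (0 < \sum_(1 <= k <oo) ((v k (dn n)) ^+ 4 * (dkd k (dn n))%:R)%:E)%E) ->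
  let sigma2 := fun n =>
    2 * fine (\sum_(1 <= k <oo) ((v k (dn n)) ^+ 4 * (dkd k (dn n))%:R)%:E)%E in
  (* (ii) *)
  ((fun n => ((sigma2 n) ^-2)%:E *
      \sum_(1 <= k <oo) ((v k (dn n)) ^+ 8 * (dkd k (dn n))%:R)%:E)%E
     @ \oo --> 0%E) ->
  (exists C : R, \forall n \near \oo,
     (((sigma2 n) ^-2)%:E *
       \int[P n]_w ((psi n (inner (X n 0 w) (X n 1 w))) ^+ 4)%:E
      <= C%:E)%E) ->
  (* conclusion: sigma_n^{-1} T_n converges weakly to N(0,1) *)
  forall f : R -> R, continuous f -> (exists M : R, forall x, `|f x| <= M) ->
    (fun n => (\int[P n]_w
        (f ((Num.sqrt (sigma2 n))^-1 * Tstat n (psi n) (X n) w))%:E)%E)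
    @ \oo --> (\int[normal_prob 0 1]_x (f x)%:E)%E.
Proof.
move=> _ dn_oo indX unifX mpsi psi_cvg v4_lty psi2 v4_gt0 sigma2 v8_cvg [C psi4_le] f cf.
have sigma2_gt0 n : 0 < sigma2 n by rewrite mulr_gt0// fine_gt0// v4_gt0 v4_lty.
have /fine_cvgP[v8_fin q_cvg] := v8_cvg.
apply: (spherical_statistic_clt (C := C) _ indX unifX mpsi psi_cvg sigma2_gt0
  _ _ _ q_cvg cf).
- by have [N dn_ge2] := dn_oo 2; exists N.
- move=> n n2; rewrite psi2// /sigma2 mulrC mulKf// fineK//.
  by rewrite ge0_fin_numE ?v4_lty// ltW.
- apply: filterS psi4_le => n.
  by rewrite lee_pdivrMl ?exprn_gt0// -EFinM mulrC.
- apply: filterS v8_fin => n v8_fin K.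
  apply: partial_sum_le_nneseries => // [|k]; first exact: exprn_gt0.
  by rewrite mulr_ge0// exprn_even_ge0.
Qed.
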